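(* Let $\mu\in(0,1)$ and consider the planar circular restricted three body problem with Hamiltonian $H$. For every $c<H(L_1)$ both regularized energy hypersurfaces $\overline{\Sigma}_c^E$ and $\overline{\Sigma}_c^M$ admit a compatible contact form $\lambda$. Moreover, there exists $\epsilon>0$ such that for every $c\in(H(L_1),H(L_1)+\epsilon)$ the regularized energy hypersurface $\overline{\Sigma}_c^{E,M}$ admits a compatible contact form.
   Context: Setting. Fix $\mu\in(0,1)$, $E=(\mu,0)$ (earth, mass $1-\mu$), $M=(-(1-\mu),0)$ (moon, mass $\mu$). On $(\mathbb{R}^2\setminus\{E,M\})\times\mathbb{R}^2\ni(q,p)$ with symplectic form $\omega=dp_1\wedge dq_1+dp_2\wedge dq_2$ let $$H(q,p)=\tfrac12|p|^2-\frac{1-\mu}{|q-E|}-\frac{\mu}{|q-M|}+p_1q_2-p_2q_1=\tfrac12\big((p_1+q_2)^2+(p_2-q_1)^2\big)+U(q),$$ $$U(q)=-\frac{1-\mu}{|q-E|}-\frac{\mu}{|q-M|}-\tfrac12|q|^2 .$$ $\ell^1$ is the critical point of $U$ on the open segment between $E$ and $M$, and $L_1=(\ell^1_1,\ell^1_2,-\ell^1_2,\ell^1_1)$ is the corresponding critical point of $H$ (in coordinates $(q_1,q_2,p_1,p_2)$), so $H(L_1)=U(\ell^1)$. Put $\Sigma_c=H^{-1}(c)$, let $\pi(q,p)=q$, and let $\mathcal{K}_c=\pi(\Sigma_c)=\{q: U(q)\le c\}$ be the Hill's region. For $c<H(L_1)$, $\mathcal{K}_c$ has three connected components: an unbounded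 one and two bounded ones $\mathcal{K}_c^E,\mathcal{K}_c^M$ with $E\in\mathrm{cl}(\mathcal{K}_c^E)$, $M\in\mathrm{cl}(\mathcal{K}_c^M)$; put $\Sigma_c^E=\pi^{-1}(\mathcal{K}_c^E)\cap\Sigma_c$, $\Sigma_c^M=\pi^{-1}(\mathcal{K}_c^M)\cap\Sigma_c$. For $c$ slightly above $H(L_1)$, $\mathcal{K}_c$ has one bounded component, whose closure contains both $E$ and $M$, and one unbounded component; $\Sigma_c^{E,M}$ is the part of $\Sigma_c$ lying over the bounded component. Moser regularization. For a primary $P\in\{E,M\}$ put $x=-p$, $y=q-P$, and let $(\xi,\eta)\in T^*S^2$ (with $\xi=(\xi_0,\xi_1,\xi_2)\in S^2\subset\mathbb{R}^3$, $\eta\in\mathbb{R}^3$, $\xi\cdot\eta=0$, $TS^2$ and $T^*S^2$ being identified by the round metric) be determined by $x_k=\xi_k/(1-\xi_0)$, $y_k=\eta_k(1-\xi_0)+\xi_k\eta_0$, $k=1,2$ (the cotangent lift of inverse stereographic projection from the north pole $N=(1,0,0)$). This defines a symplectic embedding $\Phi_P:(q,p)\mapsto(\xi,\eta)$ into $T^*S^2$ with symplectic form $d(\eta\, d\xi)$, where $\eta\,d\xi$ is the canonical 1-form. For $c<H(L_1)$, $\overline{\Sigma}_c^P$ ($P=E,M$) is the closure of $\Phi_P(\Sigma_c^P)$ in $T^*S^2$; it is a closed hypersurface obtained by adding a circle in the fibre over $N$ (collisions), and is endowed with the restriction of the symplectic form. For $c>H(L_1)$ close to $H(L_1)$, $\overline{\Sigma}_c^{E,M}$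 is the closed 3-manifold obtained from $\Sigma_c^{E,M}$ by performing the same completion near both primaries (i.e. replacing, for small $\delta>0$ and each $P\in\{E,M\}$, the part of $\Sigma_c^{E,M}$ with $|q-P|<\delta$ by its completion in $T^*S^2$ through $\Phi_P$, adding a circle over $N$), with the closed two-form extending $\omega|_{\Sigma_c^{E,M}}$. Definitions. A Hamiltonian structure on a $(2n+1)$-dimensional manifold is a closed two-form whose kernel is a one-dimensional distribution; the two-forms above are Hamiltonian structures ($n=1$). A contact form is a 1-form $\lambda$ with $\lambda\wedge(d\lambda)^n$ a volume form. A contact form $\lambda$ is compatible with the Hamiltonian structure $\omega$ if $d\lambda=\omega$; here ''compatible'' refers to the Hamiltonian structure just described. *)

(* Defs.v *)
From HB Require Import structures.
From mathcomp Require Import all_boot all_order all_algebra.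
From mathcomp Require Import all_classical all_reals all_analysis.
From mathcomp Require Import ring.

Set Implicit Arguments.
Unset Strict Implicit.
Unset Printing Implicit Defensive.

Import Order.TTheory GRing.Theory Num.Theory.
Import numFieldNormedType.Exports.

Local Open Scope classical_set_scope.
Local Open Scope ring_scope.

(* Submanifolds of a finite-dimensional normed space V are given as subsets
   S : set V.  A 1-form on S is a function lam : V -> V -> R of a base point and
   a vector, and a 2-form is a function V -> V -> V -> R; only their values at
   points of S on vectors tangent to S are ever used. *)
Section FormsOnSubmanifolds.
Context {R : realType} {V W : normedModType R}.

(* iterD [:: v1; ...; vk] f is the iterated derivative D_v1 (... (D_vk f)). *)
Definition iterD (vs : seq V) (f : V -> R) : V -> R :=
  foldr (fun v (g : V -> R) => (fun z => 'D_v g z)) f vs.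

(* C^infinity on an open set. *)
Definition smooth_on (A : set V) (f : V -> R) :=
  forall (vs : seq V) (z : V), A z -> differentiable (iterD vs f) z.

Definition smooth_form_on (A : set V) (a : V -> V -> R) :=
  (forall z, A z -> scalar (a z)) /\ (forall v, smooth_on A (fun z => a z v)).

(* The sign is the one for which d(f dg) = df /\ dg, with
   (df /\ dg)(u, v) = df(u) dg(v) - df(v) dg(u). *)
Definition ext_d (a : V -> V -> R) (z u v : V) : R :=
  'D_u (fun x => a x v) z - 'D_v (fun x => a x u) z.

(* Velocities of the curves in S through z.  At a point of an embedded
   submanifold these form the tangent space T_z S. *)
Definition tangent (S : set V) (z v : V) :=
  exists g : R -> V,
    [/\ g 0 = z, \forall t \near (0 : R), S (g t) & is_derive (0 : R) 1 g v].

(* lam is a smooth 1-form on S and d lam = om on S: near each point of S, lam is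
   the restriction to S of a smooth form a of the ambient space and om is the
   restriction of d a.  On an embedded submanifold the restriction of d a does
   not depend on the choice of a, since d commutes with restriction. *)
Definition has_ext_d (S : set V) (lam : V -> V -> R) (om : V -> V -> V -> R) :=
  forall z, S z -> exists (A : set V) (a : V -> V -> R),
    [/\ open A, A z, smooth_form_on A a &
      forall x, A x -> S x ->
        (forall u, tangent S x u -> lam x u = a x u) /\
        (forall u v, tangent S x u -> tangent S x v -> om x u v = ext_d a x u v)].

Definition wedge12 (lam : V -> V -> R) (om : V -> V -> V -> R) (z u v w : V) : R :=
  lam z u * om z v w - lam z v * om z u w + lam z w * om z u v.

(* For S of dimension 3: the 3-form vol vanishes at no point of S. *)
Definition volume_form (S : set V) (vol : V -> V -> V -> V -> R) :=
  forall z, S z -> exists u v w,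
    [/\ tangent S z u, tangent S z v, tangent S z w & vol z u v w != 0].

Definition contact_form (S : set V) (lam : V -> V -> R) :=
  exists2 dlam, has_ext_d S lam dlam & volume_form S (wedge12 lam dlam).

Definition compatible (S : set V) (om : V -> V -> V -> R) (lam : V -> V -> R) :=
  has_ext_d S lam om.

(* lam = f^* lam' on S. *)
Definition is_pullback (S : set V) (f : V -> W) (lam : V -> V -> R)
    (lam' : W -> W -> R) :=
  forall z v, S z -> tangent S z v -> lam z v = lam' (f z) ('D_v f z).

End FormsOnSubmanifolds.

(* Pairs (q, p); the coordinates q_1, q_2 of z are z.1 0 0, z.1 0 1. *)
Notation phase R := ('rV[R]_2 * 'rV[R]_2)%type.
(* Pairs (xi, eta); xi_0 is the first block of xi, (xi_1, xi_2) the second. *)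
Notation amb R := ('rV[R]_(1 + 2) * 'rV[R]_(1 + 2))%type.

Section ThreeBody.
Context {R : realType}.

(* The library norm on row vectors is the sup norm, hence these definitions. *)
Definition dot {n} (u v : 'rV[R]_n) : R := \sum_i u 0 i * v 0 i.
Definition enorm {n} (u : 'rV[R]_n) : R := Num.sqrt (dot u u).

Definition vec2 (a b : R) : 'rV[R]_2 := \row_i (if i == 0 then a else b).

Local Notation phase := (phase R).
Local Notation amb := (amb R).

Definition earth (mu : R) : 'rV[R]_2 := vec2 mu 0.
Definition moon (mu : R) : 'rV[R]_2 := vec2 (- (1 - mu)) 0.

Definition Ham (mu : R) (z : phase) : R :=
  let q := z.1 in let p := z.2 in
  2^-1 * enorm p ^+ 2 - (1 - mu) / enorm (q - earth mu)
  - mu / enorm (q - moon mu) + p 0 0 * q 0 1 - p 0 1 * q 0 0.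

Definition Upot (mu : R) (q : 'rV[R]_2) : R :=
  - ((1 - mu) / enorm (q - earth mu)) - mu / enorm (q - moon mu)
  - 2^-1 * enorm q ^+ 2.

(* omega = dp_1 /\ dq_1 + dp_2 /\ dq_2 *)
Definition omega (z u v : phase) : R := dot u.2 v.1 - dot v.2 u.1.

(* l is the critical point of U on the open segment from E to M (there is
   exactly one). *)
Definition is_l1 (mu : R) (l : 'rV[R]_2) :=
  (exists2 t : R, 0 < t < 1 & l = (1 - t) *: earth mu + t *: moon mu) /\
  (forall v, is_derive l v (Upot mu) 0).

Definition L1 (l : 'rV[R]_2) : phase := (l, vec2 (- l 0 1) (l 0 0)).

(* Ham takes junk values at the primaries, which have to be excluded. *)
Definition Sigma (mu c : R) : set phase :=
  [set z | [/\ z.1 != earth mu, z.1 != moon mu & Ham mu z = c]].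

Definition Hill (mu c : R) : set 'rV[R]_2 := [set z.1 | z in Sigma mu c].

(* The bounded connected component of the Hill's region whose closure contains
   the set Ps of primaries. *)
Definition Hill_part (mu c : R) (Ps : set 'rV[R]_2) : set 'rV[R]_2 :=
  [set q | let C := connected_component (Hill mu c) q in
     [/\ Hill mu c q, bounded_set C & Ps `<=` closure C]].

Definition Sigma_part (mu c : R) (Ps : set 'rV[R]_2) : set phase :=
  [set z | Sigma mu c z /\ Hill_part mu c Ps z.1].

Definition cotS2 : set amb := [set w | dot w.1 w.1 = 1 /\ dot w.1 w.2 = 0].

Definition north : 'rV[R]_(1 + 2) := row_mx (const_mx 1) 0.

(* The map Phi_P, solved for (xi, eta); see Moser_cotS2, Moser_base and
   Moser_fibre. *)
Definition Moser (P : 'rV[R]_2) (z : phase) : amb :=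
  let x := - z.2 in let y := z.1 - P in
  (row_mx (const_mx ((dot x x - 1) / (dot x x + 1))) ((2 / (dot x x + 1)) *: x),
   row_mx (const_mx (dot x y)) (((dot x x + 1) / 2) *: y - dot x y *: x)).

Definition can_form (w v : amb) : R := dot w.2 v.1.
Definition can_omega : amb -> amb -> amb -> R := ext_d can_form.

(* For c < H(L1). *)
Definition Sigma_bar (mu c : R) (P : 'rV[R]_2) : set amb :=
  cotS2 `&` closure (Moser P @` Sigma_part mu c [set P]).

(* For c slightly above H(L1) the regularized hypersurface is the union of the
   open pieces Sigma_EM and, for P = E, M, near_bar P: the completion over the
   north pole of Phi_P(Sigma_near P), with z in Sigma_near P glued to
   Phi_P(z). *)
Definition Sigma_EM (mu c : R) : set phase :=
  Sigma_part mu c [set earth mu; moon mu].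

Definition Sigma_near (mu c delta : R) (P : 'rV[R]_2) : set phase :=
  [set z | Sigma_EM mu c z /\ enorm (z.1 - P) < delta].

Definition near_bar (mu c delta : R) (P : 'rV[R]_2) : set amb :=
  let A := Moser P @` Sigma_near mu c delta P in
  A `|` [set w | [/\ cotS2 w, closure A w & w.1 = north]].

(* A 1-form on the glued manifold is a triple of 1-forms on the pieces which
   agree under the gluing maps.  The glued manifold does not depend on delta;
   |E - M| = 1, so for delta < 1/2 the two neighbourhoods are disjoint. *)
Definition Sigma_EM_bar_has_compatible_contact_form (mu c : R) :=
  exists (delta : R) (lam : phase -> phase -> R) (lamE lamM : amb -> amb -> R),
    [/\ 0 < delta < 2^-1,
        contact_form (Sigma_EM mu c) lam /\ compatible (Sigma_EM mu c) omega lam,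
        contact_form (near_bar mu c delta (earth mu)) lamE /\
        compatible (near_bar mu c delta (earth mu)) can_omega lamE,
        contact_form (near_bar mu c delta (moon mu)) lamM /\
        compatible (near_bar mu c delta (moon mu)) can_omega lamM &
        is_pullback (Sigma_near mu c delta (earth mu)) (Moser (earth mu)) lam lamE /\
        is_pullback (Sigma_near mu c delta (moon mu)) (Moser (moon mu)) lam lamM].

Lemma dotZl n a (u v : 'rV[R]_n) : dot (a *: u) v = a * dot u v.
Proof. by rewrite /dot mulr_sumr; apply: eq_bigr => i _; rewrite mxE mulrA. Qed.

Lemma dotC n (u v : 'rV[R]_n) : dot u v = dot v u.
Proof. by apply: eq_bigr => i _; rewrite mulrC. Qed.

Lemma dotZr n a (u v : 'rV[R]_n) : dot u (a *: v) = a * dot u v.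
Proof. by rewrite dotC dotZl dotC. Qed.

Lemma dotBr n (u v w : 'rV[R]_n) : dot u (v - w) = dot u v - dot u w.
Proof.
by rewrite /dot -sumrB; apply: eq_bigr => i _; rewrite !mxE mulrBr.
Qed.

Lemma dot_row_mx m n (a b : 'rV[R]_m) (u v : 'rV[R]_n) :
  dot (row_mx a u) (row_mx b v) = dot a b + dot u v.
Proof.
rewrite /dot big_split_ord /=; congr (_ + _);
  by apply: eq_bigr => i _; rewrite ?row_mxEl ?row_mxEr.
Qed.

Lemma dot_ge0 n (u : 'rV[R]_n) : 0 <= dot u u.
Proof. by apply: sumr_ge0 => i _; rewrite -expr2 sqr_ge0. Qed.

Lemma dot1_neq0 n (u : 'rV[R]_n) : dot u u + 1 != 0.
Proof. by rewrite gt_eqF // ltr_wpDl ?dot_ge0. Qed.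

Lemma Moser_cotS2 P z : cotS2 (Moser P z).
Proof.
have h := dot1_neq0 (- z.2).
rewrite /cotS2 /Moser /= !dot_row_mx !(dotZl, dotZr, dotBr).
have dc a b : dot (const_mx a : 'rV[R]_1) (const_mx b) = a * b.
  by rewrite /dot big_ord1 !mxE.
by rewrite !dc; split; field; rewrite h.
Qed.

Lemma Moser_base P z (w := Moser P z) (k : 'I_2) :
  (- z.2) 0 k = w.1 0 (rshift 1 k) / (1 - w.1 0 (lshift 2 0)).
Proof.
have h := dot1_neq0 (- z.2).
rewrite /w /Moser /= row_mxEr row_mxEl.
move: (- z.2) h => x h; rewrite !mxE; field; rewrite h /=.
by rewrite (_ : _ - _ = 2) ?pnatr_eq0 //; ring.
Qed.

Lemma Moser_fibre P z (w := Moser P z) (k : 'I_2) :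
  (z.1 - P) 0 k = w.2 0 (rshift 1 k) * (1 - w.1 0 (lshift 2 0))
                  + w.1 0 (rshift 1 k) * w.2 0 (lshift 2 0).
Proof.
have h := dot1_neq0 (- z.2).
rewrite /w /Moser /= !row_mxEr !row_mxEl.
by move: (- z.2) (z.1 - P) h => x y h; rewrite !mxE; field; rewrite h.
Qed.

End ThreeBody.

(* Main.v *)
(* A primitive lam of the two-form is a contact form on a level of H as soon as
   lam (X_H) has no zero, where X_H = (H_p, - H_q).

   Around a primary P take lam = - (q - P) dp, the pull-back of the canonical
   form under Phi_P; then lam (X_H) = (q - P) . H_q.  Let a = |l1 - P|,
   rho = |q - P|, s = a - rho, let v = 1 - cos of the angle between q - P and
   l1 - P, and U' the radial derivative of U.  The estimate
   U + s U' - s^2 / 2 >= U(l1) + k (s^2 + v), a rational inequality in rho, v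
   and |q - P'|, gives (q - P) . H_q > 0 and rho < a wherever rho <= a and
   c < U(l1) + k' |q - l1|^2.  For c < H(L1) this holds on the whole component,
   which is thereby confined to rho < a.  At a collision the level is described
   in the stereographic chart centred at the pole.

   For c slightly above H(L1) the two forms differ by the differential of a
   linear function of p, and near l1 they are interpolated by - q dp + df.  With
   x = q1 - l, y = q2, p = p1, s = p2 - l one has f = l p + phi away from the
   primaries, phi = (1 + j) x p + j y s, for which lam (X_H) is positive
   definite in (x, y, p, s); the cut-off is a function of g = x + s / A, whose
   derivative along X_H is (1 - 1 / A) p to first order, so that the leading
   error term chi'(g) (1 - 1 / A) d p^2 has the right sign. *)
From HB Require Import structures.
Require Import Defs.
From mathcomp Require Import all_boot all_order all_algebra.
From mathcomp Require Import all_classical all_reals all_analysis.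
From mathcomp Require Import ring lra.

Set Implicit Arguments.
Unset Strict Implicit.
Unset Printing Implicit Defensive.

Import Order.TTheory GRing.Theory Num.Theory.
Import numFieldNormedType.Exports.

Local Open Scope classical_set_scope.
Local Open Scope ring_scope.

(** * Gradients and tangent vectors *)

(** The radial estimate acts through the inequality of the means. If w = |H_p| is the speed in the
    rotating frame, then (q - P) . H_q >= rho (U' - w), while s w <= s^2 / 2 + w^2 / 2 = s^2 / 2 + c
    - U < s U'.

    Near L1 the value of a radial form on X_H is linear to first order, a multiple of s + 2 A x, and
    has no sign; hence the interpolation. A cut-off of width sig has a derivative of order 1 / sig,
    so the error has to be controlled by scale. To first order x' = p + y and s' = - (p + A y), and
    adding s / A to x is what removes y from the derivative of g. The term in p^2 being nonnegative,
    the remainder of the product is quartic after completion of the square. Where the cut-off varies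
    all coordinates are O(sig), so this remainder, divided by sig, is O(sig) times the quadratic
    form, which wins for small sig.

    Tangent vectors are velocities of curves, so a nonvanishing volume form requires actual curves
    in the levels; [tangent_level] provides them. *)

Section Gradients.
Context {R : realType} {V : normedModType R}.
Implicit Types (f g : V -> R) (z v : V) (L : V -> R).

(** The differential is a bare function, so that it can be given by an explicit formula; its
    linearity is recovered in [has_grad_linear]. *)
Definition has_grad f z L :=
  differentiable f z /\ forall v, 'D_v f z = L v.

Lemma has_grad_eq f z L L' : has_grad f z L -> L =1 L' -> has_grad f z L'.
Proof. by move=> [df Df] LL'; split=> // v; rewrite Df. Qed.

Lemma has_grad_diff f z : differentiable f z -> has_grad f z ('d f z).
Proof. by move=> df; split=> // v; rewrite deriveE. Qed.

Lemma has_grad_cst c z : has_grad (fun=> c) z (fun=> 0).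
Proof. by split=> [|v]; [exact: differentiable_cst|exact: derive_cst]. Qed.

Lemma has_grad_lin (l : V -> R) z : scalar l -> continuous l -> has_grad l z l.
Proof.
move=> sl cl.
pose lM := GRing.isLinear.Build _ _ _ _ _ sl.
pose lL : {linear V -> R} := HB.pack l lM.
have dl : differentiable l z by exact: (@linear_differentiable _ _ _ lL).
split=> // v; rewrite deriveE //.
by rewrite (@diff_lin _ _ _ lL).
Qed.

Lemma has_gradD f g z L M : has_grad f z L -> has_grad g z M ->
  has_grad (fun x => f x + g x) z (fun v => L v + M v).
Proof.
move=> [df Df] [dg Dg]; split; first exact: differentiableD.
by move=> v; rewrite -Df -Dg deriveD //; exact: diff_derivable.
Qed.

Lemma has_gradN f z L : has_grad f z L -> has_grad (fun x => - f x) z (fun v => - L v).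
Proof.
move=> [df Df]; split; first exact: differentiableN.
by move=> v; rewrite -Df deriveN //; exact: diff_derivable.
Qed.

Lemma has_gradB f g z L M : has_grad f z L -> has_grad g z M ->
  has_grad (fun x => f x - g x) z (fun v => L v - M v).
Proof. by move=> hf hg; apply: has_gradD => //; exact: has_gradN. Qed.

Lemma has_gradM f g z L M : has_grad f z L -> has_grad g z M ->
  has_grad (fun x => f x * g x) z (fun v => f z * M v + g z * L v).
Proof.
move=> [df Df] [dg Dg]; split; first exact: differentiableM.
by move=> v; rewrite -Df -Dg deriveM //; exact: diff_derivable.
Qed.

Lemma has_grad_comp f z L (h : R -> R) d : has_grad f z L ->
  is_derive (f z) 1 h d -> has_grad (fun x => h (f x)) z (fun v => d * L v).
Proof.
move=> [df Df] [dh Dh].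
have dh' : differentiable h (f z) by apply/derivable1_diffP.
split; first exact: differentiable_comp.
move=> v; rewrite deriveE; last exact: differentiable_comp.
rewrite diff_comp //= -Df deriveE // diff1E //.
by rewrite derive1E Dh /= mulrC.
Qed.

Lemma has_grad_cont f z L : has_grad f z L -> {for z, continuous f}.
Proof. by case=> df _; exact: differentiable_continuous. Qed.

End Gradients.

Section Curves.
Context {R : realType} {V W : normedModType R}.

Lemma is_derive_curve (F : V -> W) (g : R -> V) (z v : V) : g 0 = z ->
  is_derive (0 : R) 1 g v -> differentiable F z ->
  is_derive (0 : R) 1 (F \o g) ('D_v F z).
Proof.
move=> g0 [dg Dg] dF.
have dg' : differentiable g 0 by apply/derivable1_diffP.
have dFg : differentiable (F \o g) 0 by apply: differentiable_comp => //; rewrite g0.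
split; first exact: diff_derivable.
rewrite deriveE // diff_comp ?g0 //= [RHS]deriveE //.
by rewrite -Dg [in RHS]deriveE.
Qed.

End Curves.

Section LevelSets.
Context {R : realType} {V : normedModType R}.

Lemma has_grad_small (f : V -> R) z L : has_grad f z L -> forall e, 0 < e ->
  \forall h \near (0 : V), `|f (z + h) - f z - L h| <= e * `|h|.
Proof.
move=> [df Df] e e0.
have /eqaddoP /(_ _ e0) := diff_locally df.
apply: filterS => h /=; rewrite /shift /cst /= -Df deriveE //.
by rewrite !fctE opprD addrA [h + z]addrC.
Qed.

Lemma has_grad_linear (f : V -> R) z L : has_grad f z L -> scalar L.
Proof. by move=> [df Df] k x y; rewrite -!Df !deriveE // linearP. Qed.

Lemma is_derive_scalel (k : R -> R) (w : V) (t dk : R) :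
  is_derive t 1 k dk -> is_derive t 1 (fun x => k x *: w) (dk *: w).
Proof.
move=> [/derivable1_diffP dk' Dk].
have d : differentiable (fun x => k x *: w) t by exact: differentiableZl.
split; first exact/derivable1_diffP.
by rewrite deriveE // diffZl //= -deriveE // Dk.
Qed.

(* The correction s t along the transverse direction n is a zero of
   s |-> G (z + t v + s n) - G z nearly minimal in absolute value; the
   intermediate value theorem shows that it is o(t). *)
Lemma tangent_level (G : V -> R) (S : set V) (z n v : V) L :
  has_grad G z L -> L n != 0 -> L v = 0 ->
  (\forall x \near z, {for x, continuous G}) ->
  (\forall x \near z, G x = G z -> S x) -> tangent S z v.
Proof.
move=> hG; have lL := has_grad_linear hG.
pose LM := GRing.isLinear.Build _ _ _ _ _ lL.
pose LL : {linear V -> R} := HB.pack L LM.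
have LD x y : L (x + y) = L x + L y by exact: (linearD LL).
have LZ k x : L (k *: x) = k * L x by exact: (linearZ_LR LL).
wlog Ln : n / L n = 1 => [hw Ln Lv|_ Lv contG SG].
  apply: (hw ((L n)^-1 *: n)) => //; first by rewrite LZ mulVf.
  by rewrite LZ mulVf // oner_neq0.
pose Z (t : R) : set R := [set s | G (z + t *: v + s *: n) = G z].
pose K := `|v| + `|n| + 1.
have K0 : 0 < K by rewrite ltr_wpDl // addr_ge0.
have Zsmall (k : R) : 0 < k <= 1 -> \forall t \near (0 : R), exists2 s, Z t s & `|s| <= k * `|t|.
  move=> /andP[k0 k1].
  have e0 : 0 < k / K by rewrite divr_gt0.
  have /nbhs_ballP[d /= d0 dG] := has_grad_small hG e0.
  have /nbhs_ballP[d' /= d'0 d'G] := contG.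
  have hsmall t s : `|s| <= k * `|t| -> `|t *: v + s *: n| <= K * `|t|.
    move=> st; rewrite (le_trans (ler_normD _ _)) // !normrZ /K.
    have : `|s| * `|n| <= `|t| * `|n|.
      by rewrite ler_wpM2r // (le_trans st) // ler_piMl.
    have := normr_ge0 t; nra.
  have nearK e1 : 0 < e1 -> \forall t \near (0:R), K * `|t| < e1.
    move=> e10; near=> t; rewrite mulrC -ltr_pdivlMr //.
    have : ball 0 (e1 / K) t by near: t; apply: nbhsx_ballx; rewrite divr_gt0.
    by rewrite -ball_normE /= sub0r normrN.
  near=> t.
  have td : K * `|t| < d by near: t; exact: nearK.
  have td' : K * `|t| < d' by near: t; exact: nearK.
  (* With accuracy [k / K] the error is at most k |t|, so that G - G z is nonnegative at s = k |t|
     and nonpositive at s = - k |t|. *)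
  have dGt s : `|s| <= k * `|t| -> `|G (z + t *: v + s *: n) - G z - s| <= k * `|t|.
    move=> st; have h := hsmall _ _ st.
    have := dG (t *: v + s *: n); rewrite -ball_normE /= sub0r normrN.
    move=> /(_ (le_lt_trans h td)).
    rewrite LD !LZ Lv Ln mulr0 add0r mulr1 addrA => /le_trans; apply.
    have -> : k * `|t| = k / K * (K * `|t|) by field; rewrite gt_eqF.
    by rewrite ler_wpM2l // ltW.
  have kt0 : 0 <= k * `|t| by rewrite mulr_ge0 // ltW.
  have contF : {within `[- (k * `|t|), k * `|t|], continuous (fun s => G (z + t *: v + s *: n))}.
    apply: continuous_in_subspaceT => s; rewrite inE /= in_itv /= -ler_norml => st.
    apply: (@continuous_comp _ _ _ (fun s : R => z + t *: v + s *: n) G).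
      by apply: cvgD; [exact: cvg_cst|apply: cvgZl; exact: cvg_id].
    apply: d'G; rewrite -ball_normE /= -addrA opprD addrA subrr sub0r normrN.
    by rewrite (le_lt_trans (hsmall _ _ st)).
  have [||s] := IVT _ contF (v := G z); first by rewrite ge0_cp.
    have h1 : `|k * `|t| | <= k * `|t| by rewrite (ger0_norm kt0).
    have h2 : `|- (k * `|t|)| <= k * `|t| by rewrite normrN.
    move: (dGt _ h2) (dGt _ h1); rewrite ge_min le_max !ler_distl => /andP[_ h3] /andP[h4 _].
    by apply/andP; split; apply/orP; [left|right]; lra.
  by rewrite in_itv /= -ler_norml => sk Gs; exists s.
pose Zn (t : R) : set R := [set `|s| | s in Z t].
have infZ (t s : R) : Z t s -> has_inf (Zn t).
  by move=> Zs; split; [exists `|s|, s|exists 0 => _ [s' _ <-]].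
(* The slack allows a near-minimiser whether or not the infimum is attained. Being [t ^+ 2] it is
   o(t), and at t = 0 it vanishes and forces [sg 0 = 0]. *)
pose sg (t : R) : R := xget 0 [set s | Z t s /\ `|s| <= inf (Zn t) + t ^+ 2].
have sgE (t s : R) : t != 0 -> Z t s -> Z t (sg t) /\ `|sg t| <= `|s| + t ^+ 2.
  move=> t0 Zs.
  have [||_ [s' Zs' <-] s'lt] := @inf_adherent _ (Zn t) (t ^+ 2).
  - by rewrite exprn_even_gt0.
  - exact: infZ Zs.
  have : [set s | Z t s /\ `|s| <= inf (Zn t) + t ^+ 2] (sg t).
    by apply: (@xgetPex _ 0); exists s'; split => //; exact: ltW.
  move=> [Zsg sgle]; split => //; rewrite (le_trans sgle) // lerD2r.
  by apply: ge_inf; [case: (infZ _ _ Zs)|exists s].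
have sg0 : sg 0 = 0.
  have Z00 : Z 0 0 by rewrite /Z /= !scale0r !addr0.
  have : [set s | Z 0 s /\ `|s| <= inf (Zn 0) + 0 ^+ 2] (sg 0).
    apply: (@xgetPex _ 0); exists 0; split => //.
    rewrite normr0 expr0n /= addr0; apply: lb_le_inf; first by exists `|0 : R|, (0 : R).
    by move=> _ [s _ <-].
  move=> [_]; rewrite expr0n /= addr0 => h.
  apply/eqP; rewrite -normr_le0 (le_trans h) //.
  by apply: ge_inf; [case: (infZ _ _ Z00)|exists (0 : R); rewrite ?normr0].
have sgo (k : R) : 0 < k -> \forall t \near (0:R), `|sg t| <= k * `|t|.
  move=> k0; pose k' := Num.min (k / 2) 1.
  have k'0 : 0 < k' <= 1.
    apply/andP; split; last by rewrite ge_min lexx orbT.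
    by rewrite lt_min ltr01 andbT divr_gt0.
  have k'k : k' <= k / 2 by rewrite ge_min lexx.
  near=> t; have [->|t0] := eqVneq t 0; first by rewrite sg0 !normr0 mulr0.
  have [s Zs sk] : exists2 s, Z t s & `|s| <= k' * `|t|.
    by near: t; apply: Zsmall.
  have [_ /le_trans] := sgE _ _ t0 Zs; apply.
  have : `|t| <= k / 2.
    have : ball 0 (k / 2) t by near: t; apply: nbhsx_ballx; rewrite divr_gt0.
    by rewrite -ball_normE /= sub0r normrN => /ltW.
  rewrite -[t ^+ 2]real_normK ?num_real //.
  have := normr_ge0 t; nra.
have sgZ : \forall t \near (0:R), Z t (sg t).
  near=> t; have [->|t0] := eqVneq t 0.
    by rewrite sg0 /Z /= !scale0r !addr0.
  have [s Zs sk] : exists2 s, Z t s & `|s| <= 1 * `|t|.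
    by near: t; apply: Zsmall; rewrite ltr01 lexx.
  by case: (sgE _ _ t0 Zs).
have dsg : is_derive (0 : R) 1 sg 0.
  have h : h^-1 *: ((sg \o shift 0) (h *: 1) - sg 0) @[h --> 0^'] --> (0 : R).
    apply/cvgr0Pnorm_le => e e0; near=> h.
    rewrite /= addr0 sg0 subr0 normrZ normfV [h *: 1]mulr1.
    rewrite ler_pdivrMl ?normr_gt0; last by near: h; exact: nbhs_dnbhs_neq.
    by rewrite mulrC; near: h; apply: nbhs_dnbhs; exact: sgo.
  by split; [apply: cvgP h|apply: cvg_lim].
have dg : is_derive (0 : R) 1 (fun t => z + t *: v + sg t *: n) v.
  have d1 : is_derive (0 : R) 1 (fun t : R => t *: v) (1 *: v).
    exact: is_derive_scalel.
  have d2 := is_derive_scalel n dsg.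
  have d3 := is_deriveD (is_deriveD (is_derive_cst z (0 : R) 1) d1) d2.
  by apply: (is_derive_eq d3); rewrite add0r scale1r scale0r addr0.
pose g t := z + t *: v + sg t *: n.
have g0 : g 0 = z by rewrite /g sg0 !scale0r !addr0.
exists g; split => //.
have cg : g t @[t --> (0 : R)] --> z.
  rewrite -[X in _ --> X]g0; apply: differentiable_continuous.
  by apply/derivable1_diffP; case: dg.
have SGg := cg _ SG; near=> t.
by have: G (g t) = G z by [near: t; exact: sgZ]; near: t.
Unshelve. all: by end_near. Qed.

End LevelSets.

(** * Smooth functions *)

Section Flat.
Context {R : realType}.

(** The powers of 1 / t make the family closed under differentiation up to linear combinations, see
    [is_derive_flat]. *)
Definition flat (n : nat) (t : R) : R :=
  if 0 < t then t^-1 ^+ n * expR (- t^-1) else 0.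

Lemma flat_le0 n t : t <= 0 -> flat n t = 0.
Proof. by rewrite /flat ltNge => ->. Qed.

Lemma flat_ge0 n t : 0 <= flat n t.
Proof.
rewrite /flat; case: ifP => // t0.
by rewrite mulr_ge0 ?expR_ge0 // exprn_ge0 // invr_ge0 ltW.
Qed.

Lemma flat_gt0 n t : 0 < t -> 0 < flat n t.
Proof. by move=> t0; rewrite /flat t0 mulr_gt0 ?expR_gt0 // exprn_gt0 // invr_gt0. Qed.

(** The exponential series at 1 / t contains the term t^-(n+2) / (n+2)!. Being O(t^2) on the right
    and 0 on the left, [flat n] has derivative 0 at the origin. *)
Lemma flat_le n t : flat n t <= (n.+2)`!%:R * t ^+ 2.
Proof.
rewrite /flat; case: ifP => [t0|_]; last by rewrite mulr_ge0 // sqr_ge0.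
have u0 : 0 <= t^-1 by rewrite invr_ge0 ltW.
have := expR_ge1Dxn n.+1 u0.
set F := (n.+2)`!%:R; have F0 : 0 < F :> R by rewrite ltr0n fact_gt0.
move=> h; have : t^-1 ^+ n.+2 / F <= expR t^-1 by apply: le_trans h; rewrite lerDr.
rewrite expRN ler_pdivrMr // ler_pdivrMr ?expR_gt0 // => h1.
have -> : t^-1 ^+ n = t ^+ 2 * t^-1 ^+ n.+2.
  by rewrite !exprS expr0 mulr1; field; rewrite gt_eqF.
have := sqr_ge0 t; nra.
Qed.

Lemma is_derive_flat n (t : R) :
  is_derive t 1 (flat n) (- n%:R * flat n.+1 t + flat n.+2 t).
Proof.
have [t0|t0|->] := ltrgtP t 0.
- rewrite !flat_le0 ?ltW // mulr0 addr0.
  apply: (@near_eq_is_derive _ _ _ (cst 0)).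
    near=> x; rewrite flat_le0 //; apply: ltW.
    by near: x; exact: (@lt_nbhsl _ t 0).
- have tn : t != 0 by rewrite gt_eqF.
  apply: (@near_eq_is_derive _ _ _ (fun x : R => x^-1 ^+ n * expR (- x^-1) : R)).
    near=> x; rewrite /flat ifT //.
    by near: x; exact: (@lt_nbhsr _ 0 t).
  have dV : is_derive t 1 (fun x : R => x^-1) (- t ^- 2).
    split; first by apply: derivableV => //; exact: derivable_id.
    by rewrite deriveV //= derive_id; rewrite [_ *: _]mulr1.
  have dX : is_derive t 1 (fun x : R => x^-1 ^+ n) (n%:R * t^-1 ^+ n.-1 * (- t ^- 2)).
    have dP : is_derive t^-1 1 (fun x : R => x ^+ n) (n%:R * t^-1 ^+ n.-1).
      by split; [exact: exprn_derivable|rewrite exp_derive [_ *: 1]mulr1].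
    exact: is_derive1_comp dP dV.
  have dN : is_derive t 1 (fun x : R => - x^-1) (- - t ^- 2) := is_deriveN dV.
  have dE : is_derive t 1 (fun x : R => expR (- x^-1)) (expR (- t^-1) * - - t ^- 2).
    have X := @is_derive1_comp R expR (fun x : R => - x^-1) t _ _ (is_derive_expR (- t^-1)) dN. exact: X.
  apply: (is_derive_eq (is_deriveM dX dE)).
  have scE (a b : R) : a *: (b : R) = a * b by [].
  rewrite /flat t0 opprK !scE {scE dE dN dV}.
  case: n {dX} => [|n]; first by rewrite !exprS !expr0; field.
  by rewrite /= !exprS; field.
- rewrite !flat_le0 // mulr0 addr0.
  have h : h^-1 *: ((flat n \o shift 0) (h *: 1) - flat n 0) @[h --> 0^'] --> (0 : R).
    apply/cvgr0Pnorm_le => e e0; near=> h.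
    rewrite /= addr0 (flat_le0 n (lexx 0)) subr0 normrZ normfV [h *: 1]mulr1.
    rewrite ler_pdivrMl ?normr_gt0; last by near: h; exact: nbhs_dnbhs_neq.
    rewrite ger0_norm ?flat_ge0 // (le_trans (flat_le _ _)) //.
    have F0 : 0 < (n.+2)`!%:R :> R by rewrite ltr0n fact_gt0.
    rewrite -[h ^+ 2]real_normK ?num_real // expr2 mulrCA ler_wpM2l //.
    rewrite mulrC -ler_pdivlMr //.
    have : ball 0 (e / (n.+2)`!%:R) h.
      by near: h; apply: nbhs_dnbhs; apply: nbhsx_ballx; rewrite divr_gt0.
    by rewrite -ball_normE /= sub0r normrN => /ltW.
  by split; [apply: cvgP h|apply: cvg_lim].
Unshelve. all: by end_near. Qed.

End Flat.

Section Smooth.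
Context {R : realType} {V : normedModType R}.

(* Closed under directional derivatives, which makes the symmetry of second
   derivatives an induction. *)
Inductive smooth : (V -> R) -> Prop :=
| smooth_cst c : smooth (fun=> c)
| smooth_lin (l : V -> R) : scalar l -> continuous l -> smooth l
| smoothD f g : smooth f -> smooth g -> smooth (fun x => f x + g x)
| smoothM f g : smooth f -> smooth g -> smooth (fun x => f x * g x)
| smooth_flat n f : smooth f -> smooth (fun x => flat n (f x)).

Lemma smoothZ k f : smooth f -> smooth (fun x => k * f x).
Proof. by apply: smoothM; exact: smooth_cst. Qed.

Lemma smoothN f : smooth f -> smooth (fun x => - f x).
Proof.
move=> /(smoothZ (-1)); congr smooth.
by apply/funext => x; rewrite mulN1r.
Qed.

Lemma smooth_grad f : smooth f ->
  (forall z, differentiable f z) /\ (forall v, smooth (fun z => 'D_v f z)).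
Proof.
elim=> {f} [c|l sl cl|f g _ [df Df] _ [dg Dg]|f g sf [df Df] sg [dg Dg]|n f sf [df Df]].
- split=> [z|v]; first by case: (has_grad_cst (V := V) c z).
  rewrite (_ : (fun z => 'D_v (fun=> c) z) = fun=> 0); first exact: smooth_cst.
  by apply/funext => z; case: (has_grad_cst (V := V) c z).
- split=> [z|v]; first by case: (has_grad_lin z sl cl).
  rewrite (_ : (fun z => 'D_v l z) = fun=> l v); first exact: smooth_cst.
  by apply/funext => z; case: (has_grad_lin z sl cl).
- have H z := has_gradD (has_grad_diff (df z)) (has_grad_diff (dg z)).
  split=> [z|v]; first by case: (H z).
  rewrite (_ : (fun z => 'D_v (fun x => f x + g x) z) = fun z => 'D_v f z + 'D_v g z); first exact: smoothD.
  by apply/funext => z; case: (H z) => _ ->; rewrite !deriveE.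
- have H z := has_gradM (has_grad_diff (df z)) (has_grad_diff (dg z)).
  split=> [z|v]; first by case: (H z).
  rewrite (_ : (fun z => 'D_v (fun x => f x * g x) z) = fun z => f z * 'D_v g z + g z * 'D_v f z).
    by apply: smoothD; exact: smoothM.
  by apply/funext => z; case: (H z) => _ ->; rewrite !deriveE.
- have H z := has_grad_comp (has_grad_diff (df z)) (is_derive_flat n (f z)).
  split=> [z|v]; first by case: (H z).
  rewrite (_ : (fun z => 'D_v (fun x => flat n (f x)) z) = fun z =>
      (- n%:R * flat n.+1 (f z) + flat n.+2 (f z)) * 'D_v f z).
    apply: smoothM => //; apply: smoothD; last exact: smooth_flat.
    by apply: smoothZ; exact: smooth_flat.
  by apply/funext => z; case: (H z) => _ ->; rewrite !deriveE.
Qed.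

Lemma smooth_smooth_on f A : smooth f -> smooth_on A f.
Proof.
move=> sf vs z _; suff : smooth (Defs.iterD vs f) by move=> /smooth_grad[].
by elim: vs => //= v vs /smooth_grad[_]; apply.
Qed.

Lemma has_grad_derive (f : V -> R) z : differentiable f z ->
  has_grad f z (fun v => 'D_v f z).
Proof. by []. Qed.

Lemma smooth_schwarz f z u v : smooth f ->
  'D_u (fun x => 'D_v f x) z = 'D_v (fun x => 'D_u f x) z.
Proof.
move=> sf; elim: sf z => {f} [c|l sl cl|f g sf IHf sg IHg|f g sf IHf sg IHg|n f sf IHf] z.
- have E w : (fun x : V => 'D_w (fun=> c) x) = fun=> 0.
    by apply/funext => x; case: (has_grad_cst (V := V) c x).
  by rewrite !E; case: (has_grad_cst (V := V) 0 z) => _ D; rewrite !D.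
- have E w : (fun x : V => 'D_w l x) = fun=> l w.
    by apply/funext => x; case: (has_grad_lin x sl cl).
  rewrite !E; case: (has_grad_cst (V := V) (l u) z) => _ ->.
  by case: (has_grad_cst (V := V) (l v) z) => _ ->.
- have [df Df] := smooth_grad sf; have [dg Dg] := smooth_grad sg.
  have E w : (fun x => 'D_w (fun y => f y + g y) x) = fun x => 'D_w f x + 'D_w g x.
    apply/funext => x; have [_ ->] := has_gradD (has_grad_diff (df x)) (has_grad_diff (dg x)).
    by rewrite !deriveE.
  have dDf w := (smooth_grad (Df w)).1 z; have dDg w := (smooth_grad (Dg w)).1 z.
  have E2 w w' : 'D_w' (fun x => 'D_w f x + 'D_w g x) z =
      'D_w' (fun x => 'D_w f x) z + 'D_w' (fun x => 'D_w g x) z.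
    by have [_ ->] := has_gradD (has_grad_derive (dDf w)) (has_grad_derive (dDg w)).
  by rewrite !E !E2 IHf IHg.
- have [df Df] := smooth_grad sf; have [dg Dg] := smooth_grad sg.
  have E w : (fun x => 'D_w (fun y => f y * g y) x) =
      fun x => f x * 'D_w g x + g x * 'D_w f x.
    apply/funext => x; have [_ ->] := has_gradM (has_grad_diff (df x)) (has_grad_diff (dg x)).
    by rewrite !deriveE.
  have dDf w := (smooth_grad (Df w)).1 z; have dDg w := (smooth_grad (Dg w)).1 z.
  have E2 w w' : 'D_w' (fun x => f x * 'D_w g x + g x * 'D_w f x) z =
      f z * 'D_w' (fun x => 'D_w g x) z + 'D_w g z * 'D_w' f z +
      (g z * 'D_w' (fun x => 'D_w f x) z + 'D_w f z * 'D_w' g z).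
    by have [_ ->] := has_gradD
      (has_gradM (has_grad_derive (df z)) (has_grad_derive (dDg w)))
      (has_gradM (has_grad_derive (dg z)) (has_grad_derive (dDf w))).
  rewrite !E !E2 IHf IHg addrACA [RHS]addrACA; congr (_ + _).
  by rewrite addrC; congr (_ + _); rewrite mulrC.
- have [df Df] := smooth_grad sf.
  pose h x := - n%:R * flat n.+1 (f x) + flat n.+2 (f x).
  have E w : (fun x => 'D_w (fun y => flat n (f y)) x) = fun x => h x * 'D_w f x.
    apply/funext => x.
    have [_ ->] := has_grad_comp (has_grad_diff (df x)) (is_derive_flat n (f x)).
    by rewrite deriveE.
  have dDf w := (smooth_grad (Df w)).1 z.
  have dh := has_gradD
    (has_gradM (has_grad_cst (- n%:R) z)
      (has_grad_comp (has_grad_diff (df z)) (is_derive_flat n.+1 (f z))))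
    (has_grad_comp (has_grad_diff (df z)) (is_derive_flat n.+2 (f z))).
  (* Only this shape matters: [k] will multiply a product of two first derivatives of [f], which is
     symmetric in the directions. *)
  have [k Dh] : exists k, has_grad h z (fun w => k * 'D_w f z).
    eexists; apply: (has_grad_eq dh) => w /=.
    by rewrite mulr0 addr0 mulrA -mulrDl -deriveE.
  have E2 w w' : 'D_w' (fun x => h x * 'D_w f x) z =
      h z * 'D_w' (fun x => 'D_w f x) z + 'D_w f z * (k * 'D_w' f z).
    by have [_ ->] := has_gradM Dh (has_grad_derive (dDf w)).
  by rewrite !E !E2 IHf; congr (_ + _); rewrite mulrCA [RHS]mulrCA; congr (_ * _); rewrite mulrC.
Qed.

End Smooth.

(** * The Moser map *)

Section Dot.
Context {R : realType} {n : nat}.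
Implicit Types u v w : 'rV[R]_n.

Lemma dotDr u v w : dot u (v + w) = dot u v + dot u w.
Proof. by rewrite /dot -big_split; apply: eq_bigr => i _; rewrite !mxE mulrDr. Qed.

Lemma dotDl u v w : dot (u + v) w = dot u w + dot v w.
Proof. by rewrite dotC dotDr !(dotC w). Qed.

Lemma dotNr u v : dot u (- v) = - dot u v.
Proof. by rewrite -scaleN1r dotZr mulN1r. Qed.

Lemma dotNl u v : dot (- u) v = - dot u v.
Proof. by rewrite dotC dotNr dotC. Qed.

Lemma dotBl u v w : dot (u - v) w = dot u w - dot v w.
Proof. by rewrite dotDl dotNl. Qed.

Lemma dot0r u : dot u 0 = 0.
Proof. by rewrite -(scale0r 0) dotZr mul0r. Qed.

Lemma dot0l u : dot 0 u = 0.
Proof. by rewrite dotC dot0r. Qed.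

Lemma dot_const (a b : R) : dot (const_mx a : 'rV_1) (const_mx b) = a * b.
Proof. by rewrite /dot big_ord1 !mxE. Qed.

Lemma dot_eq0 u : (dot u u == 0) = (u == 0).
Proof.
apply/idP/eqP => [|->]; last by rewrite dot0l.
rewrite psumr_eq0 => [/allP h|i _]; last by rewrite -expr2 sqr_ge0.
apply/rowP => i; rewrite mxE; apply/eqP.
by have := h i (mem_index_enum _); rewrite -expr2 sqrf_eq0.
Qed.

End Dot.

(** * Gradients of vector-valued maps *)

Section VectorValued.
Context {R : realType} {V : normedModType R}.

Lemma derive_row n (f : 'I_n -> V -> R) (L : 'I_n -> V -> R) z :
  (forall i, has_grad (f i) z (L i)) ->
  differentiable (fun x => \row_i f i x) z /\
  forall v, 'D_v (fun x => \row_i f i x) z = \row_i L i v.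
Proof.
move=> h; have d : differentiable (fun x => \row_i f i x) z.
  rewrite (_ : (fun x => _) = \sum_(i < n) (fun x => f i x *: delta_mx 0 i)).
    by apply: differentiable_sum => i; apply: differentiableZl; case: (h i).
  apply/funext => x; rewrite fct_sumE [LHS]row_sum_delta.
  by apply: eq_bigr => i _; rewrite mxE.
split=> // v; rewrite derive_mx; last exact: diff_derivable.
apply/rowP => i; rewrite !mxE -(h i).2; congr ('D_v _ z).
by apply/funext => x; rewrite mxE.
Qed.

Lemma derive_pair (W1 W2 : normedModType R) (f : V -> W1) (g : V -> W2) z v :
  differentiable f z -> differentiable g z ->
  'D_v (fun x => (f x, g x)) z = ('D_v f z, 'D_v g z).
Proof.
move=> df dg; rewrite deriveE; last exact: differentiable_pair.
by rewrite diff_pair // !deriveE.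
Qed.

End VectorValued.

Section VectorGradients.
Context {R : realType} {V : normedModType R}.

Lemma has_grad_sum n (f L : 'I_n -> V -> R) z :
  (forall i, has_grad (f i) z (L i)) ->
  has_grad (fun x => \sum_i f i x) z (fun v => \sum_i L i v).
Proof.
elim: n f L => [|n IH] f L h.
  have -> : (fun x => \sum_(i < 0) f i x) = fun=> 0.
    by apply/funext => x; rewrite big_ord0.
  by apply: (has_grad_eq (has_grad_cst 0 z)) => v; rewrite big_ord0.
have -> : (fun x => \sum_(i < n.+1) f i x) =
    fun x => f ord0 x + \sum_(i < n) f (lift ord0 i) x.
  by apply/funext => x; rewrite big_ord_recl.
apply: (has_grad_eq (has_gradD (h ord0) (IH _ _ (fun i => h (lift ord0 i))))).
by move=> v; rewrite big_ord_recl.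
Qed.

Lemma has_gradV (f : V -> R) z L : has_grad f z L -> f z != 0 ->
  has_grad (fun x => (f x)^-1) z (fun v => - (f z) ^- 2 * L v).
Proof.
move=> hf fz; apply: (has_grad_comp (h := fun t : R => t^-1) hf).
split; first by apply: derivableV => //; exact: derivable_id.
by rewrite deriveV //= derive_id [_ *: _]mulr1.
Qed.

Definition vgrad n (F : V -> 'rV[R]_n) z (dF : V -> 'rV[R]_n) :=
  forall i, has_grad (fun x => F x 0 i) z (fun v => dF v 0 i).

Lemma vgrad_derive n (F : V -> 'rV[R]_n) z dF : vgrad F z dF ->
  differentiable F z /\ forall v, 'D_v F z = dF v.
Proof.
move=> h; have [] := derive_row h.
have -> : (fun x => \row_i F x 0 i) = F by apply/funext => x; apply/rowP => i; rewrite mxE.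
by move=> d D; split=> // v; rewrite D; apply/rowP => i; rewrite mxE.
Qed.

Lemma vgrad_eq n (F : V -> 'rV[R]_n) z dF dF' :
  vgrad F z dF -> dF =1 dF' -> vgrad F z dF'.
Proof. by move=> h e i; apply: (has_grad_eq (h i)) => v; rewrite e. Qed.

Lemma vgrad_cst n (c : 'rV[R]_n) z : vgrad (fun=> c) z (fun=> 0).
Proof. by move=> i; apply: (has_grad_eq (has_grad_cst _ z)) => v; rewrite mxE. Qed.

Lemma vgradD n (F G : V -> 'rV[R]_n) z dF dG : vgrad F z dF -> vgrad G z dG ->
  vgrad (fun x => F x + G x) z (fun v => dF v + dG v).
Proof.
move=> hF hG i; have -> : (fun x => (F x + G x) 0 i) = fun x => F x 0 i + G x 0 i.
  by apply/funext => x; rewrite mxE.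
by apply: (has_grad_eq (has_gradD (hF i) (hG i))) => v; rewrite mxE.
Qed.

Lemma vgradN n (F : V -> 'rV[R]_n) z dF : vgrad F z dF ->
  vgrad (fun x => - F x) z (fun v => - dF v).
Proof.
move=> hF i; have -> : (fun x => (- F x) 0 i) = fun x => - F x 0 i.
  by apply/funext => x; rewrite mxE.
by apply: (has_grad_eq (has_gradN (hF i))) => v; rewrite mxE.
Qed.

Lemma vgradB n (F G : V -> 'rV[R]_n) z dF dG : vgrad F z dF -> vgrad G z dG ->
  vgrad (fun x => F x - G x) z (fun v => dF v - dG v).
Proof. by move=> hF hG; apply: vgradD => //; exact: vgradN. Qed.

Lemma vgradZ n (f : V -> R) (F : V -> 'rV[R]_n) z L dF :
  has_grad f z L -> vgrad F z dF ->
  vgrad (fun x => f x *: F x) z (fun v => f z *: dF v + L v *: F z).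
Proof.
move=> hf hF i; have -> : (fun x => (f x *: F x) 0 i) = fun x => f x * F x 0 i.
  by apply/funext => x; rewrite mxE.
by apply: (has_grad_eq (has_gradM hf (hF i))) => v; rewrite !mxE [_ * L v]mulrC.
Qed.

Lemma vgrad_const (f : V -> R) z L : has_grad f z L ->
  vgrad (n := 1) (fun x => const_mx (f x)) z (fun v => const_mx (L v)).
Proof.
move=> hf i; have -> : (fun x => (const_mx (f x) : 'rV_1) 0 i) = f.
  by apply/funext => x; rewrite mxE.
by apply: (has_grad_eq hf) => v; rewrite mxE.
Qed.

Lemma vgrad_row_mx m n (F : V -> 'rV[R]_m) (G : V -> 'rV[R]_n) z dF dG :
  vgrad F z dF -> vgrad G z dG ->
  vgrad (fun x => row_mx (F x) (G x)) z (fun v => row_mx (dF v) (dG v)).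
Proof.
move=> hF hG i; case: (split_ordP i) => j ->.
  have -> : (fun x => row_mx (F x) (G x) 0 (lshift n j)) = fun x => F x 0 j.
    by apply/funext => x; rewrite row_mxEl.
  by apply: (has_grad_eq (hF j)) => v; rewrite row_mxEl.
have -> : (fun x => row_mx (F x) (G x) 0 (rshift m j)) = fun x => G x 0 j.
  by apply/funext => x; rewrite row_mxEr.
by apply: (has_grad_eq (hG j)) => v; rewrite row_mxEr.
Qed.

Lemma has_grad_dot n (F G : V -> 'rV[R]_n) z dF dG :
  vgrad F z dF -> vgrad G z dG ->
  has_grad (fun x => dot (F x) (G x)) z (fun v => dot (F z) (dG v) + dot (G z) (dF v)).
Proof.
move=> hF hG.
apply: (has_grad_eq (has_grad_sum (fun i => has_gradM (hF i) (hG i)))) => v.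
by rewrite big_split.
Qed.

Lemma derive_vpair m n (F : V -> 'rV[R]_m) (G : V -> 'rV[R]_n) z dF dG :
  vgrad F z dF -> vgrad G z dG ->
  differentiable (fun x => (F x, G x)) z /\
  forall v, 'D_v (fun x => (F x, G x)) z = (dF v, dG v).
Proof.
move=> /vgrad_derive[dF' DF] /vgrad_derive[dG' DG].
split; first exact: differentiable_pair.
by move=> v; rewrite derive_pair // DF DG.
Qed.

End VectorGradients.

(** * The derivative of the Moser map and the forms it pulls back *)

Section Phase.
Context {R : realType}.
Local Notation phase := (phase R).
Local Notation amb := (amb R).

Lemma vgrad_fst m n (w : 'rV[R]_m * 'rV[R]_n) : vgrad (V := ('rV[R]_m * 'rV[R]_n)%type) (fun x => x.1) w (fun v => v.1).
Proof.
move=> i; apply: (has_grad_lin (V := ('rV[R]_m * 'rV[R]_n)%type) (l := fun x => x.1 0 i)).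
  by move=> k x y; rewrite !mxE.
move=> x; apply: (@continuous_comp _ _ _ fst (fun M : 'rV[R]_m => M 0 i)).
  exact: cvg_fst.
exact: coord_continuous.
Qed.

Lemma vgrad_snd m n (w : 'rV[R]_m * 'rV[R]_n) : vgrad (V := ('rV[R]_m * 'rV[R]_n)%type) (fun x => x.2) w (fun v => v.2).
Proof.
move=> i; apply: (has_grad_lin (V := ('rV[R]_m * 'rV[R]_n)%type) (l := fun x => x.2 0 i)).
  by move=> k x y; rewrite !mxE.
move=> x; apply: (@continuous_comp _ _ _ snd (fun M : 'rV[R]_n => M 0 i)).
  exact: cvg_snd.
exact: coord_continuous.
Qed.

(** Here xi_0 = 1 - 2 / N, so [2 * dN / N ^+ 2] is both the differential of xi_0 and minus that of
    the factor 2 / N. *)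
Definition dMoser (P : 'rV[R]_2) (z v : phase) : amb :=
  let x := - z.2 in let y := z.1 - P in let dx := - v.2 in let dy := v.1 in
  let N := dot x x + 1 in let dN := 2 * dot x dx in
  let k := dot x y in let dk := dot x dy + dot y dx in
  (row_mx (const_mx (2 * dN / N ^+ 2)) ((2 / N) *: dx - (2 * dN / N ^+ 2) *: x),
   row_mx (const_mx dk)
     ((N / 2) *: dy + (dN / 2) *: y - (k *: dx + dk *: x))).

Lemma vgrad_Moser (P : 'rV[R]_2) (z : phase) :
  vgrad (fun x => (Moser P x).1) z (fun v => (dMoser P z v).1) /\
  vgrad (fun x => (Moser P x).2) z (fun v => (dMoser P z v).2).
Proof.
have h : dot (- z.2) (- z.2) + 1 != 0 by exact: dot1_neq0.
have gx := vgradN (vgrad_snd z).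
have gy := vgradB (vgrad_fst z) (vgrad_cst P z).
have gn := has_grad_dot gx gx.
have gk := has_grad_dot gx gy.
have gN := has_gradD gn (has_grad_cst 1 z).
have gV := has_gradV gN h.
have g1 := vgrad_row_mx
  (vgrad_const (has_gradM (has_gradB gn (has_grad_cst 1 z)) gV))
  (vgradZ (has_gradM (has_grad_cst 2 z) gV) gx).
have g2 := vgrad_row_mx (vgrad_const gk)
  (vgradB (vgradZ (has_gradM gN (has_grad_cst 2^-1 z)) gy) (vgradZ gk gx)).
split; [apply: (vgrad_eq g1)|apply: (vgrad_eq g2)] => v; rewrite /dMoser /=;
  move: (- z.2) (z.1 - P) (- v.2) v.1 h => x y dx dy h;
  congr (row_mx (const_mx _) _).
- by field.
- rewrite mulr0 addr0; congr (_ + _); rewrite -scaleNr; congr (_ *: _).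
  by field.
- by rewrite subr0.
- rewrite subr0 mulr0 add0r !addr0; congr (_ *: _ + _ *: _ - _).
  by field.
Qed.

Lemma derive_Moser (P : 'rV[R]_2) (z : phase) :
  differentiable (Moser P) z /\ forall v, 'D_v (Moser P) z = dMoser P z v.
Proof. by have [/derive_vpair h /h[]] := vgrad_Moser P z. Qed.

(** The Moser map is a cotangent lift and preserves the canonical form: eta d xi = y dx, with x = -
    p and y = q - P. *)
Lemma Moser_can_form (P : 'rV[R]_2) (z v : phase) :
  can_form (Moser P z) ('D_v (Moser P) z) = - dot (z.1 - P) v.2.
Proof.
rewrite (derive_Moser P z).2 /can_form /dMoser /Moser /= -dotNr.
have h := dot1_neq0 (- z.2).
move: (- z.2) (z.1 - P) (- v.2) v.1 h => x y dx dy h.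
rewrite !dot_row_mx !dot_const !(dotZl, dotZr, dotBl, dotBr, dotNl, dotNr).
move: h; rewrite ?(dotC y x) ?(dotC dx x) ?(dotC dy x) ?(dotC dx y).
by move: (dot x x) (dot x y) (dot x dx) (dot x dy) (dot y dx) => *; field.
Qed.

Lemma can_omegaE (w u v : amb) : can_omega w u v = dot u.2 v.1 - dot v.2 u.1.
Proof.
have D (c a : amb) : 'D_a (fun x : amb => can_form x c) w = dot a.2 c.1.
  have := has_grad_dot (V := amb) (vgrad_snd w) (vgrad_cst c.1 w).
  by case=> _ ->; rewrite dot0r add0r dotC.
by rewrite /can_omega /ext_d !D.
Qed.

Lemma Moser_can_omega (P : 'rV[R]_2) (z u v : phase) :
  can_omega (Moser P z) ('D_u (Moser P) z) ('D_v (Moser P) z) = omega z u v.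
Proof.
rewrite can_omegaE !(derive_Moser P z).2 /omega /dMoser /=.
have -> : dot u.2 v.1 - dot v.2 u.1 = dot (- v.2) u.1 - dot (- u.2) v.1.
  by rewrite !dotNl; ring.
have h := dot1_neq0 (- z.2).
move: (- z.2) (z.1 - P) (- v.2) v.1 (- u.2) u.1 h => x y bx by' ax ay h.
rewrite !dot_row_mx !dot_const !(dotZl, dotZr, dotBl, dotBr, dotNl, dotNr, dotDl, dotDr).
move: h; rewrite ?(dotC y x) ?(dotC ax x) ?(dotC ay x) ?(dotC bx x) ?(dotC by' x)
  ?(dotC ax y) ?(dotC bx y) ?(dotC ay y) ?(dotC by' y) ?(dotC ay bx) ?(dotC by' ax) ?(dotC bx ax).
by move: (dot x x) (dot x y) (dot x ax) (dot x ay) (dot x bx) (dot x by')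
  (dot y ax) (dot y bx) (dot ax bx) (dot bx ay) (dot ax by') => *; field.
Qed.

End Phase.

(** * The contact criterion *)

Section ContactCriterion.
Context {R : realType}.
Local Notation phase := (phase R).
Local Notation amb := (amb R).

Lemma dot2E (u v : 'rV[R]_2) : dot u v = u 0 0 * v 0 0 + u 0 1 * v 0 1.
Proof. by rewrite /dot big_ord_recl big_ord1; congr (_ + u 0 _ * v 0 _); apply/val_inj. Qed.

Lemma vec20 (a b : R) : vec2 a b 0 0 = a. Proof. by rewrite mxE. Qed.
Lemma vec21 (a b : R) : vec2 a b 0 1 = b. Proof. by rewrite mxE. Qed.

Lemma omega_ham (z v : phase) (gq gp : 'rV[R]_2) :
  omega z (gp, - gq) v = - (dot gq v.1 + dot gp v.2).
Proof. by rewrite /omega /= dotNl (dotC gp) opprD. Qed.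

(* Rotating the gradient by the unit quaternions j and k. *)
Lemma omega_kernel (z : phase) (gq gp : 'rV[R]_2) : exists v w : phase,
  [/\ dot gq v.1 + dot gp v.2 = 0, dot gq w.1 + dot gp w.2 = 0 &
      omega z v w = - (dot gq gq + dot gp gp)].
Proof.
exists (vec2 (- gq 0 1) (gq 0 0), vec2 (gp 0 1) (- gp 0 0)).
exists (vec2 (- gp 0 1) (gp 0 0), vec2 (- gq 0 1) (gq 0 0)).
by rewrite /omega /= !dot2E !vec20 !vec21; split; ring.
Qed.

(** By [omega_ham], X = (gp, - gq) pairs to zero with every vector killed by the differential. So
    only lam(X) omega(v, w) survives in the wedge product, and omega(v, w) is minus the squared
    gradient, which is nonzero because lam(X) is. *)
Lemma volume_form_phase (S : set phase) (lam : phase -> phase -> R) :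
  (forall z, lam z 0 = 0) ->
  (forall z, S z -> exists gq gp : 'rV[R]_2,
    (forall v, dot gq v.1 + dot gp v.2 = 0 -> tangent S z v) /\
    lam z (gp, - gq) != 0) ->
  volume_form S (wedge12 lam omega).
Proof.
move=> lam0 H z /H[gq [gp [tan lamn0]]].
have [v [w [kv kw vw]]] := omega_kernel z gq gp.
exists (gp, - gq), v, w; split; try exact: tan.
  by apply: tan; rewrite /= dotNr (dotC gp) subrr.
rewrite /wedge12 !omega_ham kv kw oppr0 !mulr0 subr0 addr0 vw mulf_neq0 //.
rewrite oppr_eq0 paddr_eq0 ?dot_ge0 // !dot_eq0; apply: contra lamn0.
by move=> /andP[/eqP -> /eqP ->]; rewrite oppr0 lam0.
Qed.

(** The same criterion read in a chart with derivative [dF]: [z] is the point in the chart and (gq,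
    gp) the gradient of a defining function there. It serves for [Moser] and, at collisions, for
    [Psi]. *)
Lemma volume_form_chart (S : set amb) :
  (forall w, S w -> exists (dF : phase -> amb) z (gq gp P : 'rV[R]_2),
    [/\ forall v, can_form w (dF v) = - dot (z.1 - P) v.2,
        forall u v, can_omega w (dF u) (dF v) = omega z u v,
        forall v, dot gq v.1 + dot gp v.2 = 0 -> tangent S w (dF v) &
        dot (z.1 - P) gq != 0]) ->
  volume_form S (wedge12 can_form can_omega).
Proof.
move=> H w /H[dF [z [gq [gp [P [Fform Fomega tan n0]]]]]].
have [v [v' [kv kv' vv']]] := omega_kernel z gq gp.
exists (dF (gp, - gq)), (dF v), (dF v'); split; try exact: tan.
  by apply: tan; rewrite /= dotNr (dotC gp) subrr.
rewrite /wedge12 !Fomega !omega_ham kv kv' oppr0 !mulr0 subr0 addr0 vv' Fform.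
rewrite mulf_neq0 // ?oppr_eq0 /= ?dotNr ?oppr_eq0 //.
rewrite paddr_eq0 ?dot_ge0 // !dot_eq0; apply: contra n0.
by move=> /andP[/eqP -> _]; rewrite dot0r.
Qed.

End ContactCriterion.

(** * The Hamiltonian and its gradient *)

Section Hamiltonian.
Context {R : realType}.
Local Notation phase := (phase R).

Lemma enorm_ge0 n (u : 'rV[R]_n) : 0 <= enorm u.
Proof. exact: sqrtr_ge0. Qed.

Lemma enormX2 n (u : 'rV[R]_n) : enorm u ^+ 2 = dot u u.
Proof. by rewrite sqr_sqrtr // dot_ge0. Qed.

Lemma enorm_eq0 n (u : 'rV[R]_n) : (enorm u == 0) = (u == 0).
Proof. by rewrite sqrtr_eq0 le_eqVlt ltNge dot_ge0 orbF dot_eq0. Qed.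

Lemma enorm_gt0 n (u : 'rV[R]_n) : (0 < enorm u) = (u != 0).
Proof. by rewrite lt_neqAle eq_sym enorm_eq0 enorm_ge0 andbT. Qed.

Lemma enormZ n (a : R) (u : 'rV[R]_n) : enorm (a *: u) = `|a| * enorm u.
Proof. by rewrite /enorm dotZl dotZr mulrA -expr2 sqrtrM ?sqr_ge0 // sqrtr_sqr. Qed.

Lemma has_grad_enorm (V : normedModType R) n (F : V -> 'rV[R]_n) z dF :
  vgrad F z dF -> F z != 0 ->
  has_grad (fun x => enorm (F x)) z (fun v => dot (F z) (dF v) / enorm (F z)).
Proof.
move=> hF Fz; have F0 : 0 < dot (F z) (F z).
  by rewrite lt_neqAle eq_sym dot_eq0 Fz dot_ge0.
apply: (has_grad_eq (has_grad_comp (has_grad_dot hF hF) (is_derive1_sqrt F0))) => v.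
by rewrite -/(enorm (F z)); field; rewrite gt_eqF // enorm_gt0.
Qed.

Lemma has_grad_cont_near (V : normedModType R) (f : V -> R) z : {for z, continuous f} ->
  0 < f z -> \forall x \near z, 0 < f x.
Proof. by move=> cf fz; exact: (cvgr_gt (f z)). Qed.

Lemma cont_dot (V : normedModType R) n (F G : V -> 'rV[R]_n) z dF dG :
  vgrad F z dF -> vgrad G z dG -> {for z, continuous (fun x => dot (F x) (G x))}.
Proof. by move=> hF hG; apply: has_grad_cont (has_grad_dot hF hG). Qed.

Lemma near_neq0 (V : normedModType R) n (F : V -> 'rV[R]_n) z dF :
  vgrad F z dF -> F z != 0 -> \forall x \near z, F x != 0.
Proof.
move=> hF Fz.
have F0 : 0 < dot (F z) (F z) by rewrite lt_neqAle eq_sym dot_eq0 Fz dot_ge0.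
apply: filterS (has_grad_cont_near (cont_dot hF hF) F0) => x.
by rewrite -dot_eq0 => /gt_eqF ->.
Qed.

Lemma enorm_cont n (F : 'rV[R]_n) : {for F, continuous (@enorm R n)}.
Proof.
have : vgrad (V := 'rV[R]_n) id F id.
  move=> i; apply: (has_grad_lin (V := 'rV[R]_n) (l := fun x => x 0 i)).
    by move=> k x y; rewrite !mxE.
  by move=> x; exact: coord_continuous.
move=> h; apply: (@continuous_comp _ _ _ (fun x => dot x x) Num.sqrt).
  exact: (cont_dot h h).
exact: sqrt_continuous.
Qed.

(* Both roles of a primary: see Ham_earth and Ham_moon. *)
Definition Ham2 (m : R) (P : 'rV[R]_2) (m' : R) (P' : 'rV[R]_2) (z : phase) : R :=
  2^-1 * dot z.2 z.2 - m / enorm (z.1 - P) - m' / enorm (z.1 - P')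
  + (z.2 0 0 * z.1 0 1 - z.2 0 1 * z.1 0 0).

Lemma Ham_earth mu : Ham mu = Ham2 (1 - mu) (earth mu) mu (moon mu).
Proof. by apply/funext => z; rewrite /Ham /Ham2 enormX2 addrA. Qed.

Lemma Ham_moon mu : Ham mu = Ham2 mu (moon mu) (1 - mu) (earth mu).
Proof. by apply/funext => z; rewrite /Ham /Ham2 enormX2; ring. Qed.

Definition gradq m P m' P' (z : phase) : 'rV[R]_2 :=
  (m / enorm (z.1 - P) ^+ 3) *: (z.1 - P) + (m' / enorm (z.1 - P') ^+ 3) *: (z.1 - P')
  + vec2 (- z.2 0 1) (z.2 0 0).
(** The velocity in the rotating frame; half its square is the kinetic part of the energy in
    [Ham_Upot]. *)
Definition gradp (z : phase) : 'rV[R]_2 := z.2 + vec2 (z.1 0 1) (- z.1 0 0).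

Lemma has_grad_Ham2 m P m' P' z : z.1 != P -> z.1 != P' ->
  has_grad (Ham2 m P m' P') z
    (fun v => dot (gradq m P m' P' z) v.1 + dot (gradp z) v.2).
Proof.
rewrite -subr_eq0 -[z.1 == P']subr_eq0 => zP zP'.
have gp := vgrad_snd z; have gq := vgrad_fst z.
have gE := has_grad_enorm (vgradB gq (vgrad_cst P z)) zP.
have gE' := has_grad_enorm (vgradB gq (vgrad_cst P' z)) zP'.
have e0 : enorm (z.1 - P) != 0 by rewrite enorm_eq0.
have e0' : enorm (z.1 - P') != 0 by rewrite enorm_eq0.
have := has_gradD (has_gradB (has_gradB
  (has_gradM (has_grad_cst 2^-1 z) (has_grad_dot gp gp))
  (has_gradM (has_grad_cst m z) (has_gradV gE e0)))
  (has_gradM (has_grad_cst m' z) (has_gradV gE' e0')))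
  (has_gradB (has_gradM (gp 0) (gq 1)) (has_gradM (gp 1) (gq 0))).
move=> h; apply: (has_grad_eq h) => v; rewrite !subr0 /gradq /gradp.
rewrite !(dotDl, dotZl) !(dot2E (vec2 _ _)) !vec20 !vec21.
by field; rewrite e0 e0'.
Qed.

Lemma Ham_Upot mu (z : phase) : Ham mu z =
  2^-1 * (gradp z 0 0 ^+ 2 + gradp z 0 1 ^+ 2) + Upot mu z.1.
Proof.
rewrite /Ham /Upot /gradp !enormX2 !dot2E ![(_ + vec2 _ _) 0 _]mxE !vec20 !vec21.
by move: (_ / enorm (z.1 - earth mu)) (_ / enorm (z.1 - moon mu)) => a b; field.
Qed.

Lemma near_fst_neq (P : 'rV[R]_2) (z : phase) : z.1 != P -> \forall x \near z, x.1 != P.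
Proof.
move=> zP; have := near_neq0 (vgradB (vgrad_fst z) (vgrad_cst P z)).
rewrite subr_eq0 => /(_ zP); apply: filterS => x; by rewrite subr_eq0.
Qed.

Lemma cont_Ham2_near m P m' P' (z : phase) : z.1 != P -> z.1 != P' ->
  \forall x \near z, {for x, continuous (Ham2 m P m' P')}.
Proof.
move=> zP zP'; near=> x; apply: has_grad_cont (has_grad_Ham2 m m' _ _).
  by near: x; exact: near_fst_neq.
by near: x; exact: near_fst_neq.
Unshelve. all: by end_near. Qed.

Lemma tangent_Ham2 m P m' P' (S : set phase) (z v : phase) :
  z.1 != P -> z.1 != P' ->
  (gradq m P m' P' z != 0) || (gradp z != 0) ->
  (\forall x \near z, Ham2 m P m' P' x = Ham2 m P m' P' z -> S x) ->
  dot (gradq m P m' P' z) v.1 + dot (gradp z) v.2 = 0 -> tangent S z v.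
Proof.
move=> zP zP' g0 Sz kv.
apply: (tangent_level (n := (gradq m P m' P' z, gradp z)) (has_grad_Ham2 m m' zP zP')) => //=.
  by rewrite paddr_eq0 ?dot_ge0 // !dot_eq0 negb_and.
exact: cont_Ham2_near.
Qed.

Lemma volume_form_Ham2 m P m' P' c (S : set phase) (lam : phase -> phase -> R) :
  (forall z, lam z 0 = 0) ->
  (forall z, S z -> [/\ z.1 != P, z.1 != P' & Ham2 m P m' P' z = c]) ->
  (forall z, S z -> \forall x \near z, Ham2 m P m' P' x = c -> S x) ->
  (forall z, S z -> lam z (gradp z, - gradq m P m' P' z) != 0) ->
  volume_form S (wedge12 lam omega).
Proof.
move=> lam0 SH Sopen lamX; apply: volume_form_phase => // z Sz.
exists (gradq m P m' P' z), (gradp z); split; last exact: lamX.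
have [zP zP' Hz] := SH _ Sz => v; apply: tangent_Ham2 => //.
  rewrite -negb_and; apply: contra (lamX _ Sz) => /andP[/eqP -> /eqP ->].
  by rewrite oppr0 lam0.
by rewrite Hz; exact: Sopen.
Qed.

End Hamiltonian.

(** * Collisions *)

Section Regularization.
Context {R : realType}.
Local Notation phase := (phase R).
Local Notation amb := (amb R).

(** The reflection exchanging the poles: [Moser] sends p = 0 to the south pole, its reflection sends
    it to the north pole. *)
Definition flip (u : 'rV[R]_(1 + 2)) : 'rV[R]_(1 + 2) := row_mx (- lsubmx u) (rsubmx u).

Lemma dot_flip u v : dot (flip u) (flip v) = dot u v.
Proof.
rewrite -[in RHS](hsubmxK u) -[in RHS](hsubmxK v) !dot_row_mx.
by rewrite dotNl dotNr opprK.
Qed.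

Lemma vgrad_flip (V : normedModType R) (F : V -> 'rV[R]_(1 + 2)) z dF :
  vgrad F z dF -> vgrad (fun x => flip (F x)) z (fun v => flip (dF v)).
Proof.
move=> h; apply: vgrad_row_mx => i.
  have -> : (fun x => (- lsubmx (F x)) 0 i) = fun x => - F x 0 (lshift 2 i).
    by apply/funext => x; rewrite !mxE.
  by apply: (has_grad_eq (has_gradN (h _))) => v; rewrite !mxE.
have -> : (fun x => rsubmx (F x) 0 i) = fun x => F x 0 (rshift 1 i).
  by apply/funext => x; rewrite !mxE.
by apply: (has_grad_eq (h _)) => v; rewrite !mxE.
Qed.

(* The chart of T^*S^2 around the fibre over the north pole: stereographic
   projection from the south pole. *)
Definition Psi (z : phase) : amb := (flip (Moser 0 z).1, flip (Moser 0 z).2).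

Definition dPsi (z v : phase) : amb := (flip (dMoser 0 z v).1, flip (dMoser 0 z v).2).

Lemma derive_Psi (z : phase) :
  differentiable Psi z /\ forall v, 'D_v Psi z = dPsi z v.
Proof.
have [h1 h2] := vgrad_Moser 0 z.
by have [] := derive_vpair (vgrad_flip h1) (vgrad_flip h2).
Qed.

(* In stereographic coordinates the change of charts is the inversion
   p |-> p/|p|^2 and its cotangent lift. *)
Definition Inv (P : 'rV[R]_2) (z : phase) : phase :=
  (dot z.2 z.2 *: z.1 - (2 * dot z.2 z.1) *: z.2 + P, (dot z.2 z.2)^-1 *: z.2).

Lemma Moser_Inv P z : z.2 != 0 -> Moser P (Inv P z) = Psi z.
Proof.
rewrite -dot_eq0 => n0; have n1 := dot1_neq0 z.2.
have i1 : (dot z.2 z.2)^-1 + 1 != 0.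
  have -> : (dot z.2 z.2)^-1 + 1 = (dot z.2 z.2 + 1) / dot z.2 z.2 by field.
  by rewrite mulf_neq0 // invr_neq0.
rewrite /Moser /Psi /Inv /= /flip !addrK !subr0.
move: z n0 n1 i1 => [q p] /=; set n := dot p p; set k := dot p q => n0 n1 i1.
rewrite !(row_mxKl, row_mxKr) !(dotNl, dotNr, dotZl, dotZr, dotBr) -/n -/k !opprK.
have xx : n^-1 * (n^-1 * n) = n^-1 by field.
have xy : - (n^-1 * (n * k - 2 * k * n)) = k by field.
rewrite xx xy.
congr (row_mx _ _, row_mx _ _).
- by apply/rowP => i; rewrite !mxE; field; rewrite ?n0 ?n1 ?(addrC 1) ?n1.
- rewrite !scalerN scalerA; congr (- (_ *: _)).
  by field; rewrite ?n0 ?n1 ?(addrC 1) ?n1.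
- by apply/rowP => i; rewrite !mxE opprK.
- rewrite scalerBr !scalerA scalerN scalerA opprK -addrA -scaleNr -scalerDl.
  rewrite scalerN scaleNr opprK -scaleNr; congr (_ *: _ + _ *: _); field => //.
Qed.

Lemma Inv_neq0 P z : z.2 != 0 -> (Inv P z).2 != 0.
Proof.
by move=> p0; rewrite /Inv /= scaler_eq0 invr_eq0 dot_eq0 negb_or p0.
Qed.

Lemma InvK P z : z.2 != 0 -> Inv P (Inv 0 (z.1 - P, z.2)) = z.
Proof.
case: z => q p /=; rewrite -dot_eq0 => n0.
have [y ->] : exists y, q = y + P by exists (q - P); rewrite subrK.
rewrite /Inv /= !addr0 !addrK.
rewrite !(dotZl, dotZr, dotBr); set n := dot p p; set k := dot p y.
congr pair; last first.
  by rewrite scalerA -[RHS]scale1r; congr (_ *: _); field.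
congr (_ + P); rewrite scalerBr !scalerA -addrA -opprD -scalerDl.
have H a b : a = 1 -> b = 0 -> a *: y - b *: p = y.
  by move=> -> ->; rewrite scale1r scale0r subr0.
by apply: H; field.
Qed.

(* |p|^2 |q| (H o Inv - c), which extends smoothly to the collisions p = 0. *)
Definition Kmoser m (P : 'rV[R]_2) m' (P' : 'rV[R]_2) c (z : phase) : R :=
  enorm z.1 * ((2^-1 + (z.2 0 0 * P 0 1 - z.2 0 1 * P 0 0)) + dot z.2 z.2 *
    ((z.2 0 0 * z.1 0 1 - z.2 0 1 * z.1 0 0 - c) - m' / enorm ((Inv P z).1 - P'))) - m.

Lemma dot_Inv P z : dot ((Inv P z).1 - P) ((Inv P z).1 - P) = dot z.2 z.2 ^+ 2 * dot z.1 z.1.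
Proof.
rewrite /Inv /= addrK !(dotBl, dotBr, dotZl, dotZr) (dotC z.1 z.2); ring.
Qed.

Lemma enorm_Inv P z : enorm ((Inv P z).1 - P) = dot z.2 z.2 * enorm z.1.
Proof.
by rewrite /enorm dot_Inv sqrtrM ?sqr_ge0 // sqrtr_sqr ger0_norm ?dot_ge0.
Qed.

Lemma Ham2_Inv m P m' P' c z : z.1 != 0 -> z.2 != 0 -> (Inv P z).1 != P' ->
  Ham2 m P m' P' (Inv P z) - c = Kmoser m P m' P' c z / (dot z.2 z.2 * enorm z.1).
Proof.
move=> q0 p0; rewrite -subr_eq0 -enorm_eq0 => e0.
rewrite /Ham2 enorm_Inv /Kmoser.
move: (enorm ((Inv P z).1 - P')) e0 => e' e0.
move: q0 p0; rewrite -enorm_eq0 -dot_eq0 => q0 p0.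
have E : dot z.2 z.2 = z.2 0 0 * z.2 0 0 + z.2 0 1 * z.2 0 1 := dot2E _ _.
move: (enorm z.1) q0 => e q0; rewrite /Inv /= !(dotZl, dotZr) !mxE.
move: (dot z.2 z.1) => k.
move: (z.2 0 0) (z.2 0 1) (z.1 0 0) (z.1 0 1) E => p1 p2 q1 q2 E.
move: (dot z.2 z.2) p0 E => n p0 E.
field; by rewrite p0 q0 e0.
Qed.

(** The inverse of [Psi], off the south pole; see [Psi_chart] and [chartK]. *)
Definition chart (w : amb) : phase :=
  let xi0 := w.1 0 (lshift 2 0) in
  ((1 + xi0) *: rsubmx w.2 - w.2 0 (lshift 2 0) *: rsubmx w.1,
   - (1 + xi0)^-1 *: rsubmx w.1).

Lemma Psi_chart w : cotS2 w -> w.1 0 (lshift 2 0) != -1 -> Psi (chart w) = w.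
Proof.
case: w => xi eta [/=]; rewrite -(hsubmxK xi) -(hsubmxK eta).
move: (lsubmx xi) (rsubmx xi) (lsubmx eta) (rsubmx eta) => A x B y.
have cE (D : 'rV[R]_1) : D = const_mx (D 0 0).
  by apply/rowP => i; rewrite ord1 mxE.
rewrite /chart /= !row_mxEl !row_mxKr (cE A) (cE B) !mxE.
move: (A 0 0) (B 0 0) => a b {A B cE}.
rewrite !dot_row_mx !dot_const /Psi /Moser /flip /= !row_mxKl !row_mxKr ?row_mxEl.
move=> h1 h2 h3.
have a0 : 1 + a != 0 by apply: contra h3; rewrite addrC addr_eq0.
have xx : dot x x = (1 - a) * (1 + a) by rewrite -(addrK (a * a) (dot x x)) [_ + a * a]addrC h1; ring.
have xy : dot x y = - (a * b) by rewrite -(addrK (a * b) (dot x y)) [_ + a * b]addrC h2; ring.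
rewrite subr0 scaleNr opprK !(dotZl, dotZr, dotBr) xx xy.
have n2 : (1 + a)^-1 * ((1 + a)^-1 * ((1 - a) * (1 + a))) + 1 = 2 / (1 + a) by field.
have k2 : (1 + a)^-1 * ((1 + a) * - (a * b) - b * ((1 - a) * (1 + a))) = - b by field.
rewrite n2 k2; congr (row_mx _ _, row_mx _ _).
- by apply/rowP => i; rewrite !mxE; field.
- by rewrite scalerA -[RHS]scale1r; congr (_ *: _); field.
- by apply/rowP => i; rewrite !mxE opprK.
- rewrite scalerBr !scalerA.
  have H c d e : c = 1 -> d = - e -> c *: y - d *: x - e *: x = y.
    by move=> -> ->; rewrite scale1r scaleNr opprK addrK.
  by apply: H; field.
Qed.

Lemma chartK z : chart (Psi z) = z.
Proof.
case: z => q p; rewrite /chart /Psi /Moser /flip /= !row_mxKl !row_mxKr !subr0.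
have h := dot1_neq0 (- p); rewrite !row_mxEl !mxE.
move: h; rewrite dotNl dotNr opprK dotNl => h; congr (_, _).
- rewrite opprK scalerBr !scalerN !scalerA.
  have H c d e : c = 1 -> d = - e -> c *: q - - (d *: p) - - (e *: p) = q.
    by move=> -> ->; rewrite scale1r scaleNr opprK opprK subrK.
  by apply: H; field.
- have -> : 1 - (dot p p - 1) / (dot p p + 1) = 2 / (dot p p + 1) by field.
  by apply/rowP => i; rewrite !mxE; field.
Qed.

End Regularization.

Section RegularizedContact.
Context {R : realType}.
Local Notation phase := (phase R).
Local Notation amb := (amb R).

Lemma tangent_map (V W : normedModType R) (F : V -> W) (S : set V) (S' : set W) z v :
  tangent S z v -> differentiable F z -> (forall x, S x -> S' (F x)) ->
  tangent S' (F z) ('D_v F z).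
Proof.
move=> [g [g0 Sg dg]] dF SS'; exists (F \o g); split; first by rewrite /= g0.
  by apply: filterS Sg => t /SS'.
exact: is_derive_curve.
Qed.

Lemma closure_cont_eq0 (V : normedModType R) (f : V -> R) (A : set V) w :
  {for w, continuous f} -> closure A w ->
  (\forall x \near w, A x -> f x = 0) -> f w = 0.
Proof.
move=> cf clA Af; apply/eqP; apply: contrapT => /negP fw.
have n0 : 0 < `|f w| by rewrite normr_gt0.
have : \forall x \near w, 0 < `|f x|.
  apply: (has_grad_cont_near (f := fun x => `|f x|)) n0.
  by apply: (@continuous_comp _ _ _ f (fun t : R => `|t|)) => //; exact: norm_continuous.
by move=> h; have [x [Ax [/(_ Ax) ->]]] := clA _ (filterI Af h); rewrite normr0 ltxx.
Qed.

Lemma vgrad_Inv P (z : phase) : exists dF, vgrad (fun x => (Inv P x).1) z dF.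
Proof.
have gp := vgrad_snd z; have gq := vgrad_fst z.
have := vgradD (vgradB (vgradZ (has_grad_dot gp gp) gq)
  (vgradZ (has_gradM (has_grad_cst 2 z) (has_grad_dot gp gq)) gp)) (vgrad_cst P z).
by move=> h; eexists; exact: h.
Qed.

(** Separated from [Kmoser] because the latter must be continuous also at q = 0, where [enorm] is
    not differentiable: [collision_fibre] passes to the limit before it excludes q = 0. *)
Definition Kfactor (P : 'rV[R]_2) m' (P' : 'rV[R]_2) c (z : phase) : R :=
  (2^-1 + (z.2 0 0 * P 0 1 - z.2 0 1 * P 0 0)) + dot z.2 z.2 *
    ((z.2 0 0 * z.1 0 1 - z.2 0 1 * z.1 0 0 - c) - m' / enorm ((Inv P z).1 - P')).

Lemma has_grad_Kfactor P m' P' c (z : phase) : (Inv P z).1 != P' ->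
  exists L, has_grad (Kfactor P m' P' c) z L /\
    (z.2 = 0 -> forall v, L v = v.2 0 0 * P 0 1 - v.2 0 1 * P 0 0).
Proof.
rewrite -subr_eq0 => e0.
have gp := vgrad_snd z; have gq := vgrad_fst z.
have [dF hF] := vgrad_Inv P z.
have e1 : enorm ((Inv P z).1 - P') != 0 by rewrite enorm_eq0.
have h := has_gradD (has_gradD (has_grad_cst 2^-1 z)
    (has_gradB (has_gradM (gp 0) (has_grad_cst (P 0 1) z))
               (has_gradM (gp 1) (has_grad_cst (P 0 0) z))))
  (has_gradM (has_grad_dot gp gp)
    (has_gradB (has_gradB (has_gradB (has_gradM (gp 0) (gq 1)) (has_gradM (gp 1) (gq 0)))
                          (has_grad_cst c z))
      (has_gradM (has_grad_cst m' z) (has_gradV (has_grad_enorm (vgradB hF (vgrad_cst P' z)) e0) e1)))).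
eexists; split; first exact: h.
move=> z0 v; rewrite /= z0 !dot0l !mxE; ring.
Qed.

Lemma has_grad_Kmoser m P m' P' c (z : phase) : z.1 != 0 -> (Inv P z).1 != P' ->
  exists L, has_grad (Kmoser m P m' P' c) z L /\
    (z.2 = 0 -> forall v, L v = enorm z.1 * (v.2 0 0 * P 0 1 - v.2 0 1 * P 0 0)
                                + dot z.1 v.1 / enorm z.1 / 2).
Proof.
move=> q0 e0; have [L [hL L0]] := has_grad_Kfactor m' c e0.
have h := has_gradB (has_gradM (has_grad_enorm (vgrad_fst z) q0) hL) (has_grad_cst m z).
eexists; split; first exact: h.
move=> z0 v; rewrite /= L0 // subr0; congr (_ + _).
by rewrite /Kfactor z0 !dot0l !mxE !mul0r subrr !addr0 mulrC.
Qed.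

Lemma cont_Kmoser m P m' P' c (z : phase) : (Inv P z).1 != P' ->
  {for z, continuous (Kmoser m P m' P' c)}.
Proof.
move=> e0; have [L [hL _]] := has_grad_Kfactor m' c e0.
have c1 : {for z, continuous (fun x : phase => enorm x.1)}.
  by apply: (@continuous_comp _ _ _ fst (@enorm R 2)); [exact: cvg_fst|exact: enorm_cont].
have c2 := has_grad_cont hL.
exact: (cvgB (cvgM c1 c2) (cvg_cst m)).
Qed.

Lemma near_Inv_neq P P' (z : phase) : (Inv P z).1 != P' -> \forall x \near z, (Inv P x).1 != P'.
Proof.
have [dF hF] := vgrad_Inv P z.
rewrite -subr_eq0 => /(near_neq0 (vgradB hF (vgrad_cst P' z))).
by apply: filterS => x; rewrite subr_eq0.
Qed.

Lemma can_form_flip (w v : amb) :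
  can_form (flip w.1, flip w.2) (flip v.1, flip v.2) = can_form w v.
Proof. by rewrite /can_form /= dot_flip. Qed.

Lemma can_omega_flip (w w' u v : amb) :
  can_omega w (flip u.1, flip u.2) (flip v.1, flip v.2) = can_omega w' u v.
Proof. by rewrite !can_omegaE /= !dot_flip. Qed.

Section VolumeForm.
Variables (m m' c : R) (P P' : 'rV[R]_2) (T : set phase).
Hypotheses (m0 : 0 < m) (P'P : P != P').
Hypothesis TH : forall z, T z -> [/\ z.1 != P, z.1 != P' & Ham2 m P m' P' z = c].
Hypothesis Topen : forall z, T z -> \forall x \near z, Ham2 m P m' P' x = c -> T x.
Hypothesis Tstar : forall z, T z -> dot (z.1 - P) (gradq m P m' P' z) != 0.
Hypothesis Tnear : forall w, closure (Moser P @` T) w -> w.1 = north ->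
  exists2 r, 0 < r & forall z, z.1 != P -> z.1 != P' -> Ham2 m P m' P' z = c ->
    enorm (z.1 - P) < r -> T z.

Let S := Moser P @` T `|`
  [set w | [/\ cotS2 w, closure (Moser P @` T) w & w.1 = north]].

(** The collision circle in the fibre over the pole is thus |q| = 2 m. *)
Lemma Kmoser_collision (q : 'rV[R]_2) : Kmoser m P m' P' c (q, 0) = 2^-1 * enorm q - m.
Proof. by rewrite /Kmoser /= dot0l !mxE !mul0r subrr !addr0 mulrC. Qed.

Lemma Kmoser_T z : T z -> z.2 != 0 -> Kmoser m P m' P' c (Inv 0 (z.1 - P, z.2)) = 0.
Proof.
move=> Tz p0; have [zP zP' Hz] := TH Tz.
set y := Inv _ _.
have y2 : y.2 != 0 by exact: (@Inv_neq0 _ 0 (z.1 - P, z.2)).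
have yz : Inv P y = z by exact: InvK.
have y1 : y.1 != 0.
  apply: contra zP => /eqP y10; rewrite -yz -subr_eq0 -enorm_eq0 enorm_Inv y10.
  by rewrite /enorm dot0l sqrtr0 mulr0.
have := @Ham2_Inv _ m P m' P' c y y1 y2; rewrite yz Hz subrr => /(_ zP') /esym /eqP.
rewrite mulf_eq0 invr_eq0 mulf_eq0 dot_eq0 enorm_eq0 (negPf y1) (negPf y2).
by rewrite !orbF => /eqP.
Qed.

Lemma vgrad_rsubmx (V : normedModType R) (F : V -> 'rV[R]_(1 + 2)) z dF :
  vgrad F z dF -> vgrad (fun x => rsubmx (F x)) z (fun v => rsubmx (dF v)).
Proof.
move=> h i; have -> : (fun x => rsubmx (F x) 0 i) = fun x => F x 0 (rshift 1 i).
  by apply/funext => x; rewrite !mxE.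
by apply: (has_grad_eq (h _)) => v; rewrite !mxE.
Qed.

Lemma cont_chart (w : amb) : w.1 0 (lshift 2 0) != -1 -> {for w, continuous (@chart R)}.
Proof.
rewrite -subr_eq0 opprK addrC => h.
have g1 := vgrad_fst w; have g2 := vgrad_snd w.
have ga := has_gradD (has_grad_cst 1 w) (g1 (lshift 2 0)).
have [d _] := derive_vpair
  (vgradB (vgradZ ga (vgrad_rsubmx g2)) (vgradZ (g2 (lshift 2 0)) (vgrad_rsubmx g1)))
  (vgradZ (has_gradN (has_gradV ga h)) (vgrad_rsubmx g1)).
exact: differentiable_continuous d.
Qed.

Lemma north_fibre w : cotS2 w -> w.1 = north -> exists q : 'rV[R]_2, chart w = (q, 0) /\ w = Psi (q, 0).
Proof.
move=> cw wN.
have n0 : w.1 0 (lshift 2 0) != -1.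
  by rewrite wN /north row_mxEl mxE -subr_eq0 opprK gt_eqF // addr_gt0.
have c2 : (chart w).2 = 0 by rewrite /chart /= wN /north row_mxKr scaler0.
exists (chart w).1; rewrite -c2 -surjective_pairing; split => //.
by rewrite Psi_chart.
Qed.

Lemma Psi_fibre (q : 'rV[R]_2) : cotS2 (Psi (q, 0)) /\ (Psi (q, 0)).1 = north.
Proof.
have [h1 h2] := Moser_cotS2 0 ((q, 0) : phase).
split; first by split; rewrite /= dot_flip.
rewrite /Psi /Moser /flip /north /= row_mxKl row_mxKr oppr0 dot0l scaler0.
by congr row_mx; apply/rowP => i; rewrite !mxE sub0r add0r divr1 opprK.
Qed.

(** [Kmoser] composed with [chart] is continuous at w and vanishes on the image of [T] near w, hence
    at w. At q = 0 it would be - m. *)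
Lemma collision_fibre w : cotS2 w -> closure (Moser P @` T) w -> w.1 = north ->
  exists q : 'rV[R]_2, [/\ w = Psi (q, 0), q != 0 & Kmoser m P m' P' c (q, 0) = 0].
Proof.
move=> cw clw wN; have [q [cq wq]] := north_fibre cw wN.
have n0 : w.1 0 (lshift 2 0) != -1.
  by rewrite wN /north row_mxEl mxE -subr_eq0 opprK gt_eqF // addr_gt0.
have K0 : Kmoser m P m' P' c (q, 0) = 0.
  rewrite -cq; apply: (@closure_cont_eq0 _ (Kmoser m P m' P' c \o @chart R) (Moser P @` T)) => //.
    apply: continuous_comp; first exact: cont_chart.
    by apply: cont_Kmoser; rewrite cq /Inv /= dot0l scale0r dot0l mulr0 scaler0 subr0 add0r.
  (* Images of points with p = 0 have xi_0 = - 1 and stay away from w; for the others the change of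
     charts [Inv] is available. *)
  have c1 : {for w, continuous (fun x : amb => 1 + x.1 0 (lshift 2 0))}.
    exact: has_grad_cont (has_gradD (has_grad_cst 1 w) (vgrad_fst w (lshift 2 0))).
  have w0 : 0 < 1 + w.1 0 (lshift 2 0) by rewrite wN /north row_mxEl mxE addr_gt0.
  apply: filterS (has_grad_cont_near c1 w0) => x x0 [z Tz zx] /=.
  have p0 : z.2 != 0.
    apply: contraTN x0 => /eqP z0; rewrite -zx /Moser /= row_mxEl mxE z0 oppr0 dot0l.
    by rewrite sub0r add0r divr1 subrr ltxx.
  by rewrite -zx -{1}(InvK P p0) Moser_Inv ?chartK ?Kmoser_T // Inv_neq0.
exists q; split => //; apply: contra_eqN K0 => /eqP ->.
rewrite Kmoser_collision /enorm dot0l sqrtr0 mulr0 sub0r oppr_eq0.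
by rewrite gt_eqF.
Qed.

Section NearCollision.
Variables (r : R).
Hypothesis r0 : 0 < r.
Hypothesis Tr : forall z, z.1 != P -> z.1 != P' -> Ham2 m P m' P' z = c ->
    enorm (z.1 - P) < r -> T z.

Lemma Inv_collision (q : 'rV[R]_2) : (Inv P (q, 0)).1 = P.
Proof. by rewrite /Inv /= dot0l scale0r dot0l mulr0 scaler0 subr0 add0r. Qed.

(** [Inv] takes x to a point of the level, because [Kmoser] vanishes, at distance |p|^2 |q| from P,
    which is small near p = 0. *)
Lemma near_collision (q : 'rV[R]_2) : q != 0 ->
  \forall x \near ((q, 0) : phase), Kmoser m P m' P' c x = 0 -> x.2 != 0 ->
    (Moser P @` T) (Psi x).
Proof.
move=> q0.
have h1 : \forall x \near ((q, 0) : phase), x.1 != 0 by exact: near_fst_neq.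
have h2 : \forall x \near ((q, 0) : phase), (Inv P x).1 != P'.
  by apply: near_Inv_neq; rewrite Inv_collision.
have h3 : \forall x \near ((q, 0) : phase), 0 < r - dot x.2 x.2 * enorm x.1.
  apply: (has_grad_cont_near (f := fun x : phase => r - dot x.2 x.2 * enorm x.1)).
    apply: has_grad_cont (has_gradB (has_grad_cst r _) (has_gradM
      (has_grad_dot (vgrad_snd _) (vgrad_snd _)) (has_grad_enorm (vgrad_fst _) _))).
    exact: q0.
  by rewrite /= dot0l mul0r subr0.
near=> x => Kx p0.
have x1 : x.1 != 0 by near: x.
have x2 : (Inv P x).1 != P' by near: x.
have x3 : 0 < r - dot x.2 x.2 * enorm x.1 by near: x.
exists (Inv P x); last exact: Moser_Inv.
apply: Tr => //.
- by rewrite -subr_eq0 -enorm_eq0 enorm_Inv mulf_neq0 ?dot_eq0 ?enorm_eq0.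
- by apply/eqP; rewrite -subr_eq0 Ham2_Inv // Kx mul0r.
- by rewrite enorm_Inv -subr_gt0.
Unshelve. all: by end_near. Qed.

Lemma Kmoser_level (q : 'rV[R]_2) (S0 : set phase) (v : phase) : q != 0 ->
  Kmoser m P m' P' c (q, 0) = 0 ->
  (\forall x \near ((q, 0) : phase), Kmoser m P m' P' c x = 0 -> S0 x) ->
  enorm q * (v.2 0 0 * P 0 1 - v.2 0 1 * P 0 0) + dot q v.1 / enorm q / 2 = 0 ->
  tangent S0 ((q, 0) : phase) v.
Proof.
move=> q0 K0 KS kv.
have e0 : (Inv P ((q, 0) : phase)).1 != P' by rewrite Inv_collision.
have [L [hL LE]] := @has_grad_Kmoser m P m' P' c (q, 0) q0 e0.
apply: (tangent_level (n := (q, 0)) hL).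
- rewrite LE //= !mxE !mul0r subrr mulr0 add0r !mulf_neq0 ?dot_eq0 //.
  by rewrite invr_eq0 enorm_eq0.
- by rewrite LE.
- by apply: filterS (near_Inv_neq e0) => x; exact: cont_Kmoser.
- by rewrite K0.
Qed.

(** A curve in the zero set of [Kmoser] along which p_1 has velocity 1 leaves p = 0 at once, and
    [near_collision] puts its other points close to the start into the image of [T]. *)
Lemma closure_fibre (q : 'rV[R]_2) : q != 0 -> Kmoser m P m' P' c (q, 0) = 0 ->
  closure (Moser P @` T) (Psi (q, 0)).
Proof.
move=> q0 K0.
(* The q-component cancels the contribution of p_1 to the differential of [Kmoser]. *)
pose v : phase := (- (2 * P 0 1) *: q, vec2 1 0).
have : tangent [set x | Kmoser m P m' P' c x = 0] ((q, 0) : phase) v.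
  apply: Kmoser_level => //=; first by near=> x.
  rewrite vec20 vec21 dotZr -enormX2; field.
  by rewrite enorm_eq0.
move=> [g [g0 Kg dg]] B nB.
have cg : g t @[t --> (0 : R)] --> ((q, 0) : phase).
  rewrite -[X in _ --> X]g0; apply: differentiable_continuous.
  by apply/derivable1_diffP; case: dg.
have cP : Psi x @[x --> ((q, 0) : phase)] --> Psi (q, 0).
  by apply: differentiable_continuous; exact: (derive_Psi _).1.
have h1 := cg _ (cP _ nB).
have h2 := cg _ (near_collision q0).
have [d2 D2] : has_grad (fun x : phase => x.2 0 0) (q, 0) (fun v => v.2 0 0) by exact: vgrad_snd.
have [dh Dh] := is_derive_curve g0 dg d2.
have h3 : \forall t \near (0 : R)^', (g t).2 != 0.
  have lt0 : 0 < 'D_1 ((fun x : phase => x.2 0 0) \o g) 0 by rewrite Dh D2 /= vec20.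
  have hh := cvgr_gt _ dh _ lt0; apply: (filterS _ (hh _)) => t /=.
  rewrite g0 /= mxE subr0 addr0 [t *: 1]mulr1 => h; apply: contraTN h => /eqP ->.
  by rewrite mxE scaler0 ltxx.
have h4 : \forall t \near (0 : R)^', Kmoser m P m' P' c (g t) = 0 by exact: nbhs_dnbhs.
have h5 : \forall t \near (0 : R)^', B (Psi (g t)) by exact: nbhs_dnbhs.
have h6 := nbhs_dnbhs h2.
have hall : \forall t \near (0 : R)^', [/\ Kmoser m P m' P' c (g t) = 0, (g t).2 != 0,
    B (Psi (g t)) & (Kmoser m P m' P' c (g t) = 0 -> (g t).2 != 0 -> (Moser P @` T) (Psi (g t)))].
  by near=> t; split; near: t.
have PF : ProperFilter ((0 : R)^') by exact: Proper_dnbhs_numFieldType.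
have [t [Kt t2 Bt At]] := @filter_ex _ _ PF _ hall.
by exists (Psi (g t)); split => //; exact: At.
Unshelve. all: by end_near. Qed.

Lemma near_collision_S (q : 'rV[R]_2) : q != 0 -> Kmoser m P m' P' c (q, 0) = 0 ->
  \forall x \near ((q, 0) : phase), Kmoser m P m' P' c x = 0 -> S (Psi x).
Proof.
move=> q0 K0; have h1 : \forall x \near ((q, 0) : phase), x.1 != 0 by exact: near_fst_neq.
apply: filterS (filterI h1 (near_collision q0)) => -[q' p'] [/= q'0 h] Kx.
have [p0|p0] := eqVneq p' 0; last by left; exact: h.
move: Kx; rewrite p0 => Kx; right; have [c1 c2] := Psi_fibre q'.
by split => //; exact: closure_fibre.
Qed.

End NearCollision.

(** Away from collisions this is [Tstar] in the chart [Moser P]. At a collision the q-gradient of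
    [Kmoser] in the chart [Psi] is q / (2 |q|), whose product with q is |q| / 2. *)
Lemma volume_form_reg : volume_form S (wedge12 can_form can_omega).
Proof.
apply: volume_form_chart => w [[z Tz <-]|[cw clw wN]].
  exists (dMoser P z), z, (gradq m P m' P' z), (gradp z), P.
  have [d D] := derive_Moser P z; have [zP zP' Hz] := TH Tz.
  split=> [v|u v|v kv|]; last exact: Tstar.
  - by rewrite -D Moser_can_form.
  - by rewrite -!D Moser_can_omega.
  rewrite -D; apply: (@tangent_map _ _ _ T) => //; last by move=> x Tx; left; exists x.
  apply: tangent_Ham2 kv => //; last by rewrite Hz; exact: Topen.
  by apply/orP; left; apply: contra (Tstar Tz) => /eqP ->; rewrite dot0r.
have [r r0 Tr] := Tnear clw wN.
have [q [-> q0 Kq]] := collision_fibre cw clw wN.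
have [dM DM] := derive_Moser 0 ((q, 0) : phase).
exists (dPsi (q, 0)), (q, 0), ((2 * enorm q)^-1 *: q),
  (enorm q *: vec2 (P 0 1) (- P 0 0)), 0.
have [d D] := derive_Psi (q, 0).
split=> [v|u v|v kv|].
- by rewrite can_form_flip -DM Moser_can_form.
- by rewrite (can_omega_flip _ (Moser 0 (q, 0))) -!DM Moser_can_omega.
- rewrite -D; apply: (@tangent_map _ _ _ [set x | S (Psi x)]) => //.
  apply: Kmoser_level => //; first exact: near_collision_S r0 Tr _ q0 Kq.
  move: kv; rewrite !dotZl (dot2E (vec2 _ _)) vec20 vec21 => kv.
  by rewrite -[RHS]kv; field; rewrite enorm_eq0.
- rewrite /= subr0 dotZr -enormX2 mulf_neq0 // ?expf_neq0 ?enorm_eq0 //.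
  by rewrite invr_neq0 // mulf_neq0 ?enorm_eq0.
Qed.

End VolumeForm.
End RegularizedContact.

(** * The radial estimate *)

Section Radial.
Context {R : realType}.
Local Notation phase := (phase R).

Lemma le_of_sqr (x y : R) : 0 <= y -> x ^+ 2 <= y ^+ 2 -> x <= y.
Proof.
move=> y0 h; rewrite leNgt; apply/negP => yx.
by move: h; apply/negP; rewrite -ltNge; nra.
Qed.

Lemma lt_of_sqr (x y : R) : 0 <= y -> x ^+ 2 < y ^+ 2 -> x < y.
Proof.
move=> y0 h; rewrite ltNge; apply/negP => yx.
by move: h; apply/negP; rewrite -leNgt; nra.
Qed.

(** Multiplied by the mass of P', the right-hand side is the increase of U on the circle |q - P| =
    rho between the ray towards P' (v = 0) and the direction given by v; r is |q - P'|.
    Multiplication by a conjugate removes the square root r and leaves a polynomial inequality. *)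
Lemma gap1_ge (rho v r : R) : 0 < rho < 1 -> 0 <= v <= 2 -> 0 < r ->
  r ^+ 2 = (1 - rho) ^+ 2 + 2 * rho * v ->
  rho ^+ 3 * v / 8 <= (1 - rho)^-1 - rho * v - r^-1.
Proof.
move=> /andP[r0 r1] /andP[v0 v2] rr0 rE; set d := 1 - rho.
have d0 : 0 < d by rewrite subr_gt0.
have rd : rho = 1 - d by rewrite /d; ring.
have d1 : d < 1 by rewrite /d; lra.
have q : rho * d <= 1 / 4.
  by rewrite -subr_ge0 (_ : _ - _ = (d - 1 / 2) ^+ 2) ?sqr_ge0 // rd; field.
(* The right-hand side is the cofactor of rho^2 v in (1 - rho d v)^2 r^2 - d^2, see [key]. It is
   expanded in powers of 2 - v. *)
have Bk : rho <= 2 * (1 + d + d ^+ 2) + d ^+ 4 * v - 4 * d * v + 2 * rho * d ^+ 2 * v ^+ 2.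
  pose t := 2 - v; have vt : v = 2 - t by rewrite /t; ring.
  have t0 : 0 <= t by rewrite /t; lra.
  have h1 : 1 / 2 <= 1 - 2 * d + 3 * d ^+ 2 - d ^+ 3.
    have -> : 1 - 2 * d + 3 * d ^+ 2 - d ^+ 3 =
      1 / 2 + ((2 * d - 1) ^+ 2 / 2 + d ^+ 2 * (1 - d)) by field.
    by rewrite lerDl addr_ge0 ?divr_ge0 ?sqr_ge0 // mulr_ge0 ?sqr_ge0 // subr_ge0 ltW.
  have h2 : 0 <= d * (4 - d ^+ 3 - 8 * (rho * d)) + 2 * rho * d ^+ 2 * t.
    have : d ^+ 3 <= 1 by rewrite exprn_ile1 // ltW.
    move=> d3; apply: addr_ge0; first by apply: mulr_ge0; [exact: ltW|lra].
    by rewrite !mulr_ge0 ?sqr_ge0 // ltW.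
  have -> : 2 * (1 + d + d ^+ 2) + d ^+ 4 * v - 4 * d * v + 2 * rho * d ^+ 2 * v ^+ 2
    = 2 * rho * (1 - 2 * d + 3 * d ^+ 2 - d ^+ 3) +
      t * (d * (4 - d ^+ 3 - 8 * (rho * d)) + 2 * rho * d ^+ 2 * t).
    by rewrite vt rd; ring.
  have := mulr_ge0 t0 h2; nra.
have pos : 0 < 1 - rho * d * v.
  have : rho * d * v <= 1 / 4 * 2 by apply: ler_pM => //; rewrite ltW // mulr_gt0.
  lra.
have rdle : d <= r.
  by apply: le_of_sqr; rewrite ?rE ?lerDl ?mulr_ge0 // ltW.
have r2 : r <= 2.
  apply: le_of_sqr => //; rewrite rE -/d rd.
  have : (1 - d) * v <= (1 - d) * 2 by rewrite ler_wpM2l // subr_ge0 ltW.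
  have : d ^+ 2 <= 1 by rewrite exprn_ile1 // ltW.
  nra.
have key : rho ^+ 3 * v <= (1 - rho * d * v) ^+ 2 * r ^+ 2 - d ^+ 2.
  have -> : (1 - rho * d * v) ^+ 2 * r ^+ 2 - d ^+ 2 = rho ^+ 2 * v *
     (2 * (1 + d + d ^+ 2) + d ^+ 4 * v - 4 * d * v + 2 * rho * d ^+ 2 * v ^+ 2).
    by rewrite rE -/d rd; ring.
  by rewrite exprSr mulrAC ler_wpM2l // mulr_ge0 // ?exprn_ge0 // ltW.
have S0 : 0 < (1 - rho * d * v) * r + d by rewrite addr_gt0 ?mulr_gt0.
have -> : d^-1 - rho * v - r^-1 = ((1 - rho * d * v) * r - d) / (d * r).
  by field; rewrite !gt_eqF.
rewrite ler_pdivlMr ?mulr_gt0 //.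
have q1 : 1 - rho * d * v <= 1 by rewrite gerBl !mulr_ge0 // ltW.
have S4 : (1 - rho * d * v) * r + d <= 4.
  have : (1 - rho * d * v) * r <= 1 * 2 by apply: ler_pM => //; exact: ltW.
  by move: d1; lra.
have dr2 : d * r <= 2.
  have : d * r <= 1 * 2 by apply: ler_pM => //; exact: ltW.
  by rewrite mul1r.
(* The conjugate factor is at most 4 and d r at most 2: this is the 8 of the statement. *)
have S8 : ((1 - rho * d * v) * r + d) * (d * r) <= 8.
  have -> : 8 = 4 * 2 :> R by ring.
  by apply: ler_pM => //; apply: ltW => //; exact: mulr_gt0.
rewrite -(ler_pM2l S0).
have -> : ((1 - rho * d * v) * r + d) * ((1 - rho * d * v) * r - d) =
  (1 - rho * d * v) ^+ 2 * r ^+ 2 - d ^+ 2 by ring.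
apply: le_trans key; set w := rho ^+ 3 * v.
have w0 : 0 <= w by rewrite mulr_ge0 ?exprn_ge0 // ltW.
have -> : ((1 - rho * d * v) * r + d) * (w / 8 * (d * r)) =
  w / 8 * (((1 - rho * d * v) * r + d) * (d * r)) by ring.
rewrite [leRHS](_ : w = w / 8 * 8); last by field.
by rewrite ler_wpM2l // divr_ge0.
Qed.

(** The analogue of [gap1_ge] for the radial derivative of U on the same circle, again divided by
    the mass of P'. *)
Lemma gap2_ge0 (rho v r : R) : 0 < rho < 1 -> 0 <= v <= 2 -> 0 < r ->
  r ^+ 2 = (1 - rho) ^+ 2 + 2 * rho * v ->
  0 <= (1 - rho) ^- 2 - v - (1 - rho - v) / r ^+ 3.
Proof.
move=> /andP[r0 r1] /andP[v0 v2] rr0 rE; set d := 1 - rho.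
have d0 : 0 < d by rewrite subr_gt0.
have d1 : d < 1 by rewrite /d; lra.
have rd : rho = 1 - d by rewrite /d; ring.
have rr3 : 0 < r ^+ 3 by rewrite exprn_gt0.
have [vd|dv] := leP v d.
  have rdle : d <= r.
    by apply: le_of_sqr; rewrite ?rE ?lerDl ?mulr_ge0 // ltW.
  have h : (d - v) / r ^+ 3 <= (d - v) / d ^+ 3.
    rewrite ler_wpM2l ?subr_ge0 // lef_pV2 ?posrE ?exprn_gt0 //.
    by rewrite lerXn2r ?nnegrE // ltW.
  have -> : d ^- 2 = d / d ^+ 3 by field; rewrite gt_eqF.
  have : v <= v / d ^+ 3.
    rewrite ler_peMr // invf_ge1 ?exprn_gt0 //.
    by rewrite exprn_ile1 // ltW.
  move: h; rewrite mulrBl; lra.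
have h : (d - v) / r ^+ 3 <= 0 by rewrite pmulr_lle0 ?invr_gt0 // subr_le0 ltW.
have [vle|vgt] := leP v (d ^- 2); first by rewrite subr_ge0 (le_trans h) // subr_ge0.
have r1r : r <= 1 + rho.
  apply: le_of_sqr; first by lra.
  by rewrite rE; nra.
have r3 : r ^+ 3 <= (1 + rho) ^+ 3.
  by apply: lerXn2r => //; rewrite nnegrE; [exact: ltW|lra].
(* The power series of (1 - rho)^-2, truncated. *)
have dge : 1 + 2 * rho + 3 * rho ^+ 2 <= d ^- 2.
  rewrite -[leRHS]div1r ler_pdivlMr ?exprn_gt0 // rd.
  have -> : (1 + 2 * (1 - d) + 3 * (1 - d) ^+ 2) * d ^+ 2 =
    1 - (1 - d) ^+ 3 * (1 + 3 * d) by ring.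
  rewrite gerBl; apply: mulr_ge0; last by rewrite addr_ge0 // mulr_ge0 // ltW.
  by apply: exprn_ge0; rewrite subr_ge0 ltW.
have v1 : 1 < v.
  apply: le_lt_trans vgt; apply: le_trans dge.
  by rewrite -addrA lerDl addr_ge0 // mulr_ge0 ?sqr_ge0 // ltW.
suff : (v - d ^- 2) * r ^+ 3 <= v - d.
  rewrite -ler_pdivlMr // -[d - v]opprB mulNr; lra.
set w := v - 1 - 2 * rho - 3 * rho ^+ 2.
have [w0|w0] := leP w 0.
  have : (v - d ^- 2) * r ^+ 3 <= 0.
    by rewrite pmulr_lle0 //; rewrite /w in w0; lra.
  by move=> /le_trans; apply; rewrite subr_ge0 ltW.
have h1 : (v - d ^- 2) * r ^+ 3 <= w * (1 + rho) ^+ 3.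
  apply: ler_pM => //; [by rewrite subr_ge0 ltW|exact: ltW|].
  by rewrite /w; lra.
apply: (le_trans h1); rewrite /w.
have E : v - d - (v - 1 - 2 * rho - 3 * rho ^+ 2) * (1 + rho) ^+ 3 =
  (2 - v) * ((1 + rho) ^+ 3 - 1) + rho ^+ 2 * (1 + rho) * (6 + 8 * rho + 3 * rho ^+ 2).
  by rewrite rd; ring.
rewrite -subr_ge0 E addr_ge0 // mulr_ge0 //.
- by rewrite subr_ge0.
- by rewrite subr_ge0 exprn_ege1 // lerDl ltW.
- by rewrite mulr_ge0 ?sqr_ge0 //; lra.
- by nra.
Qed.

(** The right-hand side is U + s U' - s^2 / 2 - U(l1) with s = a - rho, see [brE] in [star_shaped].
    It splits into multiples of s^2, which are its value on the axis, and the two gaps, the second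
    one times s. *)
Lemma star_bracket (m a : R) : 0 < m < 1 -> 0 < a < 1 ->
  exists2 k, 0 < k & forall rho v r, 0 < rho <= a -> 0 <= v <= 2 -> 0 < r ->
    r ^+ 2 = (1 - rho) ^+ 2 + 2 * rho * v ->
    k * ((a - rho) ^+ 2 + v) <= m * (a - rho) ^+ 2 / (a * rho ^+ 2) +
      (1 - m) * ((1 - a)^-1 - a * v - r^-1 - (a - rho) * (1 - rho - v) / r ^+ 3).
Proof.
move=> /andP[m0 m1] /andP[a0 a1].
pose k1 := m / 2; pose k2 := m * a ^+ 2 / 16; pose k3 := (1 - m) * a ^+ 3 / 64.
have k10 : 0 < k1 by rewrite divr_gt0.
have k20 : 0 < k2 by rewrite divr_gt0 // mulr_gt0 // exprn_gt0.
have k30 : 0 < k3 by rewrite divr_gt0 // mulr_gt0 ?subr_gt0 // exprn_gt0.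
have [k kE] : exists k, k = Num.min k1 (Num.min k2 k3) by eexists.
have k0 : 0 < k by rewrite kE !lt_min k10 k20 k30.
have kk1 : k <= k1 by rewrite kE ge_min lexx.
have kk2 : k <= k2 by rewrite kE !ge_min lexx orbT.
have kk3 : k <= k3 by rewrite kE !ge_min lexx !orbT.
exists k => // rho v r /andP[rho0 rhoa] v02 r0 rE; have /andP[v0 v2] := v02.
have rho1 : 0 < rho < 1 by rewrite rho0 (le_lt_trans rhoa).
have := gap1_ge rho1 v02 r0 rE; have := gap2_ge0 rho1 v02 r0 rE.
set s := a - rho; have s0 : 0 <= s by rewrite subr_ge0.
have d0 : 0 < 1 - rho by rewrite subr_gt0; case/andP: rho1.
have a'0 : 0 < 1 - a by rewrite subr_gt0.
set g1 := _ - r^-1; set g2 := _ - _ / r ^+ 3 => g20 g1v.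
have -> : (1 - a)^-1 - a * v - r^-1 - s * (1 - rho - v) / r ^+ 3 =
   g1 + s * g2 + s ^+ 2 / ((1 - a) * (1 - rho) ^+ 2).
  by rewrite /g1 /g2 /s; field; rewrite !gt_eqF.
have h1 : m * s ^+ 2 <= m * s ^+ 2 / (a * rho ^+ 2).
  rewrite ler_peMr ?mulr_ge0 ?sqr_ge0 ?(ltW m0) // invf_ge1 ?mulr_gt0 ?exprn_gt0 //.
  have : rho ^+ 2 <= 1 by rewrite exprn_ile1 // ltW //; case/andP: rho1.
  by have := sqr_ge0 rho; nra.
have h2 : 0 <= s ^+ 2 / ((1 - a) * (1 - rho) ^+ 2).
  by rewrite divr_ge0 ?sqr_ge0 // mulr_ge0 ?sqr_ge0 // ltW.
have h3 := mulr_ge0 s0 g20.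
have m'0 : 0 < 1 - m by rewrite subr_gt0.
have h4 : (1 - m) * g1 <= (1 - m) * (g1 + s * g2 + s ^+ 2 / ((1 - a) * (1 - rho) ^+ 2)).
  by rewrite ler_wpM2l ?(ltW m'0) // -addrA lerDl addr_ge0.
suff : k * (s ^+ 2 + v) <= m * s ^+ 2 + (1 - m) * g1.
  by move=> /le_trans; apply; exact: lerD.
have g10 : 0 <= g1.
  by apply: le_trans g1v; rewrite divr_ge0 // mulr_ge0 // exprn_ge0 // ltW.
have ss := sqr_ge0 s.
(* For rho >= a / 2 the first gap controls v. For smaller rho one has s >= a / 2, and half of m s^2
   already exceeds the multiple of v, which is at most 2. *)
have [big|small] := leP (a / 2) rho.
  have : (a / 2) ^+ 3 <= rho ^+ 3 by rewrite lerXn2r // nnegrE ?divr_ge0 // ltW.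
  move=> c3; have : (a / 2) ^+ 3 * v <= rho ^+ 3 * v by rewrite ler_wpM2r.
  have -> : (a / 2) ^+ 3 * v = a ^+ 3 * v / 8 by field.
  move=> c4; have c5 : a ^+ 3 * v / 64 <= g1 by lra.
  have c6 : k3 * v <= (1 - m) * g1.
    have -> : k3 * v = (1 - m) * (a ^+ 3 * v / 64) by rewrite /k3; field.
    by rewrite ler_pM2l.
  have : k * v <= k3 * v by rewrite ler_wpM2r.
  have : k * s ^+ 2 <= k1 * s ^+ 2 by rewrite ler_wpM2r.
  have : 0 <= m * s ^+ 2 by rewrite mulr_ge0 // ltW.
  by rewrite mulrDr /k1; lra.
have c1 : a ^+ 2 / 4 <= s ^+ 2.
  have -> : a ^+ 2 / 4 = (a / 2) ^+ 2 by field.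
  apply: lerXn2r => //; first by rewrite nnegrE divr_ge0 // ltW.
  by rewrite /s; lra.
have : 0 <= (1 - m) * g1 by rewrite mulr_ge0 // ltW.
have : k * s ^+ 2 <= k1 * s ^+ 2 by rewrite ler_wpM2r.
have : k * v <= k2 * 2.
  by apply: ler_pM => //; exact: ltW.
rewrite mulrDr /k1 /k2.
have : m / 2 * (a ^+ 2 / 4) <= m / 2 * s ^+ 2 by rewrite ler_wpM2l // divr_ge0 // ltW.
by lra.
Qed.

Lemma dot_cauchy n (u v : 'rV[R]_n) : dot u v ^+ 2 <= dot u u * dot v v.
Proof.
have [/eqP|v0] := eqVneq (dot v v) 0.
  by rewrite dot_eq0 => /eqP ->; rewrite !dot0r expr0n mulr0.
have vp : 0 < dot v v by rewrite lt_neqAle eq_sym v0 dot_ge0.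
have := dot_ge0 (dot v v *: u - dot u v *: v).
rewrite !(dotBl, dotBr, dotZl, dotZr) (dotC v u) => h.
rewrite -subr_ge0 -(pmulr_rge0 _ vp); apply: le_trans h _.
by rewrite le_eqVlt; apply/orP; left; apply/eqP; ring.
Qed.

Lemma dot_le_enorm n (u v : 'rV[R]_n) : dot u v <= enorm u * enorm v.
Proof.
apply: le_of_sqr; first by rewrite mulr_ge0 ?enorm_ge0.
by rewrite exprMn !enormX2 dot_cauchy.
Qed.

(* Potential energy in the frame where the primaries P = - (1 - m) e and
   P' = m e lie along a unit vector e. *)
Definition U2 (m : R) (e q : 'rV[R]_2) : R :=
  - (m / enorm (q + (1 - m) *: e)) - (1 - m) / enorm (q - m *: e) - 2^-1 * dot q q.

Lemma Ham2_U2 m e z : Ham2 m (- (1 - m) *: e) (1 - m) (m *: e) z =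
  2^-1 * dot (gradp z) (gradp z) + U2 m e z.1.
Proof.
rewrite /Ham2 /U2 /gradp scaleNr opprK !(dotDl, dotDr).
rewrite !(dot2E (vec2 _ _)) (dot2E z.2 (vec2 _ _)) !vec20 !vec21 (dot2E z.1 z.1).
by move: (_ / enorm _) (_ / enorm _) (dot z.2 z.2) => a b c; field.
Qed.

(** Let t = |gradp|. The energy is U + t^2 / 2, and by Cauchy and Schwarz the angular part of (q -
    P) . H_q is at least - t rho. The bracket gives s^2 / 2 + t^2 / 2 < s U', which excludes s = 0
    and, since the left side is at least s t, yields t < U'. *)
Lemma star_shaped (m a : R) (e : 'rV[R]_2) : 0 < m < 1 -> 0 < a < 1 -> dot e e = 1 ->
  let P := - (1 - m) *: e in let P' := m *: e in let l := (a - (1 - m)) *: e in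
  exists2 k, 0 < k & forall z : phase, z.1 != P -> enorm (z.1 - P) <= a ->
    Ham2 m P (1 - m) P' z < U2 m e l + k * dot (z.1 - l) (z.1 - l) ->
    0 < dot (z.1 - P) (gradq m P (1 - m) P' z) /\ enorm (z.1 - P) < a.
Proof.
move=> m01 a01 ee P P' l; have [k k0 kP] := star_bracket m01 a01.
have /andP[m0 m1] := m01; have /andP[a0 a1] := a01.
(* Halved because |q - l|^2 = s^2 + 2 a rho v with a rho <= 1, see [lE]. *)
exists (k / 2); first by rewrite divr_gt0.
move=> z zP za Hz; set y := z.1 - P in za *.
have qE : z.1 = y - (1 - m) *: e by rewrite /y /P scaleNr opprK addrK.
have y0 : y != 0 by rewrite subr_eq0.
clearbody y; set rho := enorm y.
have rho0 : 0 < rho by rewrite enorm_gt0.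
have rho2 : rho ^+ 2 = dot y y by rewrite enormX2.
pose x := dot y e / rho.
have xE : dot y e = rho * x by rewrite /x mulrC mulfVK // gt_eqF.
have e1 : enorm e = 1 by rewrite /enorm ee sqrtr1.
have x1 : x <= 1.
  rewrite /x ler_pdivrMr // mul1r (le_trans (dot_le_enorm _ _)) //.
  by rewrite e1 mulr1.
have x1' : -1 <= x.
  rewrite /x ler_pdivlMr // mulN1r lerNl -dotNl (le_trans (dot_le_enorm _ _)) //.
  by rewrite e1 mulr1 /enorm dotNl dotNr opprK.
have yP' : z.1 - P' = y - e.
  by rewrite qE /P'; apply/rowP => i; rewrite !mxE; ring.
set r := enorm (z.1 - P').
have r2 : r ^+ 2 = (1 - rho) ^+ 2 + 2 * rho * (1 - x).
  rewrite /r enormX2 yP' !(dotBl, dotBr) ee (dotC e y) xE -rho2; ring.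
have v02 : 0 <= 1 - x <= 2 by apply/andP; split; lra.
have rho1 : rho < 1 := le_lt_trans za a1.
have r0 : 0 < r.
  rewrite lt_neqAle enorm_ge0 andbT eq_sym -sqrf_eq0 r2 gt_eqF //.
  rewrite ltr_pwDl //; first by rewrite exprn_gt0 // subr_gt0.
  by rewrite !mulr_ge0 ?(ltW rho0) //; case/andP: v02.
have rhoa : 0 < rho <= a by rewrite rho0.
have br := kP _ _ _ rhoa v02 r0 r2.
set s := a - rho in br; have s0 : 0 <= s by rewrite subr_ge0.
pose U := - (m / rho) - (1 - m) / r - 2^-1 * (rho ^+ 2 - 2 * (1 - m) * rho * x + (1 - m) ^+ 2).
pose U' := m / rho ^+ 2 + (1 - m) * ((rho - x) / r ^+ 3 + x) - rho.
pose Ul := - (m / a) - (1 - m) / (1 - a) - 2^-1 * (a ^+ 2 - 2 * (1 - m) * a + (1 - m) ^+ 2).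
have brE : m * s ^+ 2 / (a * rho ^+ 2) +
    (1 - m) * ((1 - a)^-1 - a * (1 - x) - r^-1 - s * (1 - rho - (1 - x)) / r ^+ 3) =
    U + s * U' - s ^+ 2 / 2 - Ul.
  by rewrite /U /U' /Ul /s; field; rewrite !gt_eqF // subr_gt0.
rewrite brE in br.
set t := enorm (gradp z).
have t0 : 0 <= t by exact: enorm_ge0.
have HU : Ham2 m P (1 - m) P' z = U + t ^+ 2 / 2.
  rewrite Ham2_U2 /U2 -[z.1 + _](_ : y = _); last by rewrite qE subrK.
  rewrite -/P' -/rho -/r /U /t enormX2 [z.1]qE !(dotBl, dotBr, dotZl, dotZr) ee (dotC e y) xE -rho2.
  by move: (m / rho) ((1 - m) / r) => *; field.
have UlE : U2 m e l = Ul.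
  rewrite /U2 /l.
  have -> : (a - (1 - m)) *: e + (1 - m) *: e = a *: e by rewrite -scalerDl subrK.
  have -> : (a - (1 - m)) *: e - m *: e = - (1 - a) *: e.
    by rewrite -scalerBl; congr (_ *: _); ring.
  rewrite !enormZ e1 normrN !gtr0_norm ?subr_gt0 // !mulr1 dotZl dotZr ee mulr1.
  by rewrite /Ul; move: (m / a) ((1 - m) / (1 - a)) => *; field.
have lE : dot (z.1 - l) (z.1 - l) = s ^+ 2 + 2 * a * rho * (1 - x).
  have -> : z.1 - l = y - a *: e.
    by rewrite qE /l; apply/rowP => i; rewrite !mxE; ring.
  rewrite !(dotBl, dotBr, dotZl, dotZr) ee (dotC e y) xE -rho2 /s; ring.
have gE : dot y (gradq m P (1 - m) P' z) = rho * U' +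
    (gradp z 0 0 * y 0 1 - gradp z 0 1 * y 0 0).
  rewrite /gradq -/P' -[z.1 - P](_ : y = _); last by rewrite qE /P scaleNr opprK subrK.
  rewrite -/rho -/r yP' !(dotDr, dotZr, dotNr) -rho2 xE (dot2E y (vec2 _ _)) vec20 vec21.
  have d : dot z.1 y = rho ^+ 2 - (1 - m) * (rho * x).
    by rewrite qE dotBl dotZl (dotC e y) xE rho2.
  rewrite /gradp ![(_ + vec2 _ _) 0 _]mxE vec20 vec21.
  rewrite dot2E in d.
  have -> : (z.2 0 0 + z.1 0 1) * y 0 1 - (z.2 0 1 + - z.1 0 0) * y 0 0 =
    z.2 0 0 * y 0 1 - z.2 0 1 * y 0 0 + (z.1 0 0 * y 0 0 + z.1 0 1 * y 0 1) by ring.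
  by rewrite d /U'; field; rewrite !gt_eqF.
have cs : - (t * rho) <= gradp z 0 0 * y 0 1 - gradp z 0 1 * y 0 0.
  rewrite lerNl; apply: le_of_sqr; first by rewrite mulr_ge0 // ltW.
  rewrite exprMn /t enormX2 rho2 !dot2E -subr_ge0.
  set u := gradp z 0 0; set w := gradp z 0 1.
  by rewrite (_ : _ - _ = (u * y 0 0 + w * y 0 1) ^+ 2) ?sqr_ge0 //; ring.
have sU : s ^+ 2 / 2 + t ^+ 2 / 2 < s * U'.
  move: Hz; rewrite HU UlE lE => Hz.
  have : a * rho * (1 - x) <= 1 - x.
    rewrite ler_piMl ?subr_ge0 //.
    by apply: mulr_ile1; exact: ltW.
  move=> h; have := ler_wpM2l (ltW k0) h.
  have -> : k * (a * rho * (1 - x)) = k / 2 * (2 * a * rho * (1 - x)) by field.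
  have : 0 <= k / 2 * s ^+ 2 by rewrite mulr_ge0 ?sqr_ge0 // divr_ge0 // ltW.
  move: Hz br; rewrite !mulrDr.
  have -> : k * s ^+ 2 = k / 2 * s ^+ 2 + k / 2 * s ^+ 2 by field.
  lra.
have ss := sqr_ge0 s; have tt := sqr_ge0 t.
have sp : 0 < s.
  rewrite lt_neqAle s0 andbT; apply: contraTneq sU => <-.
  by rewrite mul0r -leNgt expr0n /= mul0r add0r divr_ge0.
have Ut : t < U'.
  rewrite -(ltr_pM2l sp); apply: le_lt_trans sU.
  rewrite -subr_ge0 (_ : _ - _ = (s - t) ^+ 2 / 2) ?divr_ge0 ?sqr_ge0 //; by field.
split; last by rewrite -subr_gt0.
rewrite gE; apply: lt_le_trans (lerD (lexx _) cs).
by rewrite subr_gt0 mulrC ltr_pM2l.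
Qed.

End Radial.

(** * Hill's region *)

Section Connectedness.
Context {R : realType}.

(** The trace of [W] on [C] is both open and closed. This is how a component of Hill's region is
    confined. *)
Lemma connected_sub_open (X : topologicalType) (C W : set X) : connected C -> open W ->
  C `&` W !=set0 -> C `&` closure W `<=` W -> C `<=` W.
Proof.
move=> conC oW CW CclW; have E : C `&` W = C `&` closure W.
  apply/seteqP; split=> x [Cx Wx]; split => //; first exact: subset_closure.
  by apply: CclW; split.
have : C `&` W = C.
  apply: conC => //; first by exists W.
  by exists (closure W); [exact: closed_closure|].
by move=> <- x [].
Qed.

Lemma segment_component (V : normedModType R) (A : set V) (a b : V) :
  (forall t : R, 0 <= t <= 1 -> A (a + t *: (b - a))) -> connected_component A a b.
Proof.
move=> seg; pose g (t : R) := a + t *: (b - a).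
exists (g @` `[0, 1]%classic).
  split.
  - by exists 0; rewrite /g /= ?in_itv /= ?lexx ?ler01 // scale0r addr0.
  - by move=> _ [t /= t01 <-]; apply: seg; rewrite in_itv /= in t01.
  - apply: connected_continuous_connected; first exact: segment_connected.
    apply: continuous_subspaceT => t; apply: cvgD; first exact: cvg_cst.
    by apply: cvgZl; exact: cvg_id.
exists 1; rewrite /g /= ?in_itv /= ?lexx ?ler01 // scale1r.
by rewrite addrC subrK.
Qed.

Lemma ball_segment (V : normedModType R) (q a b : V) (r t : R) :
  ball q r a -> ball q r b -> 0 <= t <= 1 -> ball q r (a + t *: (b - a)).
Proof.
rewrite -!ball_normE /= => qa qb /andP[t0 t1].
have -> : q - (a + t *: (b - a)) = (1 - t) *: (q - a) + t *: (q - b).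
  rewrite scalerBl scale1r -addrA [- _ + _]addrC -scalerBr.
  have -> : q - b - (q - a) = a - b by rewrite opprB addrC addrA subrK.
  by rewrite opprD addrA -scalerN opprB.
apply: (le_lt_trans (ler_normD _ _)); rewrite !normrZ !ger0_norm ?subr_ge0 //.
have [m [ma mb mr]] : exists m, [/\ `|q - a| <= m, `|q - b| <= m & m < r].
  exists (Num.max `|q - a| `|q - b|).
  by rewrite !le_max !lexx orbT gt_max qa qb.
apply: le_lt_trans mr; have -> : m = (1 - t) * m + t * m by ring.
by apply: lerD; apply: ler_wpM2l; rewrite ?subr_ge0.
Qed.

Lemma is_derive_line (V : normedModType R) (U : V -> R) (a n : V) (s : R) L :
  has_grad U (a + s *: n) L -> is_derive s 1 (fun t : R => U (a + t *: n)) (L n).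
Proof.
move=> [dU DU]; pose g (t : R) := a + t *: n.
have dg : is_derive s 1 g n.
  have d1 : is_derive s 1 (fun t : R => t *: n) (1 *: n) by exact: is_derive_scalel.
  by apply: (is_derive_eq (is_deriveD (is_derive_cst a s 1) d1)); rewrite add0r scale1r.
have dgs : differentiable g s by apply/derivable1_diffP; case: dg.
have d : differentiable (U \o g) s by exact: differentiable_comp.
split; first exact/derivable1_diffP.
rewrite deriveE // diff_comp //= -DU [RHS]deriveE //; congr ('d U _ _).
by rewrite -deriveE //; case: dg.
Qed.

Lemma descend (V : normedModType R) (U : V -> R) (a n : V) (L : V -> V -> R) :
  (forall t : R, 0 <= t <= 1 -> has_grad U (a + t *: n) (L (a + t *: n)) /\
     L (a + t *: n) n < 0) ->
  forall t : R, 0 < t <= 1 -> U (a + t *: n) < U a.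
Proof.
move=> h t /andP[t0 t1]; pose f (s : R) := U (a + s *: n).
have df (s : R) : 0 <= s <= 1 -> is_derive s 1 f (L (a + s *: n) n).
  by move=> /h[hs _]; exact: is_derive_line.
have [s| |s sI E] := @MVT _ f (fun s => L (a + s *: n) n) 0 t t0.
- by rewrite in_itv /= => /andP[s0 st]; apply: df; rewrite ltW //= (le_trans (ltW st)).
- apply: derivable_within_continuous => s; rewrite in_itv /= => /andP[s0 st].
  by case: (df s); rewrite ?s0 ?(le_trans st).
have /andP[s0 st] : 0 < s < t by move: sI; rewrite in_itv.
have s01 : 0 <= s <= 1 by rewrite (ltW s0) (le_trans (ltW st)).
have [_ neg] := h _ s01.
rewrite -subr_lt0 -[U (a + t *: n)]/(f t).
have -> : U a = f 0 by rewrite /f /= scale0r addr0.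
by rewrite E subr0 pmulr_llt0.
Qed.

End Connectedness.

Section Hill.
Context {R : realType}.
Local Notation phase := (phase R).
Variables (mu c : R).

Definition gradU (q : 'rV[R]_2) : 'rV[R]_2 :=
  ((1 - mu) / enorm (q - earth mu) ^+ 3) *: (q - earth mu)
  + (mu / enorm (q - moon mu) ^+ 3) *: (q - moon mu) - q.

Lemma vgrad_id n (q : 'rV[R]_n) : vgrad (V := 'rV[R]_n) id q id.
Proof.
move=> i; apply: (has_grad_lin (V := 'rV[R]_n) (l := fun x => x 0 i)).
  by move=> k x y; rewrite !mxE.
by move=> x; exact: coord_continuous.
Qed.

Lemma has_grad_inv_dist (P q : 'rV[R]_2) : q != P ->
  has_grad (fun x => (enorm (x - P))^-1) q (fun v => - dot (q - P) v / enorm (q - P) ^+ 3).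
Proof.
rewrite -subr_eq0 => qP; have e0 : enorm (q - P) != 0 by rewrite enorm_eq0.
have gP := has_grad_enorm (vgradB (vgrad_id q) (vgrad_cst P q)) qP.
by apply: (has_grad_eq (has_gradV gP e0)) => v; rewrite subr0; field.
Qed.

Lemma has_grad_Upot (q : 'rV[R]_2) : q != earth mu -> q != moon mu ->
  has_grad (Upot mu) q (fun v => dot (gradU q) v).
Proof.
move=> qE qM; have gq := vgrad_id q.
have gE := has_grad_inv_dist qE; have gM := has_grad_inv_dist qM.
have h := has_gradB (has_gradB
  (has_gradN (has_gradM (has_grad_cst (1 - mu) q) gE))
  (has_gradM (has_grad_cst mu q) gM))
  (has_gradM (has_grad_cst 2^-1 q) (has_grad_dot gq gq)).
have -> : Upot mu = fun x => - ((1 - mu) * (enorm (x - earth mu))^-1)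
    - mu * (enorm (x - moon mu))^-1 - 2^-1 * dot x x.
  by apply/funext => x; rewrite /Upot enormX2.
apply: (has_grad_eq h) => v; rewrite /gradU !(dotBl, dotDl, dotZl).
by field; rewrite !enorm_eq0 !subr_eq0 qE qM.
Qed.

Lemma cont_gradU (q n : 'rV[R]_2) : q != earth mu -> q != moon mu ->
  {for q, continuous (fun x => dot (gradU x) n)}.
Proof.
move=> qE qM; have gq := vgrad_id q; have gn := vgrad_cst n q.
have gE' := vgradB gq (vgrad_cst (earth mu) q).
have gM' := vgradB gq (vgrad_cst (moon mu) q).
have gE := has_grad_inv_dist qE; have gM := has_grad_inv_dist qM.
have h := has_gradB (has_gradD
  (has_gradM (has_gradM (has_gradM (has_gradM (has_grad_cst (1 - mu) q) gE) gE) gE) (has_grad_dot gE' gn))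
  (has_gradM (has_gradM (has_gradM (has_gradM (has_grad_cst mu q) gM) gM) gM) (has_grad_dot gM' gn)))
  (has_grad_dot gq gn).
have E (x : 'rV[R]_2) : dot (gradU x) n =
    (1 - mu) * (enorm (x - earth mu))^-1 * (enorm (x - earth mu))^-1
      * (enorm (x - earth mu))^-1 * dot (x - earth mu) n
    + mu * (enorm (x - moon mu))^-1 * (enorm (x - moon mu))^-1
      * (enorm (x - moon mu))^-1 * dot (x - moon mu) n - dot x n.
  rewrite /gradU !(dotDl, dotNl, dotZl) !exprS expr0 !mulr1 !invfM; ring.
by rewrite (funext E : (fun x => dot (gradU x) n) = _); exact: has_grad_cont h.
Qed.

Lemma rV2P (u v : 'rV[R]_2) : u 0 0 = v 0 0 -> u 0 1 = v 0 1 -> u = v.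
Proof.
move=> h0 h1; apply/rowP => -[[|[|//]] i2]; [move: h0|move: h1];
  by congr (u _ _ = v _ _); exact/val_inj.
Qed.

(** The point over q with zero velocity. It carries statements about the energy level over to U at
    the boundary of Hill's region. *)
Lemma rest_point (q : 'rV[R]_2) : q != earth mu -> q != moon mu ->
  let z : phase := (q, vec2 (- q 0 1) (q 0 0)) in
  [/\ Ham mu z = Upot mu q, gradp z = 0 &
      gradq (1 - mu) (earth mu) mu (moon mu) z = gradU q].
Proof.
move=> qE qM z; have g0 : gradp z = 0.
  by apply: rV2P; rewrite /gradp mxE /= ?vec20 ?vec21 mxE ?addNr ?subrr.
split => //; first by rewrite Ham_Upot g0 !mxE expr0n addr0 mulr0 add0r.
rewrite /gradq /gradU /=; congr (_ + _).
by apply: rV2P; rewrite ?vec20 ?vec21 mxE.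
Qed.

Lemma HillE (q : 'rV[R]_2) :
  Hill mu c q <-> [/\ q != earth mu, q != moon mu & Upot mu q <= c].
Proof.
split=> [[z [zE zM Hz] <-]|[qE qM Uq]].
  split => //; rewrite -Hz Ham_Upot lerDr.
  by rewrite mulr_ge0 ?addr_ge0 ?sqr_ge0.
exists (q, vec2 (Num.sqrt (2 * (c - Upot mu q)) - q 0 1) (q 0 0)) => //.
split => //; rewrite Ham_Upot /gradp ![(_ + vec2 _ _) 0 _]mxE /= !vec20 !vec21.
rewrite subrK subrr expr0n addr0 sqr_sqrtr; last by rewrite mulr_ge0 // subr_ge0.
by rewrite mulrA mulVf // mul1r subrK.
Qed.

Lemma near_regular (q : 'rV[R]_2) (P : 'rV[R]_2) : q != P -> \forall x \near q, x != P.
Proof.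
rewrite -subr_eq0 => /(near_neq0 (vgradB (vgrad_id q) (vgrad_cst P q))).
by apply: filterS => x; rewrite subr_eq0.
Qed.

(* At a boundary point q one goes down along n, across, and up again along - n. *)
Lemma hill_local (q : 'rV[R]_2) : Hill mu c q ->
  (Upot mu q < c) \/ gradU q != 0 ->
  \forall q' \near q, Hill mu c q' -> connected_component (Hill mu c) q q'.
Proof.
move=> /HillE[qE qM Uq] H.
have contU x : x != earth mu -> x != moon mu -> {for x, continuous (Upot mu)}.
  by move=> xE xM; exact: has_grad_cont (has_grad_Upot xE xM).
have nearU x : x != earth mu -> x != moon mu -> Upot mu x < c ->
    exists2 r : R, 0 < r & forall x', ball x r x' -> Hill mu c x'.
  move=> xE xM Ux.
  have h1 : \forall x' \near x, Upot mu x' < c by exact: (cvgr_lt _ (contU _ xE xM)).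
  have h2 : \forall x' \near x, [/\ Upot mu x' < c, x' != earth mu & x' != moon mu].
    near=> x'; split; near: x'; [exact: h1|exact: near_regular|exact: near_regular].
  have /nbhs_ballP[r /= r0 rP] := h2.
  by exists r => // x' /rP[/ltW U1 U2 U3]; apply/HillE.
have [Uq'|Uq'] := ltP (Upot mu q) c.
  have [r r0 rP] := nearU _ qE qM Uq'.
  apply: (filterS _ (nbhsx_ballx q r r0)) => q' qq' _; apply: segment_component => t t01.
  by apply: rP; apply: ball_segment => //; exact: ballxx.
have {}Uq' : Upot mu q = c by apply/eqP; rewrite eq_le Uq.
have g0 : gradU q != 0 by case: H => //; rewrite Uq' ltxx.
pose n := - gradU q.
have n0 : dot (gradU q) n < 0.
  by rewrite dotNr oppr_lt0 lt_neqAle eq_sym dot_eq0 g0 dot_ge0.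
have h1 : \forall x \near q, dot (gradU x) n < 0.
  have cg : dot (gradU x) n @[x --> q] --> dot (gradU q) n by exact: cont_gradU.
  have hh := cvgr_lt _ cg _ n0. exact: hh.
have h2 : \forall x \near q, [/\ dot (gradU x) n < 0, x != earth mu & x != moon mu].
  near=> x; split; near: x; [exact: h1|exact: near_regular|exact: near_regular].
have /nbhs_ballP[r /= r0 rP] := h2.
pose k := r / 2 / (`|n| + 1).
have n1 : 0 < `|n| + 1 by rewrite ltr_wpDl.
have k0 : 0 < k by rewrite !divr_gt0.
pose n' := k *: n.
have n'r : `|n'| < r / 2.
  by rewrite normrZ gtr0_norm // /k mulrAC ltr_pdivrMr // ltr_pM2l ?divr_gt0 // ltrDl.
have down x : ball q (r / 2) x -> forall t : R, 0 <= t <= 1 ->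
    [/\ ball q r (x + t *: n'), x + t *: n' != earth mu, x + t *: n' != moon mu
      & Upot mu (x + t *: n') <= Upot mu x].
  move=> qx; have inb t : 0 <= t <= 1 -> ball q r (x + t *: n').
    move=> /andP[t0 t1]; move: qx; rewrite -!ball_normE /= opprD addrA => qx.
    rewrite (le_lt_trans (ler_normB _ _)) // normrZ ger0_norm //.
    have : t * `|n'| <= `|n'| by rewrite ler_piMl.
    lra.
  move=> t t01; have [_ xE xM] := rP _ (inb _ t01); split => //; first exact: inb.
  have [->|t0] := eqVneq t 0; first by rewrite scale0r addr0.
  apply/ltW; apply: (@descend _ _ _ _ n' (fun y v => dot (gradU y) v)); last first.
    by case/andP: t01 => t0' ->; rewrite andbT lt_neqAle eq_sym t0.
  move=> s s01; have [h sE sM] := rP _ (inb _ s01).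
  split; first exact: has_grad_Upot.
  by rewrite dotZr pmulr_rlt0.
have qq : ball q (r / 2) q by apply: ballxx; rewrite divr_gt0.
have downH x : ball q (r / 2) x -> Hill mu c x -> connected_component (Hill mu c) x (x + n').
  move=> qx /HillE[_ _ Ux]; apply: segment_component => t t01.
  rewrite [x + n' - x]addrC addKr; have [_ tE tM tU] := down _ qx _ t01.
  by apply/HillE; split => //; exact: le_trans tU Ux.
have one : 0 <= (1 : R) <= 1 by rewrite ler01 lexx.
have U1 : Upot mu (q + n') < c.
  rewrite -Uq' -[n']scale1r; apply: (@descend _ _ _ _ n' (fun y v => dot (gradU y) v)).
    move=> s s01; have [sb _ _ _] := down _ qq _ s01; have [h sE sM] := rP _ sb.
    split; first exact: has_grad_Upot.
    by rewrite dotZr pmulr_rlt0.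
  by rewrite ltr01 lexx.
have [_ q1E q1M _] := down _ qq _ one; rewrite scale1r in q1E q1M.
have [r2 r20 r2P] := nearU _ q1E q1M U1.
have m0 : 0 < Num.min (r / 2) r2 by rewrite lt_min r20 divr_gt0.
apply: (filterS _ (nbhsx_ballx q _ m0)) => q' qq' Hq'.
have b1 : ball q (r / 2) q' by apply: le_ball qq'; rewrite ge_min lexx.
have b2 : ball q r2 q' by apply: le_ball qq'; rewrite ge_min lexx orbT.
have Hq : Hill mu c q by apply/HillE; rewrite Uq'.
apply: connected_component_trans (downH _ qq Hq) _.
apply: connected_component_trans; last exact/connected_component_sym/downH.
apply: segment_component => t t01; apply: r2P; apply: ball_segment => //; first exact: ballxx.
by move: b2; rewrite -!ball_normE /= opprD addrACA subrr addr0.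
Unshelve. all: by end_near. Qed.

End Hill.

Section PuncturedDisc.
Context {R : realType}.

Lemma enormD n (u v : 'rV[R]_n) : enorm (u + v) <= enorm u + enorm v.
Proof.
apply: le_of_sqr; first by rewrite addr_ge0 ?enorm_ge0.
rewrite enormX2 !(dotDl, dotDr) (dotC v u) sqrrD !enormX2.
by have := dot_le_enorm u v; rewrite -mulr_natl; lra.
Qed.

Lemma enorm_segment (u v : 'rV[R]_2) (r t : R) : enorm u < r -> enorm v < r ->
  0 <= t <= 1 -> enorm (u + t *: (v - u)) < r.
Proof.
move=> ur vr /andP[t0 t1].
have -> : u + t *: (v - u) = (1 - t) *: u + t *: v.
  by apply/rowP => i; rewrite !mxE; ring.
apply: le_lt_trans (enormD _ _) _; rewrite !enormZ !ger0_norm ?subr_ge0 //.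
have [m [ma mb mr]] : exists m, [/\ enorm u <= m, enorm v <= m & m < r].
  exists (Num.max (enorm u) (enorm v)).
  by rewrite !le_max !lexx orbT gt_max ur vr.
apply: le_lt_trans mr; have -> : m = (1 - t) * m + t * m by ring.
by apply: lerD; apply: ler_wpM2l; rewrite ?subr_ge0.
Qed.

(** If the segment meets the origin, then a and b are collinear with it, and a detour through the
    rotation of a by a right angle avoids it. *)
Lemma segment_avoid (a b : 'rV[R]_2) : a != 0 -> b != 0 ->
  (forall t : R, 0 <= t <= 1 -> a + t *: (b - a) != 0) \/
  exists J : 'rV[R]_2, [/\ enorm J = enorm a, J != 0,
    forall t : R, 0 <= t <= 1 -> a + t *: (J - a) != 0 &
    forall t : R, 0 <= t <= 1 -> J + t *: (b - J) != 0].
Proof.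
move=> a0 b0; have aa : dot a a != 0 by rewrite dot_eq0.
have [[t0 ht0]|nohit] := pselect (exists t : R, a + t *: (b - a) = 0); last first.
  by left => t _; apply/eqP => h; apply: nohit; exists t.
pose J : 'rV[R]_2 := vec2 (- a 0 1) (a 0 0).
have aJ : dot a J = 0 by rewrite dot2E vec20 vec21; ring.
have JJ : dot J J = dot a a by rewrite !dot2E !vec20 !vec21; ring.
have J0 : J != 0 by rewrite -dot_eq0 JJ.
have tone t : dot a a + t * (- dot a a) = 0 -> t = 1.
  move=> /eqP; rewrite mulrN -{1}[dot _ _]mul1r -mulrBl mulf_eq0 (negPf aa) orbF.
  by rewrite subr_eq0 => /eqP.
have Jb : dot J b = 0.
  have := congr1 (dot J) ht0; rewrite dot0r dotDr dotZr dotBr (dotC J a) aJ.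
  rewrite subr0 add0r => /eqP; rewrite mulf_eq0 => /orP[/eqP t00|/eqP //].
  by move: ht0; rewrite t00 scale0r addr0 => /eqP; rewrite (negPf a0).
right; exists J; split; rewrite ?/enorm ?JJ // => t _; apply/eqP => h.
  have := congr1 (dot a) h; rewrite dot0r dotDr dotZr dotBr aJ sub0r => /tone t1.
  by move: h; rewrite t1 scale1r addrC subrK => /eqP; rewrite (negPf J0).
have := congr1 (dot J) h; rewrite dot0r dotDr dotZr dotBr Jb sub0r JJ => /tone t1.
by move: h; rewrite t1 scale1r addrC subrK => /eqP; rewrite (negPf b0).
Qed.

Lemma punctured_disc (A : set 'rV[R]_2) (P a b : 'rV[R]_2) (r : R) :
  (forall q, 0 < enorm (q - P) < r -> A q) ->
  0 < enorm (a - P) < r -> 0 < enorm (b - P) < r -> connected_component A a b.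
Proof.
move=> AP; have seg u v : 0 < enorm (u - P) < r -> 0 < enorm (v - P) < r ->
    (forall t : R, 0 <= t <= 1 -> (u - P) + t *: ((v - P) - (u - P)) != 0) ->
    connected_component A u v.
  move=> /andP[u0 ur] /andP[v0 vr] nz; apply: segment_component => t t01.
  have E : u + t *: (v - u) - P = (u - P) + t *: ((v - P) - (u - P)).
    by apply/rowP => i; rewrite !mxE; ring.
  by apply: AP; rewrite E enorm_gt0 nz //= enorm_segment.
move=> ar br.
have a0 : a - P != 0 by rewrite -enorm_gt0; case/andP: ar.
have b0 : b - P != 0 by rewrite -enorm_gt0; case/andP: br.
have [h|[J [Ja J0 h1 h2]]] := segment_avoid a0 b0; first exact: seg.
have JE : P + J - P = J by rewrite addrC addKr.
have cJ : 0 < enorm ((P + J) - P) < r by rewrite JE Ja.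
by apply: (@connected_component_trans _ A (P + J)); apply: seg => //; rewrite JE.
Qed.

End PuncturedDisc.

Section Primary.
Context {R : realType}.
Local Notation phase := (phase R).
Local Notation amb := (amb R).
Variables (mu : R).
Hypothesis mu01 : 0 < mu < 1.

(* P is one of the primaries, P' the other one, m the mass of P, and e the
   unit vector pointing from P to P'. *)
Definition primary (m : R) (e P P' : 'rV[R]_2) :=
  [/\ m = 1 - mu, e = vec2 (-1) 0, P = earth mu & P' = moon mu] \/
  [/\ m = mu, e = vec2 1 0, P = moon mu & P' = earth mu].

Lemma primary_earth : primary (1 - mu) (vec2 (-1) 0) (earth mu) (moon mu).
Proof. by left. Qed.

Lemma primary_moon : primary mu (vec2 1 0) (moon mu) (earth mu).
Proof. by right. Qed.

Section OnePrimary.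
Variables (m : R) (e P P' : 'rV[R]_2).
Hypothesis pr : primary m e P P'.

Lemma primary_mass : 0 < m < 1.
Proof. by case: pr => -[-> _ _ _] //; case/andP: mu01 => h1 h2; apply/andP; split; lra. Qed.

Lemma primary_unit : dot e e = 1.
Proof. by case: pr => -[_ -> _ _]; rewrite dot2E vec20 vec21; ring. Qed.

Lemma primaryE : P = - (1 - m) *: e /\ P' = m *: e.
Proof.
by case: pr => -[-> -> -> ->]; split; apply: rV2P; rewrite /earth /moon [RHS]mxE ?vec20 ?vec21; ring.
Qed.

Lemma primary_Ham : Ham mu = Ham2 m P (1 - m) P'.
Proof.
case: pr => -[-> _ -> ->]; first by rewrite Ham_earth; congr Ham2; ring.
exact: Ham_moon.
Qed.

Lemma primary_Upot q : Upot mu q = U2 m e q.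
Proof.
rewrite /U2 /Upot enormX2; have [E1 E2] := primaryE.
rewrite -E2 (_ : q + (1 - m) *: e = q - P); last by rewrite E1 scaleNr opprK.
case: pr => -[-> _ -> ->] //; first by congr (_ - _ / _ - _); ring.
ring.
Qed.

Lemma primary_regular q : ((q != earth mu) && (q != moon mu)) = ((q != P) && (q != P')).
Proof. by case: pr => -[_ _ -> ->] //; rewrite andbC. Qed.

Lemma primary_dist : enorm (P - P') = 1.
Proof.
have [-> ->] := primaryE.
rewrite -scalerBl enormZ /enorm primary_unit sqrtr1 mulr1.
by rewrite (_ : _ - _ = -1) ?normrN1 //; ring.
Qed.

Lemma SigmaE c z : Sigma mu c z <-> [/\ z.1 != P, z.1 != P' & Ham2 m P (1 - m) P' z = c].
Proof.
rewrite /Sigma /= primary_Ham; split=> -[h1 h2 h3].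
  by have := primary_regular z.1; rewrite h1 h2 => /esym /andP[].
by have := primary_regular z.1; rewrite h1 h2 => /andP[].
Qed.

(** U tends to minus infinity at P. The radius m / (|c| + 1) makes m / |q - P| at least |c|, and 1/3
    keeps q away from the other primary, at distance 1. *)
Lemma hill_near_primary c : exists2 r : R, 0 < r < 2^-1 &
  forall q, 0 < enorm (q - P) < r -> Hill mu c q.
Proof.
have /andP[m0 m1] := primary_mass.
pose r := Num.min (3^-1) (m / (`|c| + 1)).
have c1 : 0 < `|c| + 1 by rewrite ltr_wpDl.
exists r; first by rewrite lt_min invr_gt0 ltr0n divr_gt0 //= gt_min ltf_pV2 ?posrE //= ltr_nat.
move=> q /andP[q0]; rewrite lt_min => /andP[q3 qc].
have qP : q != P by rewrite -subr_eq0 -enorm_gt0.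
have qP' : q != P'.
  apply: contraTneq q3 => ->; rewrite -leNgt.
  rewrite (_ : P' - P = - (P - P')); last by rewrite opprB.
  rewrite -scaleN1r enormZ normrN1 mul1r primary_dist.
  by rewrite invf_le1 ?ler1n // ltr0n.
apply/HillE; have := primary_regular q; rewrite qP qP' => /andP[-> ->]; split => //.
rewrite primary_Upot /U2.
have [E1 E2] := primaryE.
rewrite -E2 (_ : q + (1 - m) *: e = q - P); last by rewrite E1 scaleNr opprK.
have h1 : 0 <= (1 - m) / enorm (q - P') by rewrite divr_ge0 ?enorm_ge0 // subr_ge0 ltW.
have h2 := dot_ge0 q.
suff : `|c| <= m / enorm (q - P) by have := ler_norm (- c); rewrite normrN; lra.
rewrite ler_pdivlMr //; move: qc; rewrite ltr_pdivlMr //.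
by have := normr_ge0 c; nra.
Qed.

Lemma Hill_part_component c Ps q q' : Hill_part mu c Ps q ->
  connected_component (Hill mu c) q q' -> Hill_part mu c Ps q'.
Proof.
move=> [Hq bd cl] qq'; have E := same_connected_component qq'.
split; rewrite -?E //; exact: (connected_component_sub qq').
Qed.

Lemma Sigma_part_open c Ps (z : phase) : Sigma_part mu c Ps z ->
  Upot mu z.1 < c \/ gradU mu z.1 != 0 ->
  \forall x \near z, Sigma mu c x -> Sigma_part mu c Ps x.
Proof.
move=> [Sz Hz] ug; have HH : Hill mu c z.1 by exists z.
have := hill_local HH ug => /(cvg_fst (F := nbhs z.1) (G := nbhs z.2)).
move=> h; have : \forall x \near z, Hill mu c x.1 -> connected_component (Hill mu c) z.1 x.1.
  by case: z {Sz Hz HH ug} h.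
apply: filterS => x hx Sx; split => //.
by apply: Hill_part_component Hz _; apply: hx; exists x.
Qed.

(** The formula y = eta (1 - xi_0) + xi eta_0 of the regularization, on the whole ambient space: it
    is continuous and vanishes over the north pole, so that nearby points of the image have q close
    to P. *)
Definition fibre (w : amb) : 'rV[R]_2 :=
  (1 - w.1 0 (lshift 2 0)) *: rsubmx w.2 + w.2 0 (lshift 2 0) *: rsubmx w.1.

Lemma fibre_Moser z : fibre (Moser P z) = z.1 - P.
Proof.
rewrite /fibre; apply/rowP => k; rewrite (Moser_fibre P z k) !mxE.
by rewrite mulrC [X in _ + X]mulrC.
Qed.

(** Provides the hypothesis [Tnear] of [volume_form_reg]. Some point of [T] has its image near w,
    hence its q within r of P, and all of the punctured disc lies in the component of that q. *)
Lemma closure_north c Ps (T : set phase) w : T `<=` Sigma_part mu c Ps ->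
  closure (Moser P @` T) w -> w.1 = north ->
  exists2 r, 0 < r & forall z, z.1 != P -> z.1 != P' -> Ham2 m P (1 - m) P' z = c ->
    enorm (z.1 - P) < r -> Sigma_part mu c Ps z.
Proof.
move=> TS clw wN; have [r /andP[r0 r1] rP] := hill_near_primary c; exists r => //.
have g1 := vgrad_fst w; have g2 := vgrad_snd w.
have gF := vgradD
  (vgradZ (has_gradB (has_grad_cst 1 w) (g1 (lshift 2 0))) (vgrad_rsubmx g2))
  (vgradZ (g2 (lshift 2 0)) (vgrad_rsubmx g1)).
have fw : fibre w = 0.
  by rewrite /fibre wN /north row_mxEl mxE subrr scale0r row_mxKr scaler0 add0r.
have r20 : 0 < r ^+ 2 - dot (fibre w) (fibre w) by rewrite fw dot0l subr0 exprn_gt0.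
have nr : \forall x \near w, 0 < r ^+ 2 - dot (fibre x) (fibre x).
  apply: (has_grad_cont_near (f := fun x => r ^+ 2 - dot (fibre x) (fibre x))) r20.
  exact: has_grad_cont (has_gradB (has_grad_cst _ w) (has_grad_dot gF gF)).
have [_ [[z Tz <-] /=]] := clw _ nr; rewrite fibre_Moser -enormX2 subr_gt0 => zr z' z'P z'P' Hz' z'r.
have [Sz Hz] := TS _ Tz; have [zP zP' Hamz] := (SigmaE c z).1 Sz.
split; first by apply/SigmaE.
apply: Hill_part_component Hz _; apply: (punctured_disc rP).
  rewrite enorm_gt0 subr_eq0 zP /=; apply: lt_of_sqr => //; exact: ltW.
by rewrite enorm_gt0 subr_eq0 z'P.
Qed.

End OnePrimary.
End Primary.

(** * Energies below the critical value *)

Section CanonicalForm.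
Context {R : realType}.
Local Notation amb := (amb R).

Lemma has_ext_d_can_form (S : set amb) : has_ext_d S can_form can_omega.
Proof.
move=> w Sw; exists setT, can_form; split => //; first exact: openT.
split=> [z _|v].
  by move=> k x y; rewrite /can_form /= dotDr dotZr.
apply: smooth_smooth_on; apply: smooth_lin.
  by move=> k x y; rewrite /can_form /= dotDl dotZl.
move=> x; exact: has_grad_cont (has_grad_dot (vgrad_snd x) (vgrad_cst v.1 x)).
Qed.

End CanonicalForm.

Section Below.
Context {R : realType}.
Local Notation phase := (phase R).
Local Notation amb := (amb R).

(** The inverse of [Moser P], off the north pole. *)
Definition mchart (P : 'rV[R]_2) (w : amb) : phase :=
  let z := chart (flip w.1, flip w.2) in (z.1 + P, z.2).

Lemma flipK : involutive (@flip R).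
Proof. by move=> u; rewrite /flip row_mxKl row_mxKr opprK hsubmxK. Qed.

Lemma flip_pole (u : 'rV[R]_(1 + 2)) : flip u 0 (lshift 2 0) = - u 0 (lshift 2 0).
Proof. by rewrite row_mxEl !mxE. Qed.

Lemma Moser_mchart P w : cotS2 w -> w.1 0 (lshift 2 0) != 1 -> Moser P (mchart P w) = w.
Proof.
move=> [c1 c2] w1; pose w' : amb := (flip w.1, flip w.2).
have cw : cotS2 w' by split; rewrite /= dot_flip.
have n1 : w'.1 0 (lshift 2 0) != -1 by rewrite /= flip_pole eqr_opp.
have := Psi_chart cw n1; rewrite /Psi /w' => -[/(inv_inj flipK) h1 /(inv_inj flipK) h2].
rewrite (surjective_pairing w) -{2}h1 -{2}h2 -surjective_pairing.
by rewrite /Moser /mchart /= addrK subr0.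
Qed.

Lemma mchart_Moser P z : mchart P (Moser P z) = z.
Proof.
have E : Moser P z = Moser 0 (z.1 - P, z.2) by rewrite /Moser /= subr0.
by rewrite /mchart E -[(flip _, flip _)]/(Psi _) chartK /= subrK -surjective_pairing.
Qed.

Lemma north_pole (w : amb) : cotS2 w -> w.1 0 (lshift 2 0) = 1 -> w.1 = north.
Proof.
move=> [c1 _]; move: c1; rewrite -(hsubmxK w.1) row_mxEl /north.
move: (lsubmx w.1) (rsubmx w.1) => A x; rewrite dot_row_mx => c1 A1.
have AE : A = const_mx 1 by apply/rowP => i; rewrite ord1 mxE.
rewrite AE; congr row_mx; apply/eqP; rewrite -dot_eq0; apply/eqP.
by apply: (addrI 1); rewrite addr0 -[RHS]c1 AE dot_const mulr1.
Qed.

Lemma cont_mchart P (w : amb) : w.1 0 (lshift 2 0) != 1 -> {for w, continuous (mchart P)}.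
Proof.
move=> w1; have h : 1 + flip w.1 0 (lshift 2 0) != 0.
  by rewrite flip_pole subr_eq0 eq_sym.
have g1 := vgrad_flip (vgrad_fst w); have g2 := vgrad_flip (vgrad_snd w).
have ga := has_gradD (has_grad_cst 1 w) (g1 (lshift 2 0)).
have [d _] := derive_vpair
  (vgradD (vgradB (vgradZ ga (vgrad_rsubmx g2)) (vgradZ (g2 (lshift 2 0)) (vgrad_rsubmx g1)))
     (vgrad_cst P w))
  (vgradZ (has_gradN (has_gradV ga h)) (vgrad_rsubmx g1)).
exact: differentiable_continuous d.
Qed.

Lemma closure_image (V W : normedModType R) (f : V -> W) (A : set V) (B : set W) w :
  {for w, continuous f} -> closure A w -> (forall x, A x -> B (f x)) -> closure B (f w).
Proof.
move=> cf clA AB N nN; have [x [Ax Nx]] := clA _ (cf _ nN).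
by exists (f x); split => //; exact: AB.
Qed.

Variables (mu c m a : R) (e P P' : 'rV[R]_2).
Hypotheses (mu01 : 0 < mu < 1) (pr : primary mu m e P P') (a01 : 0 < a < 1).
Hypothesis c_lt : c < U2 m e ((a - (1 - m)) *: e).

Let T := Sigma_part mu c [set P].

Lemma below_star (z : phase) : Sigma mu c z -> enorm (z.1 - P) <= a ->
  0 < dot (z.1 - P) (gradq m P (1 - m) P' z) /\ enorm (z.1 - P) < a.
Proof.
move=> /(SigmaE pr)[zP zP' Hz] za.
have [k k0] := star_shaped (primary_mass mu01 pr) a01 (primary_unit pr).
have [<- <-] := primaryE pr; apply => //.
by rewrite Hz (lt_le_trans c_lt) // lerDl mulr_ge0 ?dot_ge0 // ltW.
Qed.

(** If U(q) = c, the rest point over q lies on the level and has H_q = grad U, which the strict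
    inequality of [below_star] keeps from vanishing. *)
Lemma below_regular (q : 'rV[R]_2) : Hill mu c q -> enorm (q - P) <= a ->
  Upot mu q < c \/ gradU mu q != 0.
Proof.
move=> /HillE[qE qM]; rewrite le_eqVlt => /orP[/eqP Uq|]; last by left.
move=> qa; right; have [Hr g0 gE] := rest_point qE qM.
have [] := @below_star (q, vec2 (- q 0 1) (q 0 0)) _ qa; first by split => //; rewrite Hr.
move=> h _; apply: contraTneq h => g; rewrite -leNgt.
suff -> : gradq m P (1 - m) P' (q, vec2 (- q 0 1) (q 0 0)) = 0 by rewrite dot0r.
rewrite -[RHS]g -gE; case: pr => -[-> _ -> ->] /=; first by congr gradq; ring.
by rewrite /gradq [_ *: _ + _ *: _]addrC.
Qed.

Lemma cont_enorm_sub (x : 'rV[R]_2) : {for x, continuous (fun q : 'rV[R]_2 => enorm (q - P))}.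
Proof.
apply: (@continuous_comp _ _ _ (fun q : 'rV[R]_2 => q - P) (@enorm R 2)).
  have [d _] := vgrad_derive (vgradB (vgrad_id x) (vgrad_cst P x)).
  exact: differentiable_continuous d.
exact: enorm_cont.
Qed.

Lemma open_disc r : open [set q : 'rV[R]_2 | enorm (q - P) < r].
Proof.
rewrite openE => q /= qr; rewrite /interior.
have h := cont_enorm_sub (x := q).
exact: (cvgr_lt _ h).
Qed.

Lemma closure_disc r (q : 'rV[R]_2) : closure [set q : 'rV[R]_2 | enorm (q - P) < r] q -> enorm (q - P) <= r.
Proof.
move=> clq; rewrite leNgt; apply/negP => rq.
have h := cont_enorm_sub (x := q).
have n : \forall x \near q, r < enorm (x - P) by exact: (cvgr_gt _ h).
by have [x [/= h1 h2]] := clq _ n; have := lt_trans h1 h2; rewrite ltxx.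
Qed.

(** The component meets the open disc because P is in its closure, and by [below_star] it cannot
    meet the bounding circle. *)
Lemma below_inside (q : 'rV[R]_2) : Hill_part mu c [set P] q -> enorm (q - P) < a.
Proof.
move=> [Hq _ clP]; have /andP[a0 a1] := a01.
set C := connected_component _ _ in clP.
have CW : C `<=` [set q : 'rV[R]_2 | enorm (q - P) < a].
  apply: connected_sub_open; first exact: component_connected.
  - exact: open_disc.
  - have := clP P erefl; apply; apply: open_nbhs_nbhs; split; first exact: open_disc.
    by rewrite /= subrr /enorm dot0l sqrtr0.
  - move=> x [Cx /closure_disc xa].
    by have [z Sz zx] := connected_component_sub Cx; rewrite -zx in xa *; exact: (below_star Sz xa).2.
by apply: CW; exact: connected_component_refl.
Qed.

(** The closure adds nothing off the north pole. There [mchart] turns a limit of images into a limit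
    z of points of [T]; z is not over P', since |q - P| <= a < 1, it lies on the level, and
    [hill_local] puts it in the same component. *)
Lemma Sigma_bar_decomp : Sigma_bar mu c P = Moser P @` T `|`
  [set w | [/\ cotS2 w, closure (Moser P @` T) w & w.1 = north]].
Proof.
apply/seteqP; split=> [w [cw clw]|w [[z Tz <-]|[cw clw _]]]; last 2 first.
- by split; [exact: Moser_cotS2|apply: subset_closure; exists z].
- by split.
have [w1|w1] := eqVneq (w.1 0 (lshift 2 0)) 1.
  by right; split => //; exact: north_pole.
left; exists (mchart P w); last exact: Moser_mchart.
set z := mchart P w.
have clT : closure T z.
  apply: (closure_image (cont_mchart w1) clw) => x [z' Tz' <-].
  by rewrite mchart_Moser.
have za : enorm (z.1 - P) <= a.
  apply: closure_disc; apply: (closure_image (f := fst) _ clT); first exact: cvg_fst.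
  by move=> x [_ /below_inside].
have /andP[a0 a1] := a01.
have zP' : z.1 != P'.
  apply: contraTneq za => ->; rewrite -ltNge -opprB -scaleN1r enormZ normrN1 mul1r.
  by rewrite (primary_dist pr).
have /andP[m0 m1] := primary_mass mu01 pr.
have e0 : z.1 - P' != 0 by rewrite subr_eq0.
have e1 : enorm (z.1 - P') != 0 by rewrite enorm_eq0.
(* |q - P| (H - c), which extends continuously to q = P with the value - m; its vanishing at z
   excludes a collision. *)
pose k (x : phase) := enorm (x.1 - P) * (2^-1 * dot x.2 x.2 - (1 - m) * (enorm (x.1 - P'))^-1
  + (x.2 0 0 * x.1 0 1 - x.2 0 1 * x.1 0 0) - c) - m.
have kz : k z = 0.
  apply: (closure_cont_eq0 _ clT).
    have gp := vgrad_snd z; have gq := vgrad_fst z.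
    have c2 := has_grad_cont (has_gradB (has_gradD (has_gradB
      (has_gradM (has_grad_cst 2^-1 z) (has_grad_dot gp gp))
      (has_gradM (has_grad_cst (1 - m) z) (has_gradV (has_grad_enorm (vgradB gq (vgrad_cst P' z)) e0) e1)))
      (has_gradB (has_gradM (gp 0) (gq 1)) (has_gradM (gp 1) (gq 0)))) (has_grad_cst c z)).
    have c1 : {for z, continuous (fun x : phase => enorm (x.1 - P))}.
      apply: (@continuous_comp _ _ _ fst (fun q : 'rV[R]_2 => enorm (q - P))).
        exact: cvg_fst.
      exact: cont_enorm_sub.
    exact: (cvgB (cvgM c1 c2) (cvg_cst m)).
  near=> x => -[/(SigmaE pr)[xP xP' Hx] _].
  rewrite /k -Hx /Ham2; field.
  by rewrite !enorm_eq0 !subr_eq0 xP xP'.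
have zP : z.1 != P.
  apply: contra_eqN kz => /eqP zP.
  by rewrite /k zP subrr /enorm dot0l sqrtr0 mul0r sub0r oppr_eq0 gt_eqF.
have Sz : Sigma mu c z.
  apply/(SigmaE pr); split => //; apply/eqP; rewrite -subr_eq0.
  have eP : enorm (z.1 - P) != 0 by rewrite enorm_eq0 subr_eq0.
  rewrite -(mulrI_eq0 _ (lregP eP)) -[X in _ == X]kz; apply/eqP.
  by rewrite /k /Ham2; field; rewrite e1 eP.
split => //.
have Hq : Hill mu c z.1 by exists z.
have hl := hill_local Hq (below_regular Hq za).
have clq : closure (Hill_part mu c [set P]) z.1.
  apply: (closure_image (f := fst) _ clT); first exact: cvg_fst.
  by move=> x [].
have [q' [Hq' h]] := clq _ hl.
have [Hill' _ _] := Hq'.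
by apply: Hill_part_component Hq' _; apply: connected_component_sym; exact: h.
Unshelve. all: by end_near. Qed.

Lemma below_contact : contact_form (Sigma_bar mu c P) can_form /\
  compatible (Sigma_bar mu c P) can_omega can_form.
Proof.
split; last exact: has_ext_d_can_form.
exists can_omega; first exact: has_ext_d_can_form.
have /andP[m0 m1] := primary_mass mu01 pr.
rewrite Sigma_bar_decomp; apply: (@volume_form_reg _ m (1 - m) c P P' T) => //.
- have := primary_dist pr; apply: contra_eqN => /eqP ->.
  by rewrite subrr /enorm dot0l sqrtr0 eq_sym oner_eq0.
- by move=> z [Sz _]; exact/(SigmaE pr).
- move=> z Tz; have [Sz Hz] := Tz; have [Hq _ _] := Hz.
  have za := below_inside Hz.
  have op := Sigma_part_open Tz (below_regular Hq (ltW za)).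
  have [zP zP' _] := (SigmaE pr c z).1 Sz.
  have nP := near_fst_neq zP; have nP' := near_fst_neq zP'.
  near=> x => Hx.
  suff : Sigma mu c x -> T x.
    apply; apply/(SigmaE pr); split => //; by near: x.
  by near: x.
- by move=> z [Sz Hz]; rewrite gt_eqF // (below_star Sz (ltW (below_inside Hz))).1.
- by move=> w clw wN; exact: (closure_north mu01 pr (fun=> id) clw wN).
Unshelve. all: by end_near. Qed.

End Below.

(** * The neck *)

Section Neck.
Context {R : realType}.
Implicit Types A d K C kap sig eps eta j t x y p s : R.

(* Here and below x = q1 - l, y = q2, p = p1, s = p2 - l are the coordinates of
   the point minus L1, [Aq] stands for (1 - mu) / |q - E|^3 + mu / |q - M|^3, A
   for its value at l1, and [a1] for l minus the first component of the gradient
   of the Newtonian potential, which is 2 A x to first order. *)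
Definition neck_energy A kap eps x y p s :=
  (p + y) ^+ 2 + (s - x) ^+ 2 + (A - 1) * y ^+ 2
    <= (1 + 2 * A) * x ^+ 2 + 2 * eps + kap * (x ^+ 2 + y ^+ 2).

Definition Nsq x y p s := x ^+ 2 + y ^+ 2 + p ^+ 2 + s ^+ 2.

(* The values on X_H of - q dp + d(l p + phi) and of - (q - E) dp. *)
Definition Q0 j x y p s (a1 Aq : R) :=
  (1 + j) * p ^+ 2 + 2 * y * p + (1 - j) * Aq * y ^+ 2 + j * s ^+ 2 + j * x * a1.
Definition QE d x y p s a1 Aq := (d - x) * (s + a1) + y * (p + Aq * y).

(* Then 2 A j = A - 1 and for a1 = 2 A x, Aq = A one gets Q0 =
   j (p^2 + s^2) + (p + y)^2 + (A - 1) (y^2 / 2 + x^2). *)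
Definition jneck A := (A - 1) / (2 * A).

Lemma jneck_bounds A : 1 < A -> 0 < jneck A < 1 / 2.
Proof.
move=> A1; have A0 : 0 < A by lra.
rewrite /jneck divr_gt0 ?subr_gt0 ?mulr_gt0 //= ltr_pdivrMr ?mulr_gt0 //; lra.
Qed.

(** The energy has a single negative direction, x, so x^2 + eps dominates the other coordinates; kap
    <= (A - 1) / 2 leaves half of the y^2 term. *)
Lemma neck_size A : 1 < A -> exists2 C, 0 < C & forall kap eps x y p s,
  kap <= (A - 1) / 2 -> kap <= 1 -> 0 <= eps -> neck_energy A kap eps x y p s ->
  Nsq x y p s <= C * (x ^+ 2 + eps).
Proof.
move=> A1; pose D := 6 / (A - 1) + 2.
have D0 : 0 < D by rewrite addr_gt0 // divr_gt0 // subr_gt0.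
exists (3 + D * (2 * A + 2)); first by have := mulr_gt0 D0 (_ : 0 < 2 * A + 2); lra.
move=> kap eps x y p s k1 k2 e0 E; rewrite /Nsq.
have xx := sqr_ge0 x; have yy := sqr_ge0 y; have pp := sqr_ge0 (p + y).
have ww := sqr_ge0 (s - x).
have E1 : (p + y) ^+ 2 + (s - x) ^+ 2 + (A - 1) / 2 * y ^+ 2 <= (2 * A + 2) * x ^+ 2 + 2 * eps.
  move: E; rewrite /neck_energy.
  have : kap * x ^+ 2 <= 1 * x ^+ 2 by rewrite ler_wpM2r.
  have : kap * y ^+ 2 <= (A - 1) / 2 * y ^+ 2 by rewrite ler_wpM2r.
  have -> : (A - 1) * y ^+ 2 = (A - 1) / 2 * y ^+ 2 + (A - 1) / 2 * y ^+ 2 by field.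
  lra.
set Z := (2 * A + 2) * x ^+ 2 + 2 * eps in E1 *.
have Z0 : 0 <= Z.
  by apply: addr_ge0; apply: mulr_ge0 => //; lra.
have A10 : 0 < A - 1 by rewrite subr_gt0.
have y1 : 3 * y ^+ 2 <= 6 / (A - 1) * Z.
  have : 6 / (A - 1) * ((A - 1) / 2 * y ^+ 2) <= 6 / (A - 1) * Z.
    by apply: ler_wpM2l; [apply: divr_ge0 => //; exact: ltW|lra].
  by have -> : 6 / (A - 1) * ((A - 1) / 2 * y ^+ 2) = 3 * y ^+ 2 by field; rewrite gt_eqF.
have p1 : p ^+ 2 <= 2 * (p + y) ^+ 2 + 2 * y ^+ 2.
  by rewrite -subr_ge0 (_ : _ - _ = (p + 2 * y) ^+ 2) ?sqr_ge0 //; ring.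
have s1 : s ^+ 2 <= 2 * (s - x) ^+ 2 + 2 * x ^+ 2.
  by rewrite -subr_ge0 (_ : _ - _ = (s - 2 * x) ^+ 2) ?sqr_ge0 //; ring.
have yA : 0 <= (A - 1) / 2 * y ^+ 2 by apply: mulr_ge0 => //; lra.
have fin : x ^+ 2 + y ^+ 2 + p ^+ 2 + s ^+ 2 <= 3 * x ^+ 2 + D * Z.
  by rewrite /D mulrDl; lra.
apply: le_trans fin _; rewrite /Z.
have : D * (2 * eps) <= D * (2 * A + 2) * eps.
  by rewrite -mulrA ler_pM2l // ler_wpM2r //; lra.
have : 0 <= 3 * eps by rewrite mulr_ge0.
by rewrite !mulrDr !mulrDl; lra.
Qed.

(** Since 1 + 2 A + A^2 / 2 < (A + 1)^2, the coefficient of |x| can be taken below A + 1 by the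
    margin [t]. So, up to eta, x dominates in A g = (A + 1) x + (s - x), on which the comparisons of
    g with x below rest. *)
Lemma neck_w A : 1 < A -> exists2 t, 0 < t < A + 1 & forall kap eps x y p s eta,
  kap <= (A - 1) / 2 -> kap <= A ^+ 2 / 2 -> 0 <= eta -> 2 * eps <= eta ^+ 2 ->
  neck_energy A kap eps x y p s -> `|s - x| <= (A + 1 - t) * `|x| + eta.
Proof.
move=> A1; have A0 : 0 < A by lra.
have A2 : 0 < A + 1 by lra.
pose t := A ^+ 2 / (4 * (A + 1)).
have tE : 4 * (A + 1) * t = A ^+ 2 by rewrite /t; field; rewrite gt_eqF.
have t0 : 0 < t by rewrite divr_gt0 ?exprn_gt0 ?mulr_gt0.
have tA : t < A + 1 by rewrite /t ltr_pdivrMr ?mulr_gt0 //; nra.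
exists t; first by rewrite t0.
move=> kap eps x y p s eta k1 k2 e0 e1 E.
have xx := sqr_ge0 x; have yy := sqr_ge0 y; have pp := sqr_ge0 (p + y).
have x0 := normr_ge0 x.
apply: le_of_sqr; first by rewrite addr_ge0 // mulr_ge0 // subr_ge0 ltW.
rewrite real_normK ?num_real //.
have : kap * x ^+ 2 <= A ^+ 2 / 2 * x ^+ 2 by rewrite ler_wpM2r.
have : kap * y ^+ 2 <= (A - 1) * y ^+ 2 by rewrite ler_wpM2r //; lra.
move: E; rewrite /neck_energy => E ky kx.
have W : (s - x) ^+ 2 <= (1 + 2 * A + A ^+ 2 / 2) * x ^+ 2 + eta ^+ 2 by lra.
apply: (le_trans W).
have -> : ((A + 1 - t) * `|x| + eta) ^+ 2 = (A + 1 - t) ^+ 2 * `|x| ^+ 2 + eta ^+ 2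
   + 2 * ((A + 1 - t) * `|x| * eta) by ring.
rewrite real_normK ?num_real //.
have : 0 <= (A + 1 - t) * `|x| * eta by rewrite !mulr_ge0 // subr_ge0 ltW.
have : (1 + 2 * A + A ^+ 2 / 2) * x ^+ 2 <= (A + 1 - t) ^+ 2 * x ^+ 2.
  rewrite ler_wpM2r //.
  have -> : (A + 1 - t) ^+ 2 = (A + 1) ^+ 2 - 4 * (A + 1) * t / 2 + t ^+ 2 by field.
  by rewrite tE; have := sqr_ge0 t; lra.
lra.
Qed.

Lemma neck_g_pos A kap eps x y p s eta sig : 1 < A -> 0 < sig ->
  kap <= (A - 1) / 2 -> kap <= A ^+ 2 / 2 -> 0 <= eta -> 2 * eps <= eta ^+ 2 ->
  neck_energy A kap eps x y p s -> eta <= sig / 2 -> sig <= x + s / A -> sig / 8 <= x.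
Proof.
move=> A1 sg0 k1 k2 e0 e1 E es; have A0 : 0 < A by lra.
have [t /andP[t0 tA] /(_ _ _ _ _ _ _ _ k1 k2 e0 e1 E) h] := neck_w A1.
have -> : x + s / A = ((A + 1) * x + (s - x)) / A by field; rewrite gt_eqF.
rewrite ler_pdivlMr // => gs.
have w1 := ler_norm (s - x).
have sA : sig <= sig * A by rewrite ler_peMr //; [exact: ltW|exact: ltW].
have [x0|x0] := leP x 0.
  move: h; rewrite (ler0_norm x0) => h.
  have : 0 <= (- x) * t by rewrite mulr_ge0 ?oppr_ge0 // ltW.
  by lra.
move: h; rewrite (gtr0_norm x0) => h.
have tx : 0 <= t * x by rewrite mulr_ge0 // ltW.
have h1 : sig * A - sig / 2 <= 2 * (A + 1) * x by lra.
have A2 : 0 < 2 * (A + 1) by lra.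
rewrite -(ler_pM2l A2); apply: le_trans h1.
have : 0 < sig * (A - 1) by rewrite mulr_gt0 // subr_gt0.
lra.
Qed.

Lemma neck_x_le A : 1 < A -> exists2 C, 0 < C & forall kap eps x y p s eta sig,
  kap <= (A - 1) / 2 -> kap <= A ^+ 2 / 2 -> 0 <= eta -> 2 * eps <= eta ^+ 2 ->
  neck_energy A kap eps x y p s -> eta <= sig -> `|x + s / A| <= 2 * sig -> `|x| <= C * sig.
Proof.
move=> A1; have A0 : 0 < A by lra.
have [t /andP[t0 tA] H] := neck_w A1.
exists ((2 * A + 1) / t); first by rewrite divr_gt0 //; lra.
move=> kap eps x y p s eta sig k1 k2 e0 e1 E es.
have h := H _ _ _ _ _ _ _ k1 k2 e0 e1 E.
have -> : x + s / A = ((A + 1) * x + (s - x)) / A by field; rewrite gt_eqF.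
rewrite normrM normfV (gtr0_norm A0) ler_pdivrMr // => gs.
rewrite mulrAC ler_pdivlMr //.
have : (A + 1) * `|x| <= `|(A + 1) * x + (s - x)| + `|s - x|.
  rewrite -[in leLHS](gtr0_norm (_ : 0 < A + 1)); last by lra.
  by rewrite -normrM -{1}(addrK (s - x) ((A + 1) * x)) ler_normB.
nra.
Qed.

Lemma neck_g_ge A : 1 < A -> exists2 k, 0 < k & forall kap eps x y p s eta,
  kap <= (A - 1) / 2 -> kap <= A ^+ 2 / 2 -> 0 <= eta -> 2 * eps <= eta ^+ 2 ->
  neck_energy A kap eps x y p s -> 0 < x -> eta <= k * x -> k * x <= x + s / A.
Proof.
move=> A1; have A0 : 0 < A by lra.
have [t /andP[t0 tA] H] := neck_w A1.
exists (t / (2 * A)); first by rewrite divr_gt0 // mulr_gt0.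
move=> kap eps x y p s eta k1 k2 e0 e1 E x0 ex.
have := H _ _ _ _ _ _ _ k1 k2 e0 e1 E; rewrite (gtr0_norm x0) => h.
have -> : x + s / A = ((A + 1) * x + (s - x)) / A by field; rewrite gt_eqF.
have tx : t / (2 * A) * x * A = t * x / 2 by field; rewrite gt_eqF.
have tx0 : 0 < t / (2 * A) * x by rewrite mulr_gt0 // divr_gt0 // mulr_gt0.
have etx : eta <= t * x / 2.
  by apply: le_trans ex _; rewrite -tx ler_peMr // ltW.
rewrite ler_pdivlMr //; move: h; rewrite ler_norml => /andP[h _].
by rewrite tx; lra.
Qed.

(** For Aq = A and a1 = 2 A x the form is at least jneck A times [Nsq], because jneck A <= (A - 1) /
    2. Half of this pays for the deviations of size kap. *)
Lemma Q0_ge A kap x y p s (a1 Aq : R) : 1 < A -> 0 <= kap <= jneck A / 8 ->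
  `|Aq - A| <= kap -> `|a1 - 2 * A * x| <= kap * (`|x| + `|y|) ->
  jneck A / 2 * Nsq x y p s <= Q0 (jneck A) x y p s a1 Aq.
Proof.
move=> A1 /andP[k0 k1] hA ha; have /andP[j0 j1] := jneck_bounds A1.
have jA : 2 * A * jneck A = A - 1 by rewrite /jneck; field; rewrite gt_eqF //; lra.
set j := jneck A in k1 j0 j1 jA *; clearbody j.
have h2A : j * 2 <= j * (2 * A) by rewrite ler_pM2l //; lra.
have jA' : j <= (A - 1) / 2 by lra.
rewrite /Q0 /Nsq; have xx := sqr_ge0 x; have yy := sqr_ge0 y.
have pp := sqr_ge0 p; have ss := sqr_ge0 s; have py := sqr_ge0 (p + y).
have e1 : - (kap * y ^+ 2) <= (1 - j) * (Aq - A) * y ^+ 2.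
  have : `|(1 - j) * (Aq - A)| <= kap.
    rewrite normrM ger0_norm; last by lra.
    by apply: le_trans hA; rewrite ler_piMl //; lra.
  rewrite ler_norml => /andP[h _].
  by rewrite -mulNr ler_wpM2r.
have e2 : - (kap * (2 * x ^+ 2 + y ^+ 2)) <= j * x * (a1 - 2 * A * x).
  have : `|j * x * (a1 - 2 * A * x)| <= kap * (2 * x ^+ 2 + y ^+ 2).
    rewrite 2!normrM (gtr0_norm j0).
    apply: (@le_trans _ _ (1 * `|x| * (kap * (`|x| + `|y|)))).
      by apply: ler_pM => //; [rewrite mulr_ge0 // ltW|apply: ler_wpM2r => //; lra].
    rewrite mul1r mulrCA ler_wpM2l // -[x ^+ 2]real_normK ?num_real //.
    rewrite -[y ^+ 2]real_normK ?num_real //.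
    by have := sqr_ge0 (`|x| - `|y|); have := sqr_ge0 `|y|; have := sqr_ge0 `|x|; lra.
  by rewrite ler_norml => /andP[].
have e3 : kap * x ^+ 2 <= j / 8 * x ^+ 2 by rewrite ler_wpM2r.
have e4 : kap * y ^+ 2 <= j / 8 * y ^+ 2 by rewrite ler_wpM2r.
have e5 : j * y ^+ 2 <= (A - 1) / 2 * y ^+ 2 by rewrite ler_wpM2r.
have e6 : 0 <= j * x ^+ 2 by rewrite mulr_ge0 // ltW.
have e7 : 0 <= j * y ^+ 2 by rewrite mulr_ge0 // ltW.
have e8 : 0 <= j * p ^+ 2 by rewrite mulr_ge0 // ltW.
have e9 : 0 <= j * s ^+ 2 by rewrite mulr_ge0 // ltW.
have e10 : j * x ^+ 2 <= (A - 1) / 2 * x ^+ 2 by rewrite ler_wpM2r.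
have -> : (1 + j) * p ^+ 2 + 2 * y * p + (1 - j) * Aq * y ^+ 2 + j * s ^+ 2 + j * x * a1 =
  j * p ^+ 2 + j * s ^+ 2 + (p + y) ^+ 2 + ((A - 2 * A * j / 2 - 1) * y ^+ 2) +
  2 * A * j * x ^+ 2 + (1 - j) * (Aq - A) * y ^+ 2 + j * x * (a1 - 2 * A * x) by field.
rewrite jA; lra.
Qed.

Lemma norm_le_N x y p s u : u ^+ 2 <= Nsq x y p s -> `|u| <= Num.sqrt (Nsq x y p s).
Proof.
move=> h; apply: le_of_sqr; first exact: sqrtr_ge0.
rewrite real_normK ?num_real // sqr_sqrtr // /Nsq.
by rewrite !addr_ge0 ?sqr_ge0.
Qed.

Lemma Nsq_norms x y p s (N := Num.sqrt (Nsq x y p s)) :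
  [/\ 0 <= N, N ^+ 2 = Nsq x y p s & [/\ `|x| <= N, `|y| <= N, `|p| <= N & `|s| <= N]].
Proof.
have n0 : 0 <= Nsq x y p s by rewrite /Nsq !addr_ge0 ?sqr_ge0.
split; [exact: sqrtr_ge0|exact: sqr_sqrtr|].
split; apply: norm_le_N; rewrite /Nsq; have := sqr_ge0 x; have := sqr_ge0 y;
  have := sqr_ge0 p; have := sqr_ge0 s; lra.
Qed.

(** As s + 2 A x = A (g + x), the term d (s + a1) is at least of order sig when x >= 0 and g >= sig,
    while [Nsq] and the remaining terms are O(sig^2). *)
Lemma QE_ge A C1 d : 1 < A -> 0 < C1 -> 0 < d -> exists2 kap, 0 < kap &
  exists2 sig0, 0 < sig0 & forall sig x y p s (a1 Aq : R), 0 < sig <= sig0 ->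
  `|Aq - A| <= 1 -> `|a1 - 2 * A * x| <= kap * (`|x| + `|y|) ->
  0 <= x -> sig <= x + s / A -> Nsq x y p s <= (C1 * sig) ^+ 2 ->
  Nsq x y p s <= QE d x y p s a1 Aq.
Proof.
move=> A1 C10 d0; have A0 : 0 < A by lra.
exists (A / (4 * C1)); first by rewrite divr_gt0 // mulr_gt0.
have [S2 S2E] : exists S2, S2 = d * A / (4 * (C1 ^+ 2 * (A + 3))) by eexists.
have den0 : 0 < C1 ^+ 2 * (A + 3) by rewrite mulr_gt0 ?exprn_gt0 //; lra.
have S20 : 0 < S2 by rewrite S2E; apply: divr_gt0; apply: mulr_gt0.
exists (Num.min (d / (2 * C1)) S2); first by rewrite lt_min S20 divr_gt0 // mulr_gt0.
move=> sig x y p s a1 Aq /andP[sg0]; rewrite le_min => /andP[sd sS] hA ha x0 gs NC.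
have [N0 N2 [Nx Ny Np Ns]] := Nsq_norms x y p s.
set N := Num.sqrt _ in N0 N2 Nx Ny Np Ns; rewrite -N2 in NC *.
have NCs : N <= C1 * sig by apply: le_of_sqr => //; rewrite mulr_ge0 // ltW.
have sdE : C1 * sig <= d / 2.
  by move: sd; rewrite ler_pdivlMr ?mulr_gt0 //; lra.
have xN : x <= d / 2 by have := ler_norm x; lra.
have sa : A * sig / 2 <= s + a1.
  have -> : s + a1 = A * (x + s / A) + A * x + (a1 - 2 * A * x) by field; rewrite gt_eqF.
  have h1 : A * sig <= A * (x + s / A) by rewrite ler_pM2l.
  have h2 : 0 <= A * x by rewrite mulr_ge0 // ltW.
  have h3 : `|a1 - 2 * A * x| <= A * sig / 2.
    apply: (le_trans ha).
    have -> : A * sig / 2 = A / (4 * C1) * (C1 * sig + C1 * sig) by field; rewrite gt_eqF.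
    by apply: ler_wpM2l; [rewrite divr_ge0 ?mulr_ge0 // ltW|lra].
  by move: h3; rewrite ler_norml => /andP[]; lra.
have q1 : d * A * sig / 4 <= (d - x) * (s + a1).
  have -> : d * A * sig / 4 = d / 2 * (A * sig / 2) by field.
  have As : 0 < A * sig by rewrite mulr_gt0.
  by apply: ler_pM => //; lra.
have q2 : - ((A + 2) * N ^+ 2) <= y * (p + Aq * y).
  have : `|y * (p + Aq * y)| <= (A + 2) * N ^+ 2.
    rewrite normrM; have Aqn : `|Aq| <= A + 1.
      rewrite -(subrK A Aq); apply: le_trans (ler_normD _ _) _.
      by rewrite (gtr0_norm A0); lra.
    have -> : (A + 2) * N ^+ 2 = N * (N + (A + 1) * N) by ring.
    apply: ler_pM => //; apply: le_trans (ler_normD _ _) _; apply: lerD => //.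
    by rewrite normrM; apply: ler_pM.
  by rewrite ler_norml => /andP[].
have q3 : (A + 3) * N ^+ 2 <= d * A * sig / 4.
  have : (A + 3) * N ^+ 2 <= (A + 3) * (C1 * sig) ^+ 2 by rewrite ler_wpM2l //; lra.
  move=> /le_trans; apply.
  have -> : (A + 3) * (C1 * sig) ^+ 2 = sig * (C1 ^+ 2 * (A + 3) * sig) by ring.
  have -> : d * A * sig / 4 = sig * (C1 ^+ 2 * (A + 3) * S2).
    by rewrite S2E; field; rewrite !gt_eqF //; lra.
  by rewrite ler_pM2l // ler_pM2l.
rewrite /QE; lra.
Qed.

(** The first factor is the derivative of g along X_H, the second is d p - phi. The product has the
    form (b p + e) (d p - f) with b, d > 0 and e, f of second order. Completing the square in p
    absorbs the cubic terms and leaves a quartic error. *)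
Lemma cut_ge A d CA : 1 < A -> 0 < d -> 0 < CA -> exists2 C, 0 < C & forall x y p s (Aq : R),
  Nsq x y p s <= 1 -> `|Aq - A| <= CA * (`|x| + `|y|) ->
  - (C * Nsq x y p s ^+ 2) <= ((1 - A^-1) * p + y * (1 - Aq / A)) *
     (d * p - ((1 + jneck A) * x * p + jneck A * y * s)).
Proof.
move=> A1 d0 CA0; have A0 : 0 < A by lra.
have /andP[j0 j1] := jneck_bounds A1.
set b := 1 - A^-1.
have b0 : 0 < b by rewrite subr_gt0 invf_lt1.
have b1 : b <= 1 by rewrite gerBl invr_ge0 ltW.
have [E EE] : exists E, E = 2 * CA by eexists.
have E0 : 0 < E by rewrite EE mulr_gt0.
pose K := d * E + 2; have K0 : 0 < K by rewrite addr_gt0 // mulr_gt0.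
exists (K ^+ 2 / (4 * (b * d)) + 2 * E).
  by rewrite addr_gt0 ?divr_gt0 ?mulr_gt0 ?exprn_gt0.
move=> x y p s Aq N1 hA.
have [N0 N2 [Nx Ny Np Ns]] := Nsq_norms x y p s.
set N := Num.sqrt _ in N0 N2 Nx Ny Np Ns; rewrite -N2 in N1 *.
set j := jneck A in j0 j1 *; clearbody j.
set f := (1 + j) * x * p + j * y * s; set e := y * (1 - Aq / A).
have fN : `|f| <= 2 * N ^+ 2.
  apply: le_trans (ler_normD _ _) _; rewrite !normrM (gtr0_norm j0) (gtr0_norm (_ : 0 < 1 + j)); last by lra.
  have h1 : (1 + j) * `|x| * `|p| <= (1 + j) * (N * N).
    by rewrite -mulrA ler_wpM2l ?ler_pM //; lra.
  have h2 : j * `|y| * `|s| <= j * (N * N).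
    by rewrite -mulrA ler_wpM2l ?ler_pM //; lra.
  have : 0 <= N * N by rewrite mulr_ge0.
  move=> NN; have : j * (N * N) <= 1 / 2 * (N * N) by rewrite ler_wpM2r // ltW.
  by rewrite expr2; lra.
have eN : `|e| <= E * N ^+ 2.
  rewrite /e normrM; have -> : 1 - Aq / A = - (Aq - A) / A by field; rewrite gt_eqF.
  rewrite normrM normfV normrN (gtr0_norm A0).
  have : `|Aq - A| / A <= E * N.
    rewrite ler_pdivrMr //; apply: (le_trans hA).
    have : CA * (`|x| + `|y|) <= CA * (N + N) by rewrite ler_pM2l // lerD.
    move=> /le_trans; apply; rewrite EE.
    have : 0 <= 2 * CA * N by rewrite !mulr_ge0 // ltW.
    by nra.
  move=> h; have -> : E * N ^+ 2 = N * (E * N) by ring.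
  by apply: ler_pM => //; rewrite divr_ge0 // ltW.
clearbody e f.
have XN : `|d * e - b * f| <= K * N ^+ 2.
  apply: le_trans (ler_normB _ _) _; rewrite !normrM (gtr0_norm d0) (gtr0_norm b0).
  have : d * `|e| <= d * (E * N ^+ 2) by rewrite ler_pM2l.
  have : b * `|f| <= 1 * (2 * N ^+ 2) by apply: ler_pM => //; exact: ltW.
  have -> : K * N ^+ 2 = d * (E * N ^+ 2) + 1 * (2 * N ^+ 2) by rewrite /K; ring.
  move=> h2 h1. exact: lerD h1 h2.
have ef : e * f <= 2 * E * N ^+ 4.
  apply: le_trans (ler_norm _) _; rewrite normrM.
  have -> : 2 * E * N ^+ 4 = (E * N ^+ 2) * (2 * N ^+ 2) by ring.
  exact: ler_pM.
have -> : (b * p + e) * (d * p - f) = b * d * p ^+ 2 + p * (d * e - b * f) - e * f by ring.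
set X := d * e - b * f in XN *.
have bd : 0 < b * d by rewrite mulr_gt0.
have X2 : X ^+ 2 <= K ^+ 2 * N ^+ 4.
  have -> : K ^+ 2 * N ^+ 4 = (K * N ^+ 2) ^+ 2 by ring.
  by rewrite -real_normK ?num_real // lerXn2r // nnegrE // mulr_ge0 ?sqr_ge0 // ltW.
have am : - (X ^+ 2 / (4 * (b * d))) <= b * d * p ^+ 2 + p * X.
  rewrite -subr_ge0.
  have -> : b * d * p ^+ 2 + p * X - - (X ^+ 2 / (4 * (b * d))) =
    (2 * (b * d) * p + X) ^+ 2 / (4 * (b * d)) by field; rewrite !gt_eqF.
  by rewrite divr_ge0 ?sqr_ge0 // mulr_ge0 // ltW.
have : X ^+ 2 / (4 * (b * d)) <= K ^+ 2 / (4 * (b * d)) * N ^+ 4.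
  by rewrite [leRHS]mulrAC ler_pM2r // invr_gt0 mulr_gt0.
have -> : (N ^+ 2) ^+ 2 = N ^+ 4 by ring.
move=> h; rewrite mulrDl opprD; apply: lerD; last by rewrite lerN2.
by apply: le_trans am; rewrite lerN2.
Qed.

Lemma neck_energy_mono A kap kap' eps x y p s : kap <= kap' ->
  neck_energy A kap eps x y p s -> neck_energy A kap' eps x y p s.
Proof.
move=> kk; rewrite /neck_energy => /le_trans; apply; rewrite lerD2l.
by rewrite ler_wpM2r // addr_ge0 ?sqr_ge0.
Qed.

(** For sig <= g <= 2 sig one has Nsq <= (C1 sig)^2, so the error K / sig * C4 * Nsq^2 is at most K
    C4 C1^2 sig * Nsq. The bound on sig makes this at most half of the lower bound jneck A / 2 * Nsq
    shared by both forms. *)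
Lemma neck_blend A d CA K : 1 < A -> 0 < d -> 0 < CA -> 0 < K ->
  exists2 kap, 0 < kap & exists2 sig0, 0 < sig0 &
  forall sig eps x y p s (a1 Aq chi dchi : R), 0 < sig <= sig0 -> 0 <= eps <= sig ^+ 2 / 8 ->
  `|Aq - A| <= kap -> `|Aq - A| <= CA * (`|x| + `|y|) ->
  `|a1 - 2 * A * x| <= kap * (`|x| + `|y|) -> neck_energy A kap eps x y p s ->
  sig <= x + s / A <= 2 * sig -> 0 <= chi <= 1 -> 0 <= dchi <= K / sig ->
  0 < (1 - chi) * Q0 (jneck A) x y p s a1 Aq + chi * QE d x y p s a1 Aq
      + dchi * (((1 - A^-1) * p + y * (1 - Aq / A)) *
                (d * p - ((1 + jneck A) * x * p + jneck A * y * s))).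
Proof.
move=> A1 d0 CA0 K0; have /andP[j0 j1] := jneck_bounds A1.
have [C C0 HC] := neck_size A1.
have [Cx Cx0 HCx] := neck_x_le A1.
have [C4 C40 HC4] := cut_ge A1 d0 CA0.
have [C1 C1E] : exists C1, C1 = C * (Cx ^+ 2 + 1) + 1 by eexists.
have c0 : 0 < C * (Cx ^+ 2 + 1) by rewrite mulr_gt0 // addr_gt0 // exprn_gt0.
have C10 : 0 < C1 by rewrite C1E addr_gt0.
have [kq kq0 [sq sq0 HQE]] := QE_ge A1 C10 d0.
have A10 : 0 < (A - 1) / 2 by rewrite divr_gt0 // subr_gt0.
have A20 : 0 < A ^+ 2 / 2 by rewrite divr_gt0 // exprn_gt0 //; lra.
have [kap kapE] : exists k, k = Num.min (Num.min ((A - 1) / 2) 1)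
    (Num.min (A ^+ 2 / 2) (Num.min (jneck A / 8) kq)) by eexists.
have j8 : 0 < jneck A / 8 by rewrite divr_gt0.
have kap0 : 0 < kap by rewrite kapE !lt_min ltr01 A10 A20 kq0 j8.
have k1 : kap <= (A - 1) / 2 by rewrite kapE !ge_min lexx.
have k2 : kap <= 1 by rewrite kapE !ge_min lexx !orbT.
have k3 : kap <= A ^+ 2 / 2 by rewrite kapE !ge_min lexx !orbT.
have k4 : kap <= jneck A / 8 by rewrite kapE !ge_min lexx !orbT.
have k5 : kap <= kq by rewrite kapE !ge_min lexx !orbT.
have [S ES] : exists S, S = jneck A / (4 * (K * C4 * C1 ^+ 2)) by eexists.
have den0 : 0 < K * C4 * C1 ^+ 2 by rewrite !mulr_gt0 // exprn_gt0.
have S0 : 0 < S by rewrite ES; apply: divr_gt0 => //; apply: mulr_gt0.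
exists kap => //; exists (Num.min sq (Num.min C1^-1 S)).
  by rewrite !lt_min sq0 S0 invr_gt0 C10.
move=> sig eps x y p s a1 Aq chi dchi /andP[sg0].
rewrite !le_min => /andP[ssq /andP[sC1 sS]] /andP[e0 e1] hA hA' ha E /andP[g1 g2].
move=> /andP[c00 c01] /andP[d00 d01].
have eta : 2 * eps <= (sig / 2) ^+ 2 by have -> : (sig / 2) ^+ 2 = sig ^+ 2 / 4 by [field]; lra.
have sg2 : 0 <= sig / 2 by lra.
have x8 := neck_g_pos A1 sg0 k1 k3 sg2 eta E (lexx _) g1.
have x0 : 0 < x by lra.
have gabs : `|x + s / A| <= 2 * sig by rewrite ger0_norm //; lra.
have ssle : sig / 2 <= sig by lra.
have xC := HCx _ _ _ _ _ _ _ _ k1 k3 sg2 eta E ssle gabs.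
have NC : Nsq x y p s <= (C1 * sig) ^+ 2.
  apply: le_trans (HC _ _ _ _ _ _ k1 k2 e0 E) _.
  have x2 : x ^+ 2 <= (Cx * sig) ^+ 2.
    by rewrite -[x ^+ 2]real_normK ?num_real // lerXn2r // nnegrE // mulr_ge0 // ltW.
  have s2 : eps <= sig ^+ 2 by have := sqr_ge0 sig; lra.
  have : C * (x ^+ 2 + eps) <= C * ((Cx * sig) ^+ 2 + sig ^+ 2) by rewrite ler_pM2l // lerD.
  move=> /le_trans; apply.
  have -> : C * ((Cx * sig) ^+ 2 + sig ^+ 2) = (C * (Cx ^+ 2 + 1)) * sig ^+ 2 by ring.
  rewrite exprMn ler_wpM2r ?sqr_ge0 // C1E.
  by move: (C * (Cx ^+ 2 + 1)) c0 => u u0; have := sqr_ge0 u; nra.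
have C1s : C1 * sig <= 1 by move: sC1; rewrite -[C1^-1]div1r ler_pdivlMr // mulrC.
have C1s0 : 0 <= C1 * sig by rewrite mulr_ge0 // ltW.
have N1 : Nsq x y p s <= 1 by apply: le_trans NC _; rewrite expr_le1.
have N0 : 0 < Nsq x y p s.
  rewrite /Nsq -!addrA ltr_pwDl ?exprn_gt0 // !addr_ge0 ?sqr_ge0 //.
have kk : 0 <= kap <= jneck A / 8 by rewrite ltW.
have q0 := Q0_ge p s A1 kk hA ha.
have sgq : 0 < sig <= sq by rewrite sg0.
have hA1 : `|Aq - A| <= 1 by exact: le_trans k2.
have ha' : `|a1 - 2 * A * x| <= kq * (`|x| + `|y|).
  by apply: le_trans ha _; rewrite ler_wpM2r // addr_ge0.
have qE := HQE _ _ _ _ _ _ _ sgq hA1 ha' (ltW x0) g1 NC.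
have tt := HC4 _ _ _ _ _ N1 hA'.
set N := Nsq x y p s in NC N1 N0 q0 qE tt *.
set T := (_ + _) * (d * p - _) in tt *.
set q0v := Q0 _ _ _ _ _ _ _ in q0 *; set qEv := QE _ _ _ _ _ _ _ in qE *.
have b1 : jneck A / 2 * N <= (1 - chi) * q0v + chi * qEv.
  have h1 : (1 - chi) * (jneck A / 2 * N) <= (1 - chi) * q0v by rewrite ler_wpM2l // subr_ge0.
  have h2 : chi * (jneck A / 2 * N) <= chi * qEv.
    rewrite ler_wpM2l // (le_trans _ qE) // ler_piMl ?(ltW N0) //; lra.
  by have -> : jneck A / 2 * N = (1 - chi) * (jneck A / 2 * N) + chi * (jneck A / 2 * N) by [ring]; exact: lerD.
have b2 : - (jneck A / 4 * N) <= dchi * T.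
  have h1 : dchi * (- (C4 * N ^+ 2)) <= dchi * T by rewrite ler_wpM2l.
  apply: le_trans h1; rewrite mulrN lerN2.
  have h2 : N ^+ 2 <= N * (C1 * sig) ^+ 2 by rewrite expr2 ler_wpM2l // ltW.
  have h3 : dchi * (C4 * N ^+ 2) <= K / sig * (C4 * (N * (C1 * sig) ^+ 2)).
    by apply: ler_pM => //; [rewrite mulr_ge0 ?sqr_ge0 // ltW|rewrite ler_wpM2l // ltW].
  apply: le_trans h3 _.
  have -> : K / sig * (C4 * (N * (C1 * sig) ^+ 2)) = N * (K * C4 * C1 ^+ 2 * sig).
    by field; rewrite gt_eqF.
  rewrite mulrC ler_wpM2r ?(ltW N0) //.
  have -> : jneck A / 4 = K * C4 * C1 ^+ 2 * S by rewrite ES; field; rewrite !gt_eqF.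
  by rewrite ler_pM2l.
have : 0 < jneck A / 4 * N by rewrite mulr_gt0 // divr_gt0.
lra.
Qed.

End Neck.

(** * Expansion of the gradient at the critical point *)

Section Taylor.
Context {R : realType}.

Lemma norm_coord_le (h : 'rV[R]_2) (r : R) : enorm h < r -> `|h 0 0| < r /\ `|h 0 1| < r.
Proof.
move=> hr; have r0 : 0 <= r by apply: ltW; apply: le_lt_trans hr; exact: enorm_ge0.
have := lerXn2r 2 (_ : enorm h \is Num.nneg) (_ : r \is Num.nneg) (ltW hr).
by split; apply: le_lt_trans hr; apply: le_of_sqr; rewrite ?enorm_ge0 //
  real_normK ?num_real // enormX2 dot2E -!expr2 ?lerDl ?lerDr sqr_ge0.
Qed.

Lemma sup_norm_le (h : 'rV[R]_2) : `|h| <= `|h 0 0| + `|h 0 1|.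
Proof.
rewrite [leLHS]/Num.Def.normr /= mx_normrE; apply: bigmax_le; first by rewrite addr_ge0.
move=> -[i j] _ /=; rewrite (ord1 i).
case: (j =P 0) => [->|jn0]; first by rewrite lerDl.
have -> : j = 1.
  apply/val_inj; case: j jn0 => -[|[|//]] jj jn0 //=.
  by case: jn0; exact/val_inj.
by rewrite lerDr.
Qed.

Lemma has_grad_lipschitz (f : 'rV[R]_2 -> R) z L : has_grad f z L ->
  exists2 C, 0 < C & exists2 r, 0 < r & forall h, enorm h < r ->
    `|f (z + h) - f z| <= C * (`|h 0 0| + `|h 0 1|).
Proof.
move=> hf; have /nbhs_ballP[r /= r0 rP] := has_grad_small hf ltr01.
have lL := has_grad_linear hf.
have Lh h : L h = h 0 0 * L (vec2 1 0) + h 0 1 * L (vec2 0 1).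
  have L0 : L 0 = 0 by rewrite -hf.2 derive0.
  transitivity (L (h 0 0 *: vec2 1 0 + (h 0 1 *: vec2 0 1 + 0))).
    by congr L; apply: rV2P; rewrite !mxE /=; ring.
  by rewrite !lL L0 addr0.
exists (1 + `|L (vec2 1 0)| + `|L (vec2 0 1)|).
  by rewrite -addrA ltr_pwDl // addr_ge0.
exists (r / 2); first by rewrite divr_gt0.
move=> h hr; have [h0 h1] := norm_coord_le hr.
have := rP h; rewrite -ball_normE /= sub0r normrN.
have hs := sup_norm_le h.
move=> /(_ _)/[!mul1r] H.
have {}H : `|f (z + h) - f z - L h| <= `|h| by apply: H; lra.
have : `|L h| <= (`|L (vec2 1 0)| + `|L (vec2 0 1)|) * (`|h 0 0| + `|h 0 1|).
  rewrite Lh; apply: (le_trans (ler_normD _ _)); rewrite !normrM.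
  have := normr_ge0 (L (vec2 1 0)); have := normr_ge0 (L (vec2 0 1)).
  have := normr_ge0 (h 0 0); have := normr_ge0 (h 0 1).
  by move: `|L _| `|L _| `|h 0 0| `|h 0 1| => u v w x *; nra.
have : `|f (z + h) - f z| <= `|f (z + h) - f z - L h| + `|L h|.
  by rewrite -{1}(subrK (L h) (f (z + h) - f z)) ler_normD.
lra.
Qed.

Variables (mu t : R).
Hypotheses (mu01 : 0 < mu < 1) (t01 : 0 < t < 1).
Let l := mu - t.
Let ell : 'rV[R]_2 := vec2 l 0.
Hypothesis crit : gradU mu ell = 0.

(** The cubes are spelled out as products of inverse distances, so that gradients are assembled from
    [has_grad_inv_dist]. *)
Definition Acoef (q : 'rV[R]_2) : R :=
  (1 - mu) * (enorm (q - earth mu))^-1 * (enorm (q - earth mu))^-1 * (enorm (q - earth mu))^-1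
  + mu * (enorm (q - moon mu))^-1 * (enorm (q - moon mu))^-1 * (enorm (q - moon mu))^-1.

Definition V1 (q : 'rV[R]_2) : R :=
  (1 - mu) * (enorm (q - earth mu))^-1 * (enorm (q - earth mu))^-1 * (enorm (q - earth mu))^-1
    * (q - earth mu) 0 0
  + mu * (enorm (q - moon mu))^-1 * (enorm (q - moon mu))^-1 * (enorm (q - moon mu))^-1
    * (q - moon mu) 0 0.

Let A := Acoef ell.

Lemma gradUE q : gradU mu q = vec2 (V1 q - q 0 0) (Acoef q * q 0 1 - q 0 1).
Proof.
by apply: rV2P; rewrite ?vec20 ?vec21 /gradU /V1 /Acoef !mxE /= !exprS expr0 !mulr1 !invfM; ring.
Qed.

Lemma gradqE z : gradq (1 - mu) (earth mu) mu (moon mu) z =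
  vec2 (V1 z.1 - z.2 0 1) (Acoef z.1 * z.1 0 1 + z.2 0 0).
Proof.
by apply: rV2P; rewrite ?vec20 ?vec21 /gradq /V1 /Acoef !mxE /= !exprS expr0 !mulr1 !invfM; ring.
Qed.

Lemma ell_earth : ell - earth mu = vec2 (- t) 0 /\ enorm (ell - earth mu) = t.
Proof.
have E : ell - earth mu = vec2 (- t) 0 by apply: rV2P; rewrite /ell /l !mxE /=; ring.
split => //; rewrite E /enorm dot2E vec20 vec21 mulr0 addr0 mulrNN -expr2 sqrtr_sqr.
by rewrite gtr0_norm //; case/andP: t01.
Qed.

Lemma ell_moon : ell - moon mu = vec2 (1 - t) 0 /\ enorm (ell - moon mu) = 1 - t.
Proof.
have E : ell - moon mu = vec2 (1 - t) 0 by apply: rV2P; rewrite /ell /l !mxE /=; ring.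
split => //; rewrite E /enorm dot2E vec20 vec21 mulr0 addr0 -expr2 sqrtr_sqr.
by rewrite gtr0_norm // subr_gt0; case/andP: t01.
Qed.

Lemma ell_regular : ell != earth mu /\ ell != moon mu.
Proof.
have /andP[t0 t1] := t01.
rewrite -[ell == earth mu]subr_eq0 -[ell == moon mu]subr_eq0.
rewrite -!enorm_eq0 ell_earth.2 ell_moon.2.
by rewrite !gt_eqF // subr_gt0.
Qed.

(** A is the mean of t^-3 and (1 - t)^-3 with weights 1 - mu and mu. *)
Lemma A_gt1 : 1 < A.
Proof.
have /andP[t0 t1] := t01; have /andP[m0 m1] := mu01.
rewrite /A /Acoef ell_earth.2 ell_moon.2.
have i1 : 1 < t^-1 by rewrite invf_gt1.
have i2 : 1 < (1 - t)^-1 by rewrite invf_gt1 ?subr_gt0 // gtrBl.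
have h1 : 1 - mu < (1 - mu) * t^-1 * t^-1 * t^-1.
  rewrite -!mulrA ltr_pMr ?subr_gt0 //.
  by rewrite (lt_trans i1) // ltr_pMr ?(lt_trans ltr01) // mulr_egt1.
have h2 : mu < mu * (1 - t)^-1 * (1 - t)^-1 * (1 - t)^-1.
  rewrite -!mulrA ltr_pMr //.
  by rewrite (lt_trans i2) // ltr_pMr ?(lt_trans ltr01) // mulr_egt1.
lra.
Qed.

Lemma V1_ell : V1 ell = l.
Proof.
have := congr1 (fun u : 'rV[R]_2 => u 0 0) crit.
by rewrite /= gradUE vec20 [RHS]mxE => /eqP; rewrite subr_eq0 => /eqP ->; rewrite vec20.
Qed.

Lemma has_grad_V1 : has_grad V1 ell (fun v => - (2 * A) * v 0 0).
Proof.
have /andP[t0 t1] := t01.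
have [rE rM] := ell_regular; have gq := vgrad_id ell.
have [dE eE] := ell_earth; have [dM eM] := ell_moon.
have gE' := vgradB gq (vgrad_cst (earth mu) ell).
have gM' := vgradB gq (vgrad_cst (moon mu) ell).
have gE := has_grad_inv_dist rE; have gM := has_grad_inv_dist rM.
have h := has_gradD
  (has_gradM (has_gradM (has_gradM (has_gradM (has_grad_cst (1 - mu) ell) gE) gE) gE) (gE' 0))
  (has_gradM (has_gradM (has_gradM (has_gradM (has_grad_cst mu ell) gM) gM) gM) (gM' 0)).
apply: (has_grad_eq h) => v; rewrite !subr0 /A /Acoef eE eM dE dM !dot2E !vec20 !vec21.
by field; rewrite !gt_eqF // subr_gt0.
Qed.

Lemma has_grad_Acoef : exists L, has_grad Acoef ell L.
Proof.
have [rE rM] := ell_regular.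
have gE := has_grad_inv_dist rE; have gM := has_grad_inv_dist rM.
eexists; exact: (has_gradD
  (has_gradM (has_gradM (has_gradM (has_grad_cst (1 - mu) ell) gE) gE) gE)
  (has_gradM (has_gradM (has_gradM (has_grad_cst mu ell) gM) gM) gM)).
Qed.

Lemma neck_taylor : exists2 CA, 0 < CA & forall kap, 0 < kap -> exists2 r, 0 < r &
  forall h, enorm h < r -> [/\ ell + h != earth mu, ell + h != moon mu,
    `|Acoef (ell + h) - A| <= CA * (`|h 0 0| + `|h 0 1|),
    `|Acoef (ell + h) - A| <= kap &
    `|l - V1 (ell + h) - 2 * A * h 0 0| <= kap * (`|h 0 0| + `|h 0 1|)].
Proof.
have [L hL] := has_grad_Acoef.
have [CA CA0 [r1 r10 r1P]] := has_grad_lipschitz hL.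
exists CA => // kap kap0.
have /nbhs_ballP[r2 /= r20 r2P] := has_grad_small has_grad_V1 kap0.
have /andP[t0 t1] := t01.
pose r := Num.min (Num.min r1 (r2 / 2)) (Num.min (kap / (2 * CA)) (Num.min t (1 - t))).
exists r.
  by rewrite !lt_min r10 t0 subr_gt0 t1 !divr_gt0 // mulr_gt0.
move=> h; rewrite !lt_min => /andP[/andP[hr1 hr2] /andP[hk /andP[ht ht']]].
have l1 := r1P _ hr1.
have [k0 k1] := norm_coord_le hk; have [d0 d1] := norm_coord_le hr2.
have hs := sup_norm_le h.
split => //.
- apply: contraTneq ht => E; rewrite -leNgt -ell_earth.2 -E opprD addNKr.
  by rewrite /enorm dotNl dotNr opprK.
- apply: contraTneq ht' => E; rewrite -leNgt -ell_moon.2 -E opprD addNKr.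
  by rewrite /enorm dotNl dotNr opprK.
- apply: (le_trans l1).
  have -> : kap = CA * (kap / (2 * CA) + kap / (2 * CA)) by field; rewrite gt_eqF.
  by rewrite ler_pM2l //; lra.
have := r2P h; rewrite -ball_normE /= sub0r normrN => /(_ _) H.
have {}H : `|V1 (ell + h) - V1 ell - - (2 * A) * h 0 0| <= kap * `|h| by apply: H; lra.
have -> : l - V1 (ell + h) - 2 * A * h 0 0 = - (V1 (ell + h) - V1 ell - - (2 * A) * h 0 0).
  by rewrite V1_ell; ring.
by rewrite normrN (le_trans H) // ler_pM2l.
Qed.

End Taylor.

(** * A smooth cut-off *)

Section Step.
Context {R : realType}.

Lemma flat0_mono (a b : R) : a <= b -> flat 0 a <= flat 0 b.
Proof.
move=> ab; rewrite /flat; case: ifP => [a0|_]; last by case: ifP => // _; rewrite expr0 mul1r expR_ge0.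
by rewrite (lt_le_trans a0 ab) !expr0 !mul1r ler_expR lerN2 lef_pV2 ?posrE // (lt_le_trans a0 ab).
Qed.

Lemma flat0_le1 (a : R) : flat 0 a <= 1.
Proof.
rewrite /flat; case: ifP => // a0; rewrite expr0 mul1r expR_le1 oppr_le0.
by rewrite invr_ge0 ltW.
Qed.

(** The inner difference is nonpositive for x <= 1 and equals the constant [flat 0 1] for x >= 2.
    Using [flat] twice keeps the composition with a smooth function in the class [smooth]. *)
Definition step (x : R) : R := flat 0 (flat 0 1 - flat 0 (2 - x)) / flat 0 (flat 0 1).
Definition dstep (x : R) : R :=
  flat 2 (flat 0 1 - flat 0 (2 - x)) * flat 2 (2 - x) / flat 0 (flat 0 1).

Let c0 : 0 < flat 0 (flat 0 (1 : R)).
Proof. by rewrite !flat_gt0. Qed.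

Lemma is_derive_step (x : R) : is_derive x 1 (step : R -> R) (dstep x).
Proof.
have h2 := has_gradB (has_grad_cst (2 : R) x) (has_grad_lin (V := R) (l := id) x _ _).
have h2' : has_grad (fun y : R => 2 - y) x (fun v => 0 - v).
  by apply: h2 => // y; exact: cvg_id.
have h := has_gradM (has_grad_comp (has_gradB (has_grad_cst (flat 0 1) x)
  (has_grad_comp h2' (is_derive_flat 0 (2 - x))))
  (is_derive_flat 0 (flat 0 1 - flat 0 (2 - x)))) (has_grad_cst (flat 0 (flat 0 1))^-1 x).
split; first by apply: diff_derivable; exact: h.1.
rewrite /step h.2 /dstep; ring.
Qed.

Lemma step_le1 (x : R) : x <= 1 -> step x = 0 /\ dstep x = 0.
Proof.
move=> x1; have h : flat 0 1 - flat 0 (2 - x) <= 0.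
  by rewrite subr_le0 flat0_mono //; lra.
by rewrite /step /dstep !(flat_le0 _ h) !mul0r.
Qed.

Lemma step_ge2 (x : R) : 2 <= x -> step x = 1 /\ dstep x = 0.
Proof.
move=> x2; have h : 2 - x <= 0 by rewrite subr_le0.
by rewrite /step /dstep !(flat_le0 _ h) subr0 mulr0 mul0r divff // gt_eqF.
Qed.

Lemma step_01 (x : R) : 0 <= step x <= 1.
Proof.
rewrite /step divr_ge0 ?flat_ge0 //= ler_pdivrMr // mul1r flat0_mono //.
by rewrite gerBl flat_ge0.
Qed.

Lemma dstep_bound : exists2 K : R, 0 < K & forall x : R, 0 <= dstep x <= K.
Proof.
pose F : R := (4`!)%:R; have F0 : 0 < F by rewrite ltr0n fact_gt0.
exists (F * F / flat 0 (flat 0 1)); first by rewrite divr_gt0 // mulr_gt0.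
move=> x; rewrite /dstep divr_ge0 ?mulr_ge0 ?flat_ge0 //=.
have [x1|x1] := leP x 1.
  by have [_] := step_le1 x1; rewrite /dstep => ->; rewrite divr_ge0 ?mulr_ge0 // ltW.
rewrite ler_pM2r ?invr_gt0 //.
have b (y : R) : y <= 1 -> flat 2 y <= F.
  move=> y1; have [y0|y0] := leP y 0; first by rewrite flat_le0 // ltW.
  apply: le_trans (flat_le _ _) _.
  by rewrite ler_piMr ?(ltW F0) // expr_le1 // ltW.
apply: ler_pM; rewrite ?flat_ge0 //; apply: b; last by lra.
by have := flat0_le1 1; have := flat_ge0 0 (2 - x); lra.
Qed.

End Step.

(** * The energy level near the critical point *)

Section NeckPotential.
Context {R : realType}.
Local Notation phase := (phase R).
Variables (mu t : R).
Let l := mu - t.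
Let ell : 'rV[R]_2 := vec2 l 0.
Let A := Acoef mu ell.
Variables (kap r : R).
Hypothesis k0 : 0 < kap.
Hypothesis tay : forall h, enorm h < r -> [/\ ell + h != earth mu, ell + h != moon mu,
    `|Acoef mu (ell + h) - A| <= kap &
    `|l - V1 mu (ell + h) - 2 * A * h 0 0| <= kap * (`|h 0 0| + `|h 0 1|)].

(** [B] is minus the quadratic part of U at ell, so the derivative of U + s^2 B along the segment
    consists of the errors in [tay] alone. The mean value theorem turns this first-order control of
    the gradient into a second-order bound for U. *)
Lemma neck_potential h : enorm h < r ->
  Upot mu ell - 2^-1 * (1 + 2 * A) * h 0 0 ^+ 2 + 2^-1 * (A - 1) * h 0 1 ^+ 2
      - 2 * kap * (h 0 0 ^+ 2 + h 0 1 ^+ 2) <= Upot mu (ell + h).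
Proof.
move=> hr; set x := h 0 0; set y := h 0 1.
pose B := 2^-1 * (1 + 2 * A) * x ^+ 2 - 2^-1 * (A - 1) * y ^+ 2.
pose f (s : R) := Upot mu (ell + s *: h) + s ^+ 2 * B.
pose df (s : R) := dot (gradU mu (ell + s *: h)) h + 2 * s * B.
have sh (s : R) : 0 <= s <= 1 -> enorm (s *: h) < r.
  move=> /andP[s0 s1]; apply: le_lt_trans hr; rewrite enormZ ger0_norm //.
  by rewrite ler_piMl ?enorm_ge0.
have fd (s : R) : 0 <= s <= 1 -> is_derive s 1 f (df s).
  move=> s01; have [e1 e2 _ _] := tay (sh _ s01).
  have d1 := is_derive_line (has_grad_Upot e1 e2).
  have d2 : is_derive s 1 (fun s : R => s ^+ 2 * B) (2 * s * B).
    have hid : has_grad (fun y : R => y) s id by apply: (has_grad_lin (V := R)) => // z; exact: cvg_id.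
    have hh := has_gradM (has_gradM hid hid) (has_grad_cst B s).
    split; first by apply: diff_derivable; apply: hh.1.
    by rewrite hh.2 /=; ring.
  exact: is_deriveD.
have [s| |s sI E] := @MVT _ f df 0 1 ltr01.
- by rewrite in_itv /= => /andP[s0 s1]; apply: fd; rewrite !ltW.
- apply: derivable_within_continuous => s; rewrite in_itv /= => s01.
  by case: (fd s).
have s01 : 0 <= s <= 1 by move: sI; rewrite in_itv /= => /andP[s0 s1]; rewrite !ltW.
have [_ _ hA hV] := tay (sh _ s01).
have /andP[s0 s1] := s01.
have E0 : f 0 = Upot mu ell by rewrite /f scale0r addr0 expr0n mul0r addr0.
have E1 : f 1 = Upot mu (ell + h) + B by rewrite /f scale1r expr1n mul1r.
move: E; rewrite E0 E1 subr0 mulr1 => E.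
suff : - (2 * kap * (x ^+ 2 + y ^+ 2)) <= df s.
  by move: E; rewrite /B; lra.
move: hA hV; rewrite /df gradUE dot2E vec20 vec21 !mxE /= -/x -/y.
move: (V1 _ _) (Acoef mu (_ + s *: h)) => v a hA hV.
have -> : (v - (l + s * x)) * x + (a * (0 + s * y) - (0 + s * y)) * y + 2 * s * B =
  - ((l - v - 2 * A * (s * x)) * x) + s * (a - A) * y ^+ 2 by rewrite /B; field.
have h1 : (l - v - 2 * A * (s * x)) * x <= kap * (2 * x ^+ 2 + y ^+ 2).
  apply: le_trans (ler_norm _) _; rewrite normrM.
  apply: (@le_trans _ _ (kap * (`|x| + `|y|) * `|x|)).
    rewrite ler_wpM2r // (le_trans hV) // !normrM ger0_norm // ler_pM2l //.
    by apply: lerD; rewrite ler_piMl.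
  rewrite -mulrA ler_pM2l // -[x ^+ 2]real_normK ?num_real // -[y ^+ 2]real_normK ?num_real //.
  move: (`|x|) (`|y|) => u w; have := sqr_ge0 (u - w); have := sqr_ge0 u; have := sqr_ge0 w; lra.
have h2 : - (kap * y ^+ 2) <= s * (a - A) * y ^+ 2.
  rewrite -mulNr ler_wpM2r ?sqr_ge0 //.
  have : `|s * (a - A)| <= kap by rewrite normrM ger0_norm // (le_trans _ hA) // ler_piMl.
  by rewrite ler_norml => /andP[].
by move: h1 h2; lra.
Qed.

Lemma neck_energy_Sigma c (z : phase) :
  Sigma mu c z -> enorm (z.1 - ell) < r ->
  neck_energy A (4 * kap) (c - Upot mu ell) (z.1 0 0 - l) (z.1 0 1) (z.2 0 0) (z.2 0 1 - l).
Proof.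
move=> [_ _ Hz] zr; have := neck_potential zr.
rewrite (addrC ell (z.1 - ell)) subrK ![(z.1 - ell) 0 _]mxE ![(- ell) 0 _]mxE vec20 vec21 subr0.
move: Hz; rewrite Ham_Upot /gradp ![(_ + vec2 _ _) 0 _]mxE vec20 vec21 /neck_energy => Hz h.
have -> : z.2 0 1 - l - (z.1 0 0 - l) = z.2 0 1 - z.1 0 0 by ring.
have -> : c = 2^-1 * ((z.2 0 0 + z.1 0 1) ^+ 2 + (z.2 0 1 - z.1 0 0) ^+ 2) + Upot mu z.1.
  by rewrite -Hz.
by move: h; lra.
Qed.

End NeckPotential.

(** * Primitives of the symplectic form *)

Section FormsFromFunctions.
Context {R : realType}.
Local Notation phase := (phase R).

(** The general shape of the primitives used above the critical value; f = P . p gives the radial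
    form around P, see [lamf_dot]. *)
Definition lamf (f : phase -> R) (z v : phase) : R := - dot z.1 v.2 + 'D_v f z.

Lemma has_grad_dot_fst (a : 'rV[R]_2) (z : phase) :
  has_grad (fun x : phase => dot x.1 a) z (fun v => dot v.1 a).
Proof.
apply: (has_grad_eq (has_grad_dot (vgrad_fst z) (vgrad_cst a z))) => v.
by rewrite dot0r add0r dotC.
Qed.

Lemma has_grad_dot_snd (a : 'rV[R]_2) (z : phase) :
  has_grad (fun x : phase => dot a x.2) z (fun v => dot a v.2).
Proof.
apply: (has_grad_eq (has_grad_dot (vgrad_cst a z) (vgrad_snd z))) => v.
by rewrite dot0r addr0.
Qed.

Lemma smooth_dot_fst (a : 'rV[R]_2) : smooth (fun x : phase => dot x.1 a).
Proof.
apply: smooth_lin; first by move=> k x y; rewrite /= dotDl dotZl.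
by move=> z; exact: has_grad_cont (has_grad_dot_fst a z).
Qed.

Lemma smooth_dot_snd (a : 'rV[R]_2) : smooth (fun x : phase => dot a x.2).
Proof.
apply: smooth_lin; first by move=> k x y; rewrite /= dotDr dotZr.
by move=> z; exact: has_grad_cont (has_grad_dot_snd a z).
Qed.

Lemma lamf_linear f z : smooth f -> scalar (lamf f z).
Proof.
move=> /smooth_grad[df _] k u v; have h := has_grad_linear (has_grad_derive (df z)) k u v.
rewrite /lamf h dotDr dotZr /=.
by move: ('D_u _ _) ('D_v _ _) (dot _ _) (dot _ _) => *; ring.
Qed.

Lemma lamf0 f z : lamf f z 0 = 0.
Proof. by rewrite /lamf dot0r derive0 oppr0 addr0. Qed.

Lemma lamf_smooth f A : smooth f -> smooth_form_on A (lamf f).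
Proof.
move=> sf; split=> [z _|v]; first exact: lamf_linear.
apply: smooth_smooth_on; apply: smoothD; last exact: (smooth_grad sf).2.
exact: smoothN (smooth_dot_fst v.2).
Qed.

Lemma ext_d_lamf f z u v : smooth f -> ext_d (lamf f) z u v = omega z u v.
Proof.
move=> sf; have D a b : 'D_a (fun x => lamf f x b) z = - dot a.1 b.2 + 'D_a (fun x => 'D_b f x) z.
  by have [_ ->] := has_gradD (has_gradN (has_grad_dot_fst b.2 z))
    (has_grad_derive ((smooth_grad ((smooth_grad sf).2 b)).1 z)).
rewrite /ext_d !D (smooth_schwarz z u v sf) /omega (dotC u.2) (dotC v.2).
by move: ('D_v _ _) (dot _ _) (dot _ _) => *; ring.
Qed.

Lemma lamf_dot P z v : lamf (fun x : phase => dot P x.2) z v = - dot (z.1 - P) v.2.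
Proof. by rewrite /lamf (has_grad_dot_snd P z).2 dotBl opprB addrC. Qed.

Lemma smooth_step (u : phase -> R) : smooth u -> smooth (fun z => step (u z)).
Proof.
move=> su; apply: smoothM; last exact: smooth_cst.
apply: smooth_flat; apply: smoothD; first exact: smooth_cst.
apply: smoothN; apply: smooth_flat; apply: smoothD; first exact: smooth_cst.
exact: smoothN.
Qed.

End FormsFromFunctions.

(** * The interpolated primitive *)

Section Blend.
Context {R : realType}.
Local Notation phase := (phase R).
Variables (mu t A sig : R).
Let l := mu - t.

Definition gneck (z : phase) : R := (z.1 0 0 - l) + (z.2 0 1 - l) / A.
Definition phineck (z : phase) : R :=
  (1 + jneck A) * (z.1 0 0 - l) * z.2 0 0 + jneck A * z.1 0 1 * (z.2 0 1 - l).

(** For sig > 0 this is l p + phi where |g| <= sig, mu p = E . p where g >= 2 sig, and - (1 - mu) p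
    = M . p where g <= - 2 sig. *)
Definition blend (z : phase) : R :=
  l * z.2 0 0 + phineck z
  + step (sig^-1 * gneck z) * (t * z.2 0 0 - phineck z)
  + step (- sig^-1 * gneck z) * (- (1 - t) * z.2 0 0 - phineck z).

Definition dgneck (v : phase) : R := v.1 0 0 + v.2 0 1 / A.
Definition dphineck (z v : phase) : R :=
  (1 + jneck A) * ((z.1 0 0 - l) * v.2 0 0 + z.2 0 0 * v.1 0 0)
  + jneck A * (z.1 0 1 * v.2 0 1 + (z.2 0 1 - l) * v.1 0 1).

Lemma smooth_fst0 (k : 'I_2) : smooth (fun z : phase => z.1 0 k).
Proof.
apply: smooth_lin; first by move=> a x y; rewrite /= !mxE.
by move=> z; exact: has_grad_cont (vgrad_fst z k).
Qed.

Lemma smooth_snd0 (k : 'I_2) : smooth (fun z : phase => z.2 0 k).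
Proof.
apply: smooth_lin; first by move=> a x y; rewrite /= !mxE.
by move=> z; exact: has_grad_cont (vgrad_snd z k).
Qed.

Lemma smooth_blend : smooth blend.
Proof.
have sx := smoothD (smooth_fst0 0) (smooth_cst (- l)).
have ss := smoothD (smooth_snd0 1) (smooth_cst (- l)).
have sp := smooth_snd0 0; have sy := smooth_fst0 1.
have sg : smooth gneck by apply: smoothD sx (smoothM ss (smooth_cst A^-1)).
have sf : smooth phineck.
  by apply: smoothD (smoothM (smoothZ (1 + jneck A) sx) sp) (smoothM (smoothZ (jneck A) sy) ss).
apply: smoothD; first apply: smoothD; first apply: smoothD => //; first exact: smoothZ.
  apply: smoothM; first exact: smooth_step (smoothZ _ sg).
  exact: smoothD (smoothZ _ sp) (smoothN sf).
apply: smoothM; first exact: smooth_step (smoothZ _ sg).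
exact: smoothD (smoothZ _ sp) (smoothN sf).
Qed.

Lemma has_grad_blend z : has_grad blend z (fun v =>
  l * v.2 0 0 + dphineck z v
  + step (sig^-1 * gneck z) * (t * v.2 0 0 - dphineck z v)
  + dstep (sig^-1 * gneck z) * sig^-1 * dgneck v * (t * z.2 0 0 - phineck z)
  + step (- sig^-1 * gneck z) * (- (1 - t) * v.2 0 0 - dphineck z v)
  - dstep (- sig^-1 * gneck z) * sig^-1 * dgneck v * (- (1 - t) * z.2 0 0 - phineck z)).
Proof.
have g1 := vgrad_fst z; have g2 := vgrad_snd z.
have hx := has_gradB (g1 0) (has_grad_cst l z).
have hs := has_gradB (g2 1) (has_grad_cst l z).
have hg : has_grad gneck z dgneck.
  apply: (has_grad_eq (has_gradD hx (has_gradM hs (has_grad_cst A^-1 z)))) => v.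
  by rewrite /dgneck; ring.
have hf : has_grad phineck z (dphineck z).
  apply: (has_grad_eq (has_gradD
    (has_gradM (has_gradM (has_grad_cst (1 + jneck A) z) hx) (g2 0))
    (has_gradM (has_gradM (has_grad_cst (jneck A) z) (g1 1)) hs))) => v.
  by rewrite /dphineck; ring.
have hst k := has_grad_comp (has_gradM (has_grad_cst k z) hg) (is_derive_step (k * gneck z)).
have hb k := has_gradB (has_gradM (has_grad_cst k z) (g2 0)) hf.
apply: (has_grad_eq (has_gradD (has_gradD (has_gradD (has_gradM (has_grad_cst l z) (g2 0)) hf)
  (has_gradM (hst sig^-1) (hb t))) (has_gradM (hst (- sig^-1)) (hb (- (1 - t)))))) => v.
by rewrite /=; ring.
Qed.

(** [gd] is the derivative of g along X_H. The moon side is the earth side reflected through L1,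
    with 1 - t for t; [Q0] is even under this reflection. *)
Lemma lamf_blend (z : phase) (x := z.1 0 0 - l) (y := z.1 0 1) (p := z.2 0 0) (s := z.2 0 1 - l)
    (a1 := l - V1 mu z.1) (Aq := Acoef mu z.1) (gd := (1 - A^-1) * p + y * (1 - Aq / A))
    (j := jneck A) : A != 0 ->
  lamf blend z (gradp z, - gradq (1 - mu) (earth mu) mu (moon mu) z) =
  Q0 j x y p s a1 Aq
  + step (sig^-1 * gneck z) * (QE t x y p s a1 Aq - Q0 j x y p s a1 Aq)
  + dstep (sig^-1 * gneck z) / sig * (gd * (t * p - ((1 + j) * x * p + j * y * s)))
  + step (- sig^-1 * gneck z) * (QE (1 - t) (- x) (- y) (- p) (- s) (- a1) Aq - Q0 j x y p s a1 Aq)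
  + dstep (- sig^-1 * gneck z) / sig * (- gd * (- (1 - t) * p - ((1 + j) * x * p + j * y * s))).
Proof.
move=> A0; rewrite /lamf (has_grad_blend z).2 gradqE /gradp /dgneck /dphineck /= !dot2E.
rewrite /phineck ![(- vec2 _ _) 0 _]mxE ![(_ + vec2 _ _) 0 _]mxE !vec20 !vec21.
rewrite /Q0 /QE /gd /x /y /p /s /a1 /Aq /j.
move: (step _) (step _) (dstep _) (dstep _) (jneck A) (V1 _ _) (Acoef _ _) => *.
move: sig^-1 => *.
by field.
Qed.

End Blend.

Section NeckContact.
Context {R : realType}.
Implicit Types A d K C kap sig eps t x y p s : R.

Lemma neck_energyN A kap eps x y p s : neck_energy A kap eps x y p s ->
  neck_energy A kap eps (- x) (- y) (- p) (- s).
Proof. by rewrite /neck_energy -!opprD !sqrrN. Qed.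

Lemma Q0N j x y p s a1 Aq : Q0 j (- x) (- y) (- p) (- s) (- a1) Aq = Q0 j x y p s a1 Aq.
Proof. by rewrite /Q0; ring. Qed.

(** At most one of the two cut-offs is active. Where neither is, [Q0_ge] decides; otherwise
    [neck_blend] does, on the moon side after reflection through L1. *)
Lemma neck_contact A t CA : 1 < A -> 0 < t < 1 -> 0 < CA ->
  exists2 kap, 0 < kap & exists2 sig0, 0 < sig0 &
  forall sig eps x y p s (a1 Aq : R), 0 < sig <= sig0 -> 0 <= eps <= sig ^+ 2 / 8 ->
  `|Aq - A| <= kap -> `|Aq - A| <= CA * (`|x| + `|y|) ->
  `|a1 - 2 * A * x| <= kap * (`|x| + `|y|) -> neck_energy A kap eps x y p s ->
  0 < Nsq x y p s -> `|x + s / A| <= 2 * sig ->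
  let j := jneck A in let gd := (1 - A^-1) * p + y * (1 - Aq / A) in let g := x + s / A in
  0 < Q0 j x y p s a1 Aq
  + step (sig^-1 * g) * (QE t x y p s a1 Aq - Q0 j x y p s a1 Aq)
  + dstep (sig^-1 * g) / sig * (gd * (t * p - ((1 + j) * x * p + j * y * s)))
  + step (- sig^-1 * g) * (QE (1 - t) (- x) (- y) (- p) (- s) (- a1) Aq - Q0 j x y p s a1 Aq)
  + dstep (- sig^-1 * g) / sig * (- gd * (- (1 - t) * p - ((1 + j) * x * p + j * y * s))).
Proof.
move=> A1 /andP[t0 t1] CA0; have t1' : 0 < 1 - t by rewrite subr_gt0.
have [K K0 HK] := @dstep_bound R.
have [k1 k10 [s1 s10 H1]] := neck_blend A1 t0 CA0 K0.
have [k2 k20 [s2 s20 H2]] := neck_blend A1 t1' CA0 K0.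
have /andP[j0 _] := jneck_bounds A1.
exists (Num.min (jneck A / 8) (Num.min k1 k2)); first by rewrite !lt_min k10 k20 divr_gt0.
exists (Num.min s1 s2); first by rewrite lt_min s10.
move=> sig eps x y p s a1 Aq; set kap := Num.min (jneck A / 8) _.
have kj : kap <= jneck A / 8 by rewrite /kap !ge_min lexx.
have kk1 : kap <= k1 by rewrite /kap !ge_min lexx orbT.
have kk2 : kap <= k2 by rewrite /kap !ge_min lexx !orbT.
have kap0 : 0 <= kap by rewrite /kap !le_min !ltW // divr_gt0.
clearbody kap; move=> /andP[sg0]; rewrite le_min => /andP[ss1 ss2] he hA hA' ha E N0 gs; lazy zeta.
set j := jneck A; set gd := (1 - A^-1) * p + y * (1 - Aq / A); set g := x + s / A.
have xy0 : 0 <= `|x| + `|y| by rewrite addr_ge0.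
have Ep := HK (sig^-1 * g); have En := HK (- sig^-1 * g).
have sV (u : R) : 0 <= dstep u <= K -> 0 <= dstep u / sig <= K / sig.
  by move=> /andP[u0 u1]; rewrite divr_ge0 ?(ltW sg0) //= ler_pM2r ?invr_gt0.
have gN : - g = - x + - s / A by rewrite /g; ring.
have [gl|gl] := leP `|g| sig.
  have [-> ->] : step (sig^-1 * g) = 0 /\ dstep (sig^-1 * g) = 0.
    by apply: step_le1; rewrite mulrC ler_pdivrMr // mul1r (le_trans (ler_norm _)).
  have [-> ->] : step (- sig^-1 * g) = 0 /\ dstep (- sig^-1 * g) = 0.
    apply: step_le1; rewrite mulNr -mulrN mulrC ler_pdivrMr // mul1r.
    by rewrite (le_trans (ler_norm _)) // normrN.
  rewrite !mul0r !addr0; have kk : 0 <= kap <= jneck A / 8 by rewrite kap0.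
  apply: lt_le_trans (Q0_ge p s A1 kk hA ha).
  by rewrite mulr_gt0 // divr_gt0.
have [g0|g0] := leP 0 g.
  rewrite (ger0_norm g0) in gl; rewrite -/g (ger0_norm g0) in gs.
  have [-> ->] : step (- sig^-1 * g) = 0 /\ dstep (- sig^-1 * g) = 0.
    apply: step_le1; rewrite mulNr; apply: (@le_trans _ _ 0) => //.
    by rewrite oppr_le0 mulr_ge0 // invr_ge0 ltW.
  have h := H1 sig eps x y p s a1 Aq (step (sig^-1 * g)) (dstep (sig^-1 * g) / sig).
  have {}h : 0 < _ := h _ he (le_trans hA kk1) hA' _ (neck_energy_mono kk1 E) _ (step_01 _) (sV _ Ep).
  rewrite !mul0r !addr0.
  apply: lt_le_trans (h _ _ _) _; first by rewrite sg0.
  - by apply: le_trans ha _; rewrite ler_wpM2r.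
  - by rewrite ltW.
  by rewrite -/j -/gd le_eqVlt; apply/orP; left; apply/eqP; ring.
rewrite (ltr0_norm g0) in gl; rewrite -/g (ltr0_norm g0) in gs.
have [-> ->] : step (sig^-1 * g) = 0 /\ dstep (sig^-1 * g) = 0.
  apply: step_le1; apply: (@le_trans _ _ 0) => //.
  by apply: mulr_ge0_le0; rewrite ?invr_ge0 ltW.
have h := H2 sig eps (- x) (- y) (- p) (- s) (- a1) Aq (step (- sig^-1 * g)) (dstep (- sig^-1 * g) / sig).
rewrite !normrN -gN in h.
have {}h : 0 < _ := h _ he (le_trans hA kk2) hA' _ (neck_energy_mono kk2 (neck_energyN E)) _ (step_01 _) (sV _ En).
rewrite !mul0r !addr0.
apply: lt_le_trans (h _ _ _) _; first by rewrite sg0.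
- have -> : - a1 - 2 * A * - x = - (a1 - 2 * A * x) by ring.
  by rewrite normrN; apply: le_trans ha _; rewrite ler_wpM2r.
- by rewrite ltW.
by rewrite Q0N -/j /gd le_eqVlt; apply/orP; left; apply/eqP; ring.
Qed.

End NeckContact.

(** * The two sides of the neck *)

Section NeckScalars.
Context {R : realType}.
Implicit Types C d r eps x y p s : R.

Lemma Nsq_ge x y p s : x ^+ 2 + y ^+ 2 <= Nsq x y p s.
Proof. by rewrite /Nsq -addrA lerDl addr_ge0 ?sqr_ge0. Qed.

(** The bounds give x^2 + y^2 <= 2 C x^2 < 2 d x, which says that (x, y) lies in the disc of radius
    d centred at (d, 0). *)
Lemma side_in_disc C d x y p s eps : Nsq x y p s <= C * (x ^+ 2 + eps) -> 0 < C ->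
  eps <= x ^+ 2 -> 0 < x -> C * x < d -> (x - d) ^+ 2 + y ^+ 2 < d ^+ 2.
Proof.
move=> hN C0 e x0 Cx; have h := Nsq_ge x y p s.
have h1 : C * (x ^+ 2 + eps) <= C * (x ^+ 2 + x ^+ 2) by rewrite ler_pM2l // lerD2l.
have h2 : 0 < x * (d - C * x) by rewrite mulr_gt0 // subr_gt0.
have -> : (x - d) ^+ 2 + y ^+ 2 = x ^+ 2 + y ^+ 2 - 2 * (d * x) + d ^+ 2 by ring.
have E1 : C * (x ^+ 2 + x ^+ 2) = 2 * (x * (C * x)) by ring.
have E2 : x * (d - C * x) = d * x - x * (C * x) by ring.
rewrite E1 in h1; rewrite E2 in h2.
move: h h1 h2 hN; move: (x * (C * x)) (d * x) (Nsq _ _ _ _) (C * (_ + _)) (x ^+ 2 + y ^+ 2) (d ^+ 2) => *; lra.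
Qed.

(** As x^2 + eps controls x^2 + y^2 and eps is small against r^2, a point at distance r / 2 from l1
    has |x| bounded below. The denominator 8 C + 1 is used through 8 C <= (8 C + 1)^2. *)
Lemma side_far C r x y p s eps : Nsq x y p s <= C * (x ^+ 2 + eps) -> 0 < C -> 0 < r ->
  r ^+ 2 / 4 <= x ^+ 2 + y ^+ 2 -> eps <= r ^+ 2 / (8 * C) ->
  (r / (8 * C + 1)) ^+ 2 <= x ^+ 2 /\ eps <= x ^+ 2.
Proof.
move=> hN C0 r0 hr he; have h := le_trans hr (le_trans (Nsq_ge x y p s) hN).
have h1 : r ^+ 2 / (8 * C) <= x ^+ 2.
  have : r ^+ 2 / 4 / C <= x ^+ 2 + eps by rewrite ler_pdivrMr // (mulrC (_ + _)).
  have -> : r ^+ 2 / 4 / C = r ^+ 2 / (8 * C) + r ^+ 2 / (8 * C) by field; rewrite gt_eqF.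
  by lra.
split; last exact: le_trans h1.
apply: le_trans h1; rewrite expr_div_n ler_pM2l ?exprn_gt0 //.
have c8 : 0 < 8 * C by rewrite mulr_gt0.
rewrite lef_pV2 ?posrE ?exprn_gt0 ?addr_gt0 //.
by move: (8 * C) c8 => k k0; have := sqr_ge0 k; rewrite sqrrD expr1n mulr1 mulr2n; lra.
Qed.

End NeckScalars.

Section NeckGeometry.
Context {R : realType}.
Local Notation phase := (phase R).
Variables (mu t : R).
Hypothesis mu01 : 0 < mu < 1.
Let l := mu - t.
Let ell : 'rV[R]_2 := vec2 l 0.
Let A := Acoef mu ell.
Let X (z : phase) : phase := (gradp z, - gradq (1 - mu) (earth mu) mu (moon mu) z).

Lemma star_neck (m a : R) (e P P' : 'rV[R]_2) : primary mu m e P P' -> 0 < a < 1 ->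
  ell = (a - (1 - m)) *: e ->
  exists2 k, 0 < k & forall c z, Sigma mu c z -> enorm (z.1 - P) <= a ->
    c < Upot mu ell + k * enorm (z.1 - ell) ^+ 2 ->
    0 < dot (z.1 - P) (gradq (1 - mu) (earth mu) mu (moon mu) z) /\ enorm (z.1 - P) < a.
Proof.
move=> pr a01 elE.
have [k k0 H] := star_shaped (primary_mass mu01 pr) a01 (primary_unit pr).
exists k => // c z /(SigmaE pr)[zP zP' Hz] za hc.
have := H z; rewrite -(primaryE pr).1 -(primaryE pr).2 -elE Hz -(primary_Upot pr) -enormX2.
move=> /(_ zP za hc); congr (0 < dot _ _ /\ _).
case: pr => -[-> _ -> ->] /=; first by congr gradq; ring.
by rewrite /gradq [_ *: _ + _ *: _]addrC.
Qed.

Lemma ellE : ell = (t - (1 - (1 - mu))) *: vec2 (-1) 0 /\ ell = ((1 - t) - (1 - mu)) *: vec2 1 0.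
Proof. by split; apply: rV2P; rewrite [RHS]mxE ?vec20 ?vec21 /l; ring. Qed.

Lemma dist_coords (z : phase) (x := z.1 0 0 - l) (y := z.1 0 1) :
  [/\ enorm (z.1 - ell) ^+ 2 = x ^+ 2 + y ^+ 2,
      enorm (z.1 - earth mu) ^+ 2 = (x - t) ^+ 2 + y ^+ 2 &
      enorm (z.1 - moon mu) ^+ 2 = (- x - (1 - t)) ^+ 2 + (- y) ^+ 2].
Proof.
by rewrite !enormX2 !dot2E !mxE /= /x /y /l; split; ring.
Qed.

Lemma lamf_dotX (P : 'rV[R]_2) z : lamf (fun x : phase => dot P x.2) z (X z) =
  dot (z.1 - P) (gradq (1 - mu) (earth mu) mu (moon mu) z).
Proof. by rewrite lamf_dot /= dotNr opprK. Qed.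

Lemma lamf_blend_earth (sig : R) z v : 0 < sig -> 2 * sig <= gneck mu t A z ->
  lamf (blend mu t A sig) z v = lamf (fun x : phase => dot (earth mu) x.2) z v.
Proof.
move=> s0 hg; rewrite /lamf (has_grad_blend mu t A sig z).2 (has_grad_dot_snd _ z).2; congr (_ + _).
have [-> ->] : step (sig^-1 * gneck mu t A z) = 1 /\ dstep (sig^-1 * gneck mu t A z) = 0.
  by apply: step_ge2; rewrite mulrC ler_pdivlMr.
have [-> ->] : step (- sig^-1 * gneck mu t A z) = 0 /\ dstep (- sig^-1 * gneck mu t A z) = 0.
  apply: step_le1; rewrite mulNr; apply: (@le_trans _ _ 0) => //.
  by rewrite oppr_le0 mulr_ge0 ?invr_ge0 ?(ltW s0) // (le_trans _ hg) // mulr_ge0 // ltW.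
by rewrite dot2E vec20 vec21; ring.
Qed.

Lemma lamf_blend_moon (sig : R) z v : 0 < sig -> 2 * sig <= - gneck mu t A z ->
  lamf (blend mu t A sig) z v = lamf (fun x : phase => dot (moon mu) x.2) z v.
Proof.
move=> s0 hg; rewrite /lamf (has_grad_blend mu t A sig z).2 (has_grad_dot_snd _ z).2; congr (_ + _).
have [-> ->] : step (- sig^-1 * gneck mu t A z) = 1 /\ dstep (- sig^-1 * gneck mu t A z) = 0.
  by apply: step_ge2; rewrite mulNr -mulrN mulrC ler_pdivlMr.
have [-> ->] : step (sig^-1 * gneck mu t A z) = 0 /\ dstep (sig^-1 * gneck mu t A z) = 0.
  apply: step_le1; apply: (@le_trans _ _ 0) => //.
  by rewrite pmulr_rle0 ?invr_gt0 // -oppr_ge0 (le_trans _ hg) // mulr_ge0 // ltW.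
by rewrite dot2E vec20 vec21; ring.
Qed.

End NeckGeometry.

(* Here n = |q - ell|.  Within n < r the form is built from [blend]; it agrees
   with those of the two discs on r / 2 < n < r. *)
Lemma neck_setup (R : realType) (mu t : R) (l := mu - t) (ell : 'rV[R]_2 := vec2 l 0) (A := Acoef mu ell) :
  0 < mu < 1 -> 0 < t < 1 -> gradU mu ell = 0 -> exists r sig eps0 : R, [/\ 0 < r, 0 < sig, 0 < eps0,
    r <= t / 2 & r <= (1 - t) / 2] /\
  forall c, Upot mu ell < c < Upot mu ell + eps0 -> [/\
    forall z, Sigma mu c z -> enorm (z.1 - earth mu) <= t -> r <= enorm (z.1 - ell) ->
      0 < dot (z.1 - earth mu) (gradq (1 - mu) (earth mu) mu (moon mu) z) /\
      enorm (z.1 - earth mu) < t,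
    forall z, Sigma mu c z -> enorm (z.1 - moon mu) <= 1 - t -> r <= enorm (z.1 - ell) ->
      0 < dot (z.1 - moon mu) (gradq (1 - mu) (earth mu) mu (moon mu) z) /\
      enorm (z.1 - moon mu) < 1 - t,
    forall z, Sigma mu c z -> enorm (z.1 - ell) < r ->
      0 < lamf (blend mu t A sig) z (gradp z, - gradq (1 - mu) (earth mu) mu (moon mu) z),
    forall z, Sigma mu c z -> enorm (z.1 - ell) = r ->
      enorm (z.1 - earth mu) < t \/ enorm (z.1 - moon mu) < 1 - t &
    forall z, Sigma mu c z -> r / 2 < enorm (z.1 - ell) < r ->
      (l < z.1 0 0 -> 2 * sig <= gneck mu t A z) /\
      (z.1 0 0 < l -> 2 * sig <= - gneck mu t A z)].
Proof.
move=> mu01 t01 crit.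
have A1 : 1 < A := A_gt1 mu01 t01.
have A0 : A != 0 by rewrite gt_eqF // (lt_trans ltr01).
have [CA CA0 tay] := neck_taylor t01 crit.
have [kap1 kap10 [sig0 sig00 HC]] := neck_contact A1 t01 CA0.
have [C C0 HN] := neck_size A1.
have [kg kg0 Hg] := neck_g_ge A1.
have /andP[t0 t1] := t01; have t1' : 0 < 1 - t by rewrite subr_gt0.
have t1'' : 0 < 1 - t < 1 by rewrite t1' gtrBl.
have [kE kE0 HE] := star_neck mu01 (primary_earth mu) t01 (ellE mu t).1.
have [kM kM0 HM] := star_neck mu01 (primary_moon mu) t1'' (ellE mu t).2.
have A2 : 0 < (A - 1) / 2 by rewrite divr_gt0 // subr_gt0.
have A3 : 0 < A ^+ 2 / 2 by rewrite divr_gt0 // exprn_gt0 // (lt_trans ltr01).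
have [kap [kap0 ka kb kc kd]] : exists kap, [/\ 0 < kap, kap <= kap1, kap <= (A - 1) / 2, kap <= 1 & kap <= A ^+ 2 / 2].
  exists (Num.min (Num.min kap1 ((A - 1) / 2)) (Num.min 1 (A ^+ 2 / 2))).
  by split; rewrite ?lt_min ?kap10 ?A2 ?A3 ?ltr01 // !ge_min lexx ?orbT.
have kap40 : 0 < kap / 4 by rewrite divr_gt0.
have [r0 r00 {}tay] := tay _ kap40.
have tay2 h : enorm h < r0 -> [/\ ell + h != earth mu, ell + h != moon mu,
    `|Acoef mu (ell + h) - A| <= kap / 4 &
    `|l - V1 mu (ell + h) - 2 * A * h 0 0| <= kap / 4 * (`|h 0 0| + `|h 0 1|)].
  by move=> /tay[h1 h2 _ h3 h4].
have facts c z : Sigma mu c z -> enorm (z.1 - ell) < r0 ->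
    let x := z.1 0 0 - l in let y := z.1 0 1 in
    [/\ neck_energy A kap (c - Upot mu ell) x y (z.2 0 0) (z.2 0 1 - l),
      `|Acoef mu z.1 - A| <= kap, `|Acoef mu z.1 - A| <= CA * (`|x| + `|y|) &
      `|(l - V1 mu z.1) - 2 * A * x| <= kap * (`|x| + `|y|)].
  move=> Sz zr /=; have := neck_energy_Sigma kap40 tay2 Sz zr.
  have -> : 4 * (kap / 4) = kap by field.
  have := tay _ zr; rewrite (addrC ell (z.1 - ell)) subrK ![(z.1 - ell) 0 _]mxE ![(- ell) 0 _]mxE vec20 vec21 subr0.
  move=> [_ _ h1 h2 h3] E; split => //.
    by apply: le_trans h2 _; clear - kap0; lra.
  by apply: le_trans h3 _; rewrite ler_wpM2r ?addr_ge0 //; clear - kap0; lra.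
(* The last two conditions are those of [side_in_disc] for the two discs; t / 2 and (1 - t) / 2 keep
   the neck away from the primaries. *)
have [r [rp rr0 rt rt' [rC rC']]] : exists r, [/\ 0 < r, r <= r0 / 2, r <= t / 2, r <= (1 - t) / 2 &
    C * r < t /\ C * r < 1 - t].
  exists (Num.min (r0 / 2) (Num.min (Num.min (t / 2) ((1 - t) / 2))
    (Num.min (t / (2 * C)) ((1 - t) / (2 * C))))).
  have c2 : 0 < 2 * C by rewrite mulr_gt0.
  split; rewrite ?lt_min ?divr_gt0 //; try by rewrite !ge_min lexx ?orbT.
  have h a : 0 < a -> C * (a / (2 * C)) < a.
    move=> a0; have -> : C * (a / (2 * C)) = a / 2 by field; rewrite gt_eqF.
    by clear - a0; lra.
  by split; [apply: le_lt_trans (h _ t0)|apply: le_lt_trans (h _ t1')];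
    rewrite ler_pM2l // !ge_min lexx ?orbT.
have C8 : 0 < 8 * C + 1 by rewrite addr_gt0 // mulr_gt0.
(* By [side_far] the level has |x| >= rho where |q - ell| >= r / 2, and there [neck_g_ge] bounds |g|
   below by kg rho. Taking 2 sig <= kg rho makes the cut-off constant on the collar. *)
pose rho := r / (8 * C + 1); have rho0 : 0 < rho by rewrite divr_gt0.
have [sig [sg0 sg1 sg2]] : exists sig, [/\ 0 < sig, sig <= sig0 & 2 * sig <= kg * rho].
  exists (Num.min sig0 (kg * rho / 2)).
  have q : 0 < kg * rho / 2 by apply: divr_gt0 => //; apply: mulr_gt0.
  split; [by rewrite lt_min sig00 q|by rewrite ge_min lexx|].
  by rewrite mulrC -ler_pdivlMr // ge_min lexx orbT.
(* In the order of the list: smallness against the squared width of the cut-off, star-shapedness in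
   the neck where |x| >= sig / 4, star-shapedness where |q - ell| >= r, and the hypothesis of
   [side_far]. *)
have [eps0 [e0 e1 [e2 e2'] [e3 e3'] e4]] : exists eps0, [/\ 0 < eps0, eps0 <= sig ^+ 2 / 16,
    eps0 <= kE * (sig ^+ 2 / 16) /\ eps0 <= kM * (sig ^+ 2 / 16),
    eps0 <= kE * r ^+ 2 /\ eps0 <= kM * r ^+ 2 & eps0 <= r ^+ 2 / (8 * C)].
  exists (Num.min (sig ^+ 2 / 16) (Num.min (Num.min (kE * (sig ^+ 2 / 16)) (kM * (sig ^+ 2 / 16)))
    (Num.min (Num.min (kE * r ^+ 2) (kM * r ^+ 2)) (r ^+ 2 / (8 * C))))).
  split; last by rewrite !ge_min lexx !orbT.
  - by rewrite !lt_min ?divr_gt0 ?mulr_gt0 ?divr_gt0 ?exprn_gt0.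
  - by rewrite !ge_min lexx.
  - by split; rewrite !ge_min lexx !orbT.
  - by split; rewrite !ge_min lexx !orbT.
exists r, sig, eps0; split => // c /andP[c0 c1].
have rlt : r < r0 by clear - rr0 r00; lra.
have rh : r / 2 < r by clear - rp; lra.
have ec : c - Upot mu ell < eps0 by rewrite ltrBlDl.
have ec0 : 0 < c - Upot mu ell by rewrite subr_gt0.
pose eps := c - Upot mu ell; have epsE : c = Upot mu ell + eps by rewrite /eps; ring.
rewrite -/eps in ec ec0.
have SE z : Sigma mu c z -> enorm (z.1 - earth mu) <= t -> eps < kE * enorm (z.1 - ell) ^+ 2 ->
    0 < dot (z.1 - earth mu) (gradq (1 - mu) (earth mu) mu (moon mu) z) /\
    enorm (z.1 - earth mu) < t.
  by move=> Sz zt h; apply: HE Sz zt _; rewrite epsE ltrD2l.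
have SM z : Sigma mu c z -> enorm (z.1 - moon mu) <= 1 - t -> eps < kM * enorm (z.1 - ell) ^+ 2 ->
    0 < dot (z.1 - moon mu) (gradq (1 - mu) (earth mu) mu (moon mu) z) /\
    enorm (z.1 - moon mu) < 1 - t.
  by move=> Sz zt h; apply: HM Sz zt _; rewrite epsE ltrD2l.
have size z : Sigma mu c z -> enorm (z.1 - ell) < r0 ->
    Nsq (z.1 0 0 - l) (z.1 0 1) (z.2 0 0) (z.2 0 1 - l) <= C * ((z.1 0 0 - l) ^+ 2 + eps).
  by move=> Sz zr; have [E _ _ _] := facts _ _ Sz zr; exact: HN kb kc (ltW ec0) E.
have discE z : Sigma mu c z -> enorm (z.1 - ell) <= r -> eps <= (z.1 0 0 - l) ^+ 2 ->
    0 < z.1 0 0 - l -> enorm (z.1 - earth mu) < t.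
  move=> Sz zr ex x0; apply: lt_of_sqr; first exact: ltW.
  have [_ -> _] := dist_coords mu t z.
  apply: (side_in_disc (size _ Sz _) C0 ex x0); first exact: le_lt_trans rlt.
  apply: le_lt_trans rC; rewrite ler_pM2l // (le_trans _ zr) //.
  apply: le_of_sqr; first exact: enorm_ge0.
  by have [-> _ _] := dist_coords mu t z; rewrite lerDl sqr_ge0.
have discM z : Sigma mu c z -> enorm (z.1 - ell) <= r -> eps <= (z.1 0 0 - l) ^+ 2 ->
    z.1 0 0 - l < 0 -> enorm (z.1 - moon mu) < 1 - t.
  move=> Sz zr ex x0; apply: lt_of_sqr; first exact: ltW.
  have [_ _ ->] := dist_coords mu t z.
  have h := size _ Sz.
  apply: (@side_in_disc _ C (1 - t) (- (z.1 0 0 - l)) (- z.1 0 1) (- z.2 0 0) (- (z.2 0 1 - l)) eps) => //.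
  - by rewrite /Nsq !sqrrN; apply: h; exact: le_lt_trans rlt.
  - by rewrite sqrrN.
  - by rewrite oppr_gt0.
  apply: le_lt_trans rC'; rewrite ler_pM2l // (le_trans _ zr) //.
  apply: le_of_sqr; first exact: enorm_ge0.
  by have [-> _ _] := dist_coords mu t z; rewrite sqrrN lerDl sqr_ge0.
have far z : Sigma mu c z -> r / 2 <= enorm (z.1 - ell) -> enorm (z.1 - ell) < r0 ->
    rho ^+ 2 <= (z.1 0 0 - l) ^+ 2 /\ eps <= (z.1 0 0 - l) ^+ 2.
  move=> Sz h1 h2; apply: (side_far (size _ Sz h2) C0 rp); last exact: ltW (lt_le_trans ec e4).
  have [<- _ _] := dist_coords mu t z.
  have -> : r ^+ 2 / 4 = (r / 2) ^+ 2 by field.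
  by rewrite lerXn2r // nnegrE ?enorm_ge0 // divr_ge0 // ltW.
have [eps_eta eps8 eps16] : [/\ 2 * eps <= sig ^+ 2, eps <= sig ^+ 2 / 8 & eps <= sig ^+ 2 / 16].
  have h := lt_le_trans ec e1; have h' := sqr_ge0 sig.
  by clear - h h'; split; lra.
split.
- move=> z Sz zt zr; apply: SE => //; apply: lt_le_trans ec (le_trans e3 _).
  by rewrite ler_pM2l // lerXn2r // nnegrE ?enorm_ge0 // ltW.
- move=> z Sz zt zr; apply: SM => //; apply: lt_le_trans ec (le_trans e3' _).
  by rewrite ler_pM2l // lerXn2r // nnegrE ?enorm_ge0 // ltW.
- move=> z Sz zr; have zr0 : enorm (z.1 - ell) < r0 by exact: lt_trans rlt.
  have [E hA hA' ha] := facts _ _ Sz zr0.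
  have eta := eps_eta.
  have s2 : 0 < 2 * sig by rewrite mulr_gt0.
  have s22 : sig <= 2 * sig / 2 by clear; lra.
  (* Beyond 2 sig the form is already radial, and |x| >= sig / 4 is far enough from l1 for
     [star_neck] at this energy. *)
  have [gl|gl] := leP `|gneck mu t A z| (2 * sig).
    rewrite lamf_blend //; apply: (HC sig eps) => //.
    + by rewrite sg0.
    + by rewrite ltW.
    + exact: le_trans ka.
    + by apply: le_trans ha _; rewrite ler_wpM2r // addr_ge0.
    + exact: neck_energy_mono ka E.
    (* [Nsq] vanishes only at L1, whose energy is less than c. *)
    rewrite lt_neqAle eq_sym /Nsq !addr_ge0 ?sqr_ge0 // andbT; apply: contraTneq ec0.
    move=> /eqP; rewrite !paddr_eq0 ?addr_ge0 ?sqr_ge0 // !sqrf_eq0 !subr_eq0.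
    move=> /andP[/andP[/andP[/eqP x0 /eqP y0] /eqP p0] /eqP s0].
    rewrite -leNgt /eps subr_le0.
    have zl : z.1 = ell by apply: rV2P; rewrite ?vec20 ?vec21.
    have [_ _ <-] := Sz; rewrite Ham_Upot /gradp ![(_ + vec2 _ _) 0 _]mxE vec20 vec21 x0 y0 p0 s0 zl.
    by rewrite subrr addr0 expr0n addr0 mulr0 add0r.
  have s0 := ltW sg0.
  have [g0|g0] := leP 0 (gneck mu t A z).
    rewrite (ger0_norm g0) in gl.
    have x8 := neck_g_pos A1 s2 kb kd s0 eta E s22 (ltW gl).
    have x0 : 0 < z.1 0 0 - l by clear - x8 sg0; lra.
    have x2 : sig ^+ 2 / 16 <= (z.1 0 0 - l) ^+ 2.
      have -> : sig ^+ 2 / 16 = (2 * sig / 8) ^+ 2 by field.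
      by rewrite lerXn2r // nnegrE; clear - x8 sg0; lra.
    rewrite (lamf_blend_earth _ sg0 (ltW gl)) lamf_dotX.
    apply: (SE _ Sz _ _).1.
      by apply/ltW/discE => //; [exact: ltW|exact: le_trans eps16 x2].
    apply: lt_le_trans ec (le_trans e2 _); rewrite ler_pM2l //.
    by apply: le_trans x2 _; have [-> _ _] := dist_coords mu t z; rewrite lerDl sqr_ge0.
  rewrite (ltr0_norm g0) in gl.
  have gN : - gneck mu t A z = - (z.1 0 0 - l) + (- (z.2 0 1 - l)) / A by rewrite /gneck -/l; ring.
  have gl' := ltW gl; rewrite gN in gl'.
  have x8 := neck_g_pos A1 s2 kb kd s0 eta (neck_energyN E) s22 gl'.
  have x0 : z.1 0 0 - l < 0 by clear - x8 sg0; lra.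
  have x2 : sig ^+ 2 / 16 <= (z.1 0 0 - l) ^+ 2.
    have -> : sig ^+ 2 / 16 = (2 * sig / 8) ^+ 2 by field.
    by rewrite -[leRHS]sqrrN lerXn2r // nnegrE; clear - x8 sg0; lra.
  rewrite (lamf_blend_moon _ sg0 (ltW gl)) lamf_dotX.
  apply: (SM _ Sz _ _).1.
    by apply/ltW/discM => //; [exact: ltW|exact: le_trans eps16 x2].
  apply: lt_le_trans ec (le_trans e2' _); rewrite ler_pM2l //.
  by apply: le_trans x2 _; have [-> _ _] := dist_coords mu t z; rewrite lerDl sqr_ge0.
- move=> z Sz zr.
  have [h1 h2] : rho ^+ 2 <= (z.1 0 0 - l) ^+ 2 /\ eps <= (z.1 0 0 - l) ^+ 2.
    by apply: far => //; rewrite zr // ltW.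
  have [x0|x0|x0] := ltrgtP 0 (z.1 0 0 - l).
  + by left; apply: discE => //; rewrite zr.
  + by right; apply: discM => //; rewrite zr.
  + by move: h1; rewrite -x0 expr0n /= leNgt exprn_gt0.
- move=> z Sz /andP[zr1 zr2].
  have zr0 : enorm (z.1 - ell) < r0 by exact: lt_trans rlt.
  have [h1 h2] := far _ Sz (ltW zr1) zr0.
  have [E _ _ _] := facts _ _ Sz zr0.
  have eta := eps_eta.
  have sgk : sig <= kg * rho by clear - sg2 sg0; lra.
  split=> zl.
    have x0 : 0 < z.1 0 0 - l by rewrite subr_gt0.
    have xr : rho <= z.1 0 0 - l by apply: le_of_sqr => //; exact: ltW.
    have kx : kg * rho <= kg * (z.1 0 0 - l) by rewrite ler_pM2l.
    apply: le_trans sg2 (le_trans kx _).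
    by apply: (Hg _ _ _ _ _ _ _ kb kd (ltW sg0) eta E x0); exact: le_trans sgk kx.
  have x0 : 0 < - (z.1 0 0 - l) by rewrite oppr_gt0 subr_lt0.
  have xr : rho <= - (z.1 0 0 - l) by apply: le_of_sqr; rewrite ?sqrrN // ltW.
  have kx : kg * rho <= kg * - (z.1 0 0 - l) by rewrite ler_pM2l.
  apply: le_trans sg2 (le_trans kx _).
  have -> : - gneck mu t A z = - (z.1 0 0 - l) + (- (z.2 0 1 - l)) / A by rewrite /gneck -/l; ring.
  by apply: (Hg _ _ _ _ _ _ _ kb kd (ltW sg0) eta (neck_energyN E) x0); exact: le_trans sgk kx.
Qed.

(** * Energies above the critical value *)

Section Above.
Context {R : realType}.
Local Notation phase := (phase R).
Variables (mu t c r sig : R).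
Hypotheses (mu01 : 0 < mu < 1) (t01 : 0 < t < 1) (r0 : 0 < r) (sig0 : 0 < sig).
Hypotheses (rt : r <= t / 2) (rt' : r <= (1 - t) / 2).
Let l := mu - t.
Let ell : 'rV[R]_2 := vec2 l 0.
Let A := Acoef mu ell.
Let X (z : phase) : phase := (gradp z, - gradq (1 - mu) (earth mu) mu (moon mu) z).
Let S := Sigma_EM mu c.

Hypothesis starE : forall z, Sigma mu c z -> enorm (z.1 - earth mu) <= t ->
  r <= enorm (z.1 - ell) ->
  0 < dot (z.1 - earth mu) (gradq (1 - mu) (earth mu) mu (moon mu) z) /\
  enorm (z.1 - earth mu) < t.
Hypothesis starM : forall z, Sigma mu c z -> enorm (z.1 - moon mu) <= 1 - t ->
  r <= enorm (z.1 - ell) ->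
  0 < dot (z.1 - moon mu) (gradq (1 - mu) (earth mu) mu (moon mu) z) /\
  enorm (z.1 - moon mu) < 1 - t.
Hypothesis blend_gt0 : forall z, Sigma mu c z -> enorm (z.1 - ell) < r ->
  0 < lamf (blend mu t A sig) z (X z).
Hypothesis rim : forall z, Sigma mu c z -> enorm (z.1 - ell) = r ->
  enorm (z.1 - earth mu) < t \/ enorm (z.1 - moon mu) < 1 - t.
Hypothesis collar : forall z, Sigma mu c z -> r / 2 < enorm (z.1 - ell) < r ->
  (l < z.1 0 0 -> 2 * sig <= gneck mu t A z) /\
  (z.1 0 0 < l -> 2 * sig <= - gneck mu t A z).

Definition disc (P : 'rV[R]_2) (a : R) : set 'rV[R]_2 := [set q | enorm (q - P) < a].

(** The component cannot leave the union of the three discs: outside the neck disc [starE] and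
    [starM] keep it off the circles around the primaries, and [rim] puts its points on the edge of
    the neck into one of the two large discs. *)
Lemma above_inside (q : 'rV[R]_2) : Hill_part mu c [set earth mu; moon mu] q ->
  [\/ enorm (q - earth mu) < t, enorm (q - moon mu) < 1 - t | enorm (q - ell) < r].
Proof.
move=> [Hq _ cl]; set C := connected_component _ _ in cl.
pose W := disc (earth mu) t `|` disc (moon mu) (1 - t) `|` disc ell r.
have CW : C `<=` W.
  apply: connected_sub_open; first exact: component_connected.
  - by apply: openU; [apply: openU|]; exact: open_disc.
  - have /andP[t0 t1] := t01.
    have nE : nbhs (earth mu) (disc (earth mu) t).
      apply: open_nbhs_nbhs; split; first exact: open_disc.
      by rewrite /disc /= subrr /enorm dot0l sqrtr0.
    have [x [Cx dx]] := cl (earth mu) (or_introl erefl) _ nE.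
    by exists x; split => //; left; left.
  - move=> x [Cx clx].
    have [z Sz zx] := connected_component_sub Cx.
    have [nr|rn] := ltP (enorm (x - ell)) r; first by right.
    move: clx; rewrite !closureU => -[[/closure_disc xa|/closure_disc xa]|/closure_disc xa].
    + by left; left; rewrite -zx in xa rn *; exact: (starE Sz xa rn).2.
    + by left; right; rewrite -zx in xa rn *; exact: (starM Sz xa rn).2.
    + left; rewrite -zx in xa rn *; apply: (rim Sz).
      by apply/eqP; rewrite eq_le xa.
by case: (CW q (connected_component_refl Hq)) => [[h|h]|h]; [constructor 1|constructor 2|constructor 3].
Qed.

Lemma earth_side (q : 'rV[R]_2) : enorm (q - earth mu) < t -> l < q 0 0.
Proof.
by move=> /norm_coord_le[+ _]; rewrite !mxE /= ltr_norml => /andP[h _]; rewrite /l; lra.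
Qed.

Lemma moon_side (q : 'rV[R]_2) : enorm (q - moon mu) < 1 - t -> q 0 0 < l.
Proof.
by move=> /norm_coord_le[+ _]; rewrite !mxE /= ltr_norml => /andP[_ h]; rewrite /l; lra.
Qed.

Let fE (z : phase) := dot (earth mu) z.2.
Let fM (z : phase) := dot (moon mu) z.2.

Definition above_form (z v : phase) : R :=
  if enorm (z.1 - ell) < r then lamf (blend mu t A sig) z v
  else if l < z.1 0 0 then lamf fE z v else lamf fM z v.

Lemma above_form_gt0 z : S z -> 0 < above_form z (X z).
Proof.
move=> [Sz Hz]; rewrite /above_form; case: (ltP (enorm (z.1 - ell)) r) => [nr|rn]; first exact: blend_gt0.
case: (above_inside Hz) => [h|h|h]; last by have := lt_le_trans h rn; rewrite ltxx.
  by rewrite (earth_side h) /fE lamf_dotX; exact: (starE Sz (ltW h) rn).1.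
rewrite (ltNge l) (ltW (moon_side h)) /= /fM lamf_dotX; exact: (starM Sz (ltW h) rn).1.
Qed.

Lemma near_fst (U : set 'rV[R]_2) : open U -> open [set z : phase | U z.1].
Proof. by move=> oU; apply: open_comp => // z _; exact: cvg_fst. Qed.

(** A point with |q - ell| >= r has a neighbourhood within |q - ell| > r / 2 on one side of l. Where
    that neighbourhood enters the neck, [collar] makes the blended form equal to the radial one on
    the level. *)
Lemma has_ext_d_above : has_ext_d S above_form omega.
Proof.
have sE : smooth fE by exact: smooth_dot_snd.
have sM : smooth fM by exact: smooth_dot_snd.
have sB := smooth_blend mu t A sig.
have piece (B : set 'rV[R]_2) f z : smooth f -> open B -> B z.1 ->
    (forall x v, B x.1 -> S x -> above_form x v = lamf f x v) ->
    exists (U : set phase) (a : phase -> phase -> R),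
    [/\ open U, U z, smooth_form_on U a & forall x, U x -> S x ->
        (forall u, tangent S x u -> above_form x u = a x u) /\
        (forall u v, tangent S x u -> tangent S x v -> omega x u v = ext_d a x u v)].
  move=> sf oB Bz E; exists [set x | B x.1], (lamf f); split => //.
  - exact: near_fst.
  - exact: lamf_smooth.
  - move=> x Bx Sx; split=> [u _|u v _ _]; first exact: E.
    by rewrite ext_d_lamf.
have oR : open [set q : 'rV[R]_2 | r / 2 < enorm (q - ell)].
  rewrite openE => q /= qr; rewrite /interior.
  have h := cont_enorm_sub (P := ell) (x := q).
  exact: (cvgr_gt _ h).
have co (q : 'rV[R]_2) : {for q, continuous (fun x : 'rV[R]_2 => x 0 0)}.
  exact: has_grad_cont (vgrad_id q 0).
have rh : r / 2 < r by rewrite ltr_pdivrMr // ltr_pMr // ltr1n.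
move=> z Sz; have [nr|rn] := ltP (enorm (z.1 - ell)) r.
  apply: (piece (disc ell r) _ _ sB) => //; first exact: open_disc.
  by move=> x v /= xr _; rewrite /above_form xr.
have zr := lt_le_trans rh rn.
have [h|h|h] := above_inside Sz.2; last by have := lt_le_trans h rn; rewrite ltxx.
  apply: (piece ([set q : 'rV[R]_2 | r / 2 < enorm (q - ell)] `&` [set q : 'rV[R]_2 | l < q 0 0]) _ _ sE).
  - apply: openI => //; rewrite openE => q /= qr; rewrite /interior; exact: (cvgr_gt _ (co q)).
  - by split => //; exact: earth_side.
  - move=> x v [/= x1 x2] [Sx _]; rewrite /above_form x2; case: ltP => // xr.
    apply: lamf_blend_earth => //; apply: (collar Sx _).1 => //; exact/andP.
apply: (piece ([set q : 'rV[R]_2 | r / 2 < enorm (q - ell)] `&` [set q : 'rV[R]_2 | q 0 0 < l]) _ _ sM).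
- apply: openI => //; rewrite openE => q /= qr; rewrite /interior; exact: (cvgr_lt _ (co q)).
- by split => //; exact: moon_side.
- move=> x v [/= x1 x2] [Sx _]; rewrite /above_form (ltNge l) (ltW x2) /=; case: ltP => // xr.
  apply: lamf_blend_moon => //; apply: (collar Sx _).2 => //; exact/andP.
Qed.

(** As in [below_regular]: if U = c and grad U = 0, then X vanishes at the rest point, against
    [above_form_gt0]. *)
Lemma above_open z : S z -> \forall x \near z, Sigma mu c x -> S x.
Proof.
move=> Sz; apply: (Sigma_part_open Sz).
have [Sigz Hz] := Sz; have [HH _ _] := Hz.
have [zE zM] := (HillE mu c z.1).1 HH; rewrite le_eqVlt => /orP[/eqP Uz|]; last by left.
right; have [Hr g0 gE] := rest_point zE zM.
pose z' : phase := (z.1, vec2 (- z.1 0 1) (z.1 0 0)).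
have Sz' : S z' by split => //; split => //=; rewrite Hr.
have := above_form_gt0 Sz'; rewrite /X g0 gE; apply: contraTneq => ->.
rewrite oppr0 -leNgt (_ : above_form _ _ = 0) // /above_form.
by case: ifP => _; last case: ifP => _; rewrite lamf0.
Qed.

Lemma above_contact : contact_form S above_form /\ compatible S omega above_form.
Proof.
split; last exact: has_ext_d_above.
exists omega; first exact: has_ext_d_above.
apply: (@volume_form_Ham2 _ (1 - mu) (earth mu) mu (moon mu) c).
- by move=> z; rewrite /above_form; case: ifP => _; last case: ifP => _; rewrite lamf0.
- by move=> z [[zE zM Hz] _]; rewrite -Ham_earth.
- move=> z Sz; have [[zE zM _] _] := Sz; have op := above_open Sz.
  have nE := near_fst_neq zE; have nM := near_fst_neq zM.
  near=> x => Hx; suff : Sigma mu c x -> S x.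
    by apply; split; [near: x|near: x|rewrite Ham_earth].
  by near: x.
- by move=> z Sz; rewrite gt_eqF // above_form_gt0.
Unshelve. all: by end_near. Qed.

Lemma near_contact (delta m : R) (e P P' : 'rV[R]_2) : primary mu m e P P' -> 0 < delta ->
  (forall z, S z -> enorm (z.1 - P) < delta ->
     dot (z.1 - P) (gradq m P (1 - m) P' z) != 0) ->
  contact_form (near_bar mu c delta P) can_form /\
  compatible (near_bar mu c delta P) can_omega can_form.
Proof.
move=> pr d0 star; split; last exact: has_ext_d_can_form.
exists can_omega; first exact: has_ext_d_can_form.
have /andP[m0 m1] := primary_mass mu01 pr.
apply: (@volume_form_reg _ m (1 - m) c P P' (Sigma_near mu c delta P)) => //.
- have := primary_dist pr; apply: contra_eqN => /eqP ->.
  by rewrite subrr /enorm dot0l sqrtr0 eq_sym oner_eq0.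
- by move=> z [[Sz _] _]; exact/(SigmaE pr).
- move=> z [Sz zd]; have op := above_open Sz.
  have [zP zP' _] := (SigmaE pr c z).1 Sz.1.
  have nP := near_fst_neq zP; have nP' := near_fst_neq zP'.
  have nd : \forall x \near z, enorm (x.1 - P) < delta.
    by apply: open_nbhs_nbhs; split => //; exact: (near_fst (@open_disc _ P delta)).
  near=> x => Hx; split; last by near: x.
  suff : Sigma mu c x -> S x.
    apply; apply/(SigmaE pr); split => //; by near: x.
  by near: x.
- by move=> z [Sz zd]; exact: star.
- move=> w clw wN.
  have TS : Sigma_near mu c delta P `<=` Sigma_part mu c [set earth mu; moon mu] by move=> z [].
  have [r1 r10 H] := closure_north mu01 pr TS clw wN.
  exists (Num.min r1 delta); first by rewrite lt_min r10.
  by move=> z zP zP' Hz; rewrite lt_min => /andP[h1 h2]; split => //; exact: H.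
Unshelve. all: by end_near. Qed.

Lemma enorm_subC n (u v : 'rV[R]_n) : enorm (u - v) = enorm (v - u).
Proof. by rewrite -opprB /enorm dotNl dotNr opprK. Qed.

Lemma away (P q : 'rV[R]_2) (a : R) : enorm (ell - P) = a -> r <= a / 2 ->
  enorm (q - P) < a / 4 -> r <= enorm (q - ell).
Proof.
move=> ea ra qa; have := enormD (ell - q) (q - P).
rewrite addrA subrK ea (enorm_subC ell) => h.
have := enorm_ge0 (q - P); lra.
Qed.

Lemma above_bar : Sigma_EM_bar_has_compatible_contact_form mu c.
Proof.
have /andP[t0 t1] := t01.
(* As r is at most half the distance from l1 to each primary, a quarter of it keeps the disc around
   the primary out of the neck. There [above_form] is radial, hence the pull-back of the canonical
   form. *)
pose delta := Num.min (t / 4) ((1 - t) / 4).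
have d0 : 0 < delta by rewrite lt_min !divr_gt0 // subr_gt0.
have dE (q : 'rV[R]_2) : enorm (q - earth mu) < delta ->
    r <= enorm (q - ell) /\ enorm (q - earth mu) < t.
  rewrite lt_min => /andP[h _]; split; first exact: away (ell_earth mu t01).2 rt h.
  by apply: lt_trans h _; lra.
have dM (q : 'rV[R]_2) : enorm (q - moon mu) < delta ->
    r <= enorm (q - ell) /\ enorm (q - moon mu) < 1 - t.
  rewrite lt_min => /andP[_ h]; split; first exact: away (ell_moon mu t01).2 rt' h.
  by apply: lt_trans h _; lra.
exists delta, above_form, can_form, can_form; split.
- by rewrite d0 /= gt_min; apply/orP; left; lra.
- exact: above_contact.
- apply: (near_contact (primary_earth mu)) => // z [Sz _] /dE[h1 h2].
  by rewrite (_ : 1 - (1 - mu) = mu); [rewrite gt_eqF // (starE Sz (ltW h2) h1).1|ring].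
- apply: (near_contact (primary_moon mu)) => // z [Sz _] /dM[h1 h2].
  rewrite /gradq [_ *: _ + _ *: _]addrC gt_eqF //; exact: (starM Sz (ltW h2) h1).1.
- split=> z v [[Sz Hz] zd] _.
    have [h1 h2] := dE _ zd.
    by rewrite Moser_can_form /above_form ltNge h1 /= (earth_side h2) /fE lamf_dot.
  have [h1 h2] := dM _ zd.
  by rewrite Moser_can_form /above_form ltNge h1 /= (ltNge l) (ltW (moon_side h2)) /= /fM lamf_dot.
Qed.

End Above.

Lemma gradU_l1 (R : realType) (mu t : R) (ell : 'rV[R]_2) : ell = vec2 (mu - t) 0 ->
  0 < t < 1 -> (forall v, is_derive ell v (Upot mu) 0) -> gradU mu ell = 0.
Proof.
move=> -> t01 d; have [rE rM] := ell_regular mu t01.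
apply/eqP; rewrite -dot_eq0 -(has_grad_Upot rE rM).2.
by have [_ ->] := d (gradU mu (vec2 (mu - t) 0)).
Qed.

Theorem theoremA (R : realType) (mu : R) (l1 : 'rV[R]_2) :
  0 < mu < 1 -> is_l1 mu l1 ->
  (forall c : R, c < Ham mu (L1 l1) ->
     (exists lam : amb R -> amb R -> R,
        contact_form (Sigma_bar mu c (earth mu)) lam /\
        compatible (Sigma_bar mu c (earth mu)) can_omega lam) /\
     (exists lam : amb R -> amb R -> R,
        contact_form (Sigma_bar mu c (moon mu)) lam /\
        compatible (Sigma_bar mu c (moon mu)) can_omega lam)) /\
  (exists eps : R, 0 < eps /\
     forall c : R, Ham mu (L1 l1) < c < Ham mu (L1 l1) + eps ->
       Sigma_EM_bar_has_compatible_contact_form mu c).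
Proof.
move=> mu01 [[t t01 l1E] d].
have {}l1E : l1 = vec2 (mu - t) 0.
  by rewrite l1E; apply: rV2P; rewrite !mxE /=; ring.
have crit := gradU_l1 l1E t01 d.
have [rE rM] := ell_regular mu t01; rewrite -l1E in rE rM.
have [-> _ _] := rest_point rE rM.
rewrite {}l1E in crit *; have [eE eM] := ellE mu t.
have t01' : 0 < 1 - t < 1 by case/andP: t01 => t0 t1; rewrite subr_gt0 t1 gtrBl.
split=> [c hc|].
  split; exists can_form.
    by apply: (below_contact mu01 (primary_earth mu) t01); rewrite -eE -(primary_Upot (primary_earth mu)).
  by apply: (below_contact mu01 (primary_moon mu) t01'); rewrite -eM -(primary_Upot (primary_moon mu)).
have [r [sig [eps0 [[r0 sig0 e0 rt rt'] H]]]] := neck_setup mu01 t01 crit.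
exists eps0; split => // c /H[h1 h2 h3 h4 h5].
exact: (above_bar mu01 t01 r0 sig0 rt rt' h1 h2 h3 h4 h5).
Qed.
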